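(* Let $M$ be a finite monoid and $p>0$ a prime which is nonmodular for $M$ (i.e., not modular). Let $(F,\mathcal O,k)$ be a splitting $p$-modular system for $M$. Let $e$ be a basic idempotent for $kM$. Then there is an idempotent $\tilde e\in\mathcal OM$ lifting $e$ such that $\tilde e$ is a basic idempotent of $FM$. Moreover, there is a quiver $Q$ and an ideal $I$ of $\mathcal OQ$ such that $F\otimes_{\mathcal O}I$ is an admissible ideal of $FQ$ with $FQ/(F\otimes_{\mathcal O}I)\cong\tilde eFM\tilde e$, and $k\otimes_{\mathcal O}I$ is an admissible ideal of $kQ$ with $kQ/(k\otimes_{\mathcal O}I)\cong ekMe$ (the tensor products being regarded as ideals of $FQ$ and $kQ$ via the natural maps induced by $I\subseteq\mathcal OQ$).
   Context: Strongly modular primes. For an idempotent $f\in M$: $G_f$ is the group of units of $fMf$ (the maximal subgroup at $f$); $L_f=\{m\in M\mid Mm=Mf\}$ and $R_f=\{m\in M\mid mM=fM\}$. $G_f$ acts freely on the right of $L_f$ and on the left of $R_f$ by multiplication. Put $\mathbb ZR_f^\vee=\operatorname{Hom}_{\mathbb ZG_f}(\mathbb ZR_f,\mathbb ZG_f)$ and let $\varphi_f\colon\mathbb ZL_f\to\mathbb ZR_f^\vee$ be the homomorphism given for $\ell\in L_f$, $r\in R_f$ by $\varphi_f(\ell)(r)=r\ell$ if $r\ell\in G_f$, and $0$ otherwise. A prime $p>0$ is strongly modular for $M$ if there is an idempotent $f\in M$ such that $p$ divides $|G_f|$ or the order of the torsion subgroup of $\operatorname{coker}\varphi_f$. Modular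 primes. Let $J=\mathrm{rad}(\mathbb QM)\cap\mathbb ZM$, a nilpotent ideal of $\mathbb ZM$, and let $n$ be the Loewy length of $\mathbb QM$, i.e., the least $n$ with $\mathrm{rad}(\mathbb QM)^n=0$. A prime $p$ is modular for $M$ if it is strongly modular for $M$ or it divides the order of the torsion subgroup of $J^s/J^{s+1}$ for some $1\leq s<n$. A (complete) $p$-modular system $(F,\mathcal O,k)$ consists of a complete discrete valuation ring $\mathcal O$ of characteristic $0$ with maximal ideal $\mathfrak m$, field of fractions $F$ and residue field $k=\mathcal O/\mathfrak m$ of characteristic $p$; it is splitting for $M$ if $F$ is a splitting field for $FM$ and $k$ is a splitting field for $kM$. Lifting $e$ means mapping to $e$ under the reduction $\mathcal OM\to kM$. Basic idempotent. For a finite dimensional algebra $A$ with a decomposition $1=\varepsilon_1+\cdots+\varepsilon_s$ into orthogonal primitive idempotents such that $\varepsilon_1,\ldots,\varepsilon_t$ are pairwise nonconjugate and represent all conjugacy classes of primitive idempotents of $A$, the idempotent $\varepsilon_1+\cdots+\varepsilon_t$ is called a basic idempotent of $A$. Quivers. A quiver $Q$ is a finite directed multigraph (loops allowed). For a commutative ring $R$, the path algebra $RQ$ has $R$-basis the directed paths in $Q$ (including an empty path at each vertex), with product given by concatenation (composing from right to left; undefined concatenations are $0$). The arrow ideal of $RQ$ is the ideal generated by the arrows. For a field $K$, an ideal $I'$ of $KQ$ is admissible if $B^a\subseteq I'\subseteq B^2$ for some $a\geq2$, where $B$ is the arrow ideal of $KQ$. *)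

(* Defs.v *)
From HB Require Import structures.
From mathcomp Require Import all_boot all_order all_algebra.
From mathcomp Require Import boolp.
From mathcomp Require Import finmap monalg.

Set Implicit Arguments.
Unset Strict Implicit.
Unset Printing Implicit Defensive.

Import GRing.Theory.

Local Open Scope ring_scope.
Local Open Scope quotient_scope.


Record zsubgroup (V : zmodType) := ZSubgroup {
  zsub_mem :> V -> Prop;
  zsub0 : zsub_mem 0;
  zsubB : forall x y, zsub_mem x -> zsub_mem y -> zsub_mem (x - y)
}.

Section ZSubgroup.
Variables (V : zmodType) (B : zsubgroup V).

Definition zsub_pred : pred V := fun x => `[< B x >].

Lemma zsub_pred_closed : zmod_closed zsub_pred.
Proof.
split; first exact/asboolP/zsub0.
by move=> x y /asboolP Bx /asboolP By; apply/asboolP/zsubB.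
Qed.

HB.instance Definition _ := GRing.isZmodClosed.Build V zsub_pred
  zsub_pred_closed.

Definition zsub_closed : zmodClosed V :=
  GRing.ZmodClosed.clone V zsub_pred _.

Definition zquot := Quotient.quot zsub_closed.

HB.instance Definition _ := GRing.Zmodule.on zquot.
HB.instance Definition _ := Quotient.on zquot.

Lemma zquotP (x y : V) : \pi_zquot x = \pi_zquot y <-> B (x - y).
Proof.
split=> [/eqP|Bxy]; first by rewrite -Quotient.idealrBE => /asboolP.
by apply/eqP; rewrite -Quotient.idealrBE; apply/asboolP.
Qed.

End ZSubgroup.

Record ideal (A : pzRingType) := Ideal {
  ideal_zsub :> zsubgroup A;
  idealMl : forall a x, ideal_zsub x -> ideal_zsub (a * x);
  idealMr : forall a x, ideal_zsub x -> ideal_zsub (x * a)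
}.

Definition ring_quot (A : pzRingType) (I : ideal A) := zquot I.

Section RingQuotient.
Variables (A : pzRingType) (I : ideal A).
Local Notation Q := (ring_quot I).

HB.instance Definition _ := GRing.Zmodule.on Q.
HB.instance Definition _ := Quotient.on Q.

Lemma ring_quotP (x y : A) : \pi_Q x = \pi_Q y <-> I (x - y).
Proof. exact: zquotP. Qed.

Lemma ring_quotK (x : A) : I (repr (\pi_Q x) - x).
Proof. by apply/ring_quotP; rewrite reprK. Qed.

Lemma pi_zmod_morphism : zmod_morphism (\pi_Q).
Proof. by move=> x y /=; rewrite !piE. Qed.

HB.instance Definition _ :=
  GRing.isZmodMorphism.Build A Q \pi_Q pi_zmod_morphism.

Definition quot_one : Q := \pi_Q 1.
Definition quot_mul : Q -> Q -> Q := lift_op2 Q *%R.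

Lemma idealD x y : I x -> I y -> I (x + y).
Proof.
move=> Ix Iy; rewrite -[y]opprK; apply: zsubB => //.
by rewrite -sub0r; apply: zsubB => //; apply: zsub0.
Qed.

Lemma pi_mul x y : \pi_Q (x * y) = quot_mul (\pi_Q x) (\pi_Q y).
Proof.
rewrite /quot_mul -lock; apply/esym/ring_quotP.
set x' := repr _; set y' := repr _.
have -> : x' * y' - x * y = (x' - x) * y' + x * (y' - y).
  by rewrite mulrBl mulrBr addrA subrK.
by apply: idealD; [apply: idealMr|apply: idealMl]; apply: ring_quotK.
Qed.

Lemma quot_mulA : associative quot_mul.
Proof.
elim/quotW=> x; elim/quotW=> y; elim/quotW=> z.
by rewrite -(pi_mul y z) -(pi_mul x y) -(pi_mul x _) -(pi_mul _ z) mulrA.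
Qed.

Lemma quot_mul1l : left_id quot_one quot_mul.
Proof. by elim/quotW=> x; rewrite -(pi_mul 1 x) mul1r. Qed.

Lemma quot_mul1r : right_id quot_one quot_mul.
Proof. by elim/quotW=> x; rewrite -(pi_mul x 1) mulr1. Qed.

Lemma quot_mulDl : left_distributive quot_mul +%R.
Proof.
elim/quotW=> x; elim/quotW=> y; elim/quotW=> z.
by rewrite -(pi_mul x z) -(pi_mul y z) -!raddfD -(pi_mul _ z) mulrDl.
Qed.

Lemma quot_mulDr : right_distributive quot_mul +%R.
Proof.
elim/quotW=> x; elim/quotW=> y; elim/quotW=> z.
by rewrite -(pi_mul x y) -(pi_mul x z) -!raddfD -(pi_mul x _) mulrDr.
Qed.

HB.instance Definition _ := GRing.Zmodule_isPzRing.Build Q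
  quot_mulA quot_mul1l quot_mul1r quot_mulDl quot_mulDr.

End RingQuotient.


Section Ideals.
Variable A : pzRingType.
Implicit Types I J m : A -> Prop.

Definition left_ideal I : Prop :=
  [/\ I 0, forall x y, I x -> I y -> I (x + y) & forall a x, I x -> I (a * x)].

Definition two_sided_ideal I : Prop :=
  left_ideal I /\ forall a x, I x -> I (x * a).

Definition maximal_left_ideal m : Prop :=
  [/\ left_ideal m, ~ m 1 &
      forall J, left_ideal J -> ~ J 1 ->
        (forall x, m x -> J x) -> forall x, J x -> m x].

Definition jacobson_radical : A -> Prop :=
  fun x => forall m, maximal_left_ideal m -> m x.

Definition ideal_prod I J : A -> Prop := fun x =>
  exists2 s : seq (A * A), forall u, u \in s -> I u.1 /\ J u.2
                         & x = \sum_(u <- s) u.1 * u.2.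

(* Here I^0 = A and I^1 = A * I, which is I for a left ideal I. *)
Fixpoint ideal_pow I n : A -> Prop :=
  if n is n'.+1 then ideal_prod (ideal_pow I n') I else fun=> True.

Definition generated_ideal (X : A -> Prop) : A -> Prop := fun x =>
  forall I, two_sided_ideal I -> (forall y, X y -> I y) -> I x.

Lemma ideal_pow0 I n : ideal_pow I n 0.
Proof. by case: n => //= n; exists [::]; rewrite ?big_nil. Qed.

Lemma ideal_powN I n x : ideal_pow I n x -> ideal_pow I n (- x).
Proof.
elim: n x => //= n IHn _ [s sP ->].
exists [seq (- u.1, u.2) | u <- s].
  by move=> _ /mapP[u /sP[u1 u2] ->]; split=> //; apply: IHn.
by rewrite big_map raddf_sum; apply: eq_bigr => u _; rewrite mulNr.
Qed.

Lemma ideal_powB I n x y :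
  ideal_pow I n x -> ideal_pow I n y -> ideal_pow I n (x - y).
Proof.
move=> Ix /ideal_powN; case: n Ix => //= n [s sP ->] [t tP ->].
exists (s ++ t); last by rewrite big_cat.
by move=> u; rewrite mem_cat => /orP[/sP|/tP].
Qed.

Definition ideal_pow_zsub I n : zsubgroup A :=
  ZSubgroup (ideal_pow0 I n) (@ideal_powB I n).

End Ideals.


Section Idempotents.
Variable A : pzRingType.

Definition primitive_idempotent (e : A) : Prop :=
  [/\ e * e = e, e != 0 &
      forall a b, a * a = a -> b * b = b -> a * b = 0 -> b * a = 0 ->
        e = a + b -> a = 0 \/ b = 0].

Definition conjugate (e f : A) : Prop :=
  exists u v, [/\ u * v = 1, v * u = 1 & f = u * e * v].

Definition basic_idempotent (e : A) : Prop :=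
  exists (s t : nat) (eps : 'I_s -> A),
    [/\ (t <= s)%N,
        \sum_i eps i = 1,
        forall i, primitive_idempotent (eps i),
        forall i j, i != j -> eps i * eps j = 0 &
        [/\ forall i j : 'I_s, (i < t)%N -> (j < t)%N -> i != j ->
              ~ conjugate (eps i) (eps j),
            forall x, primitive_idempotent x ->
              exists2 i : 'I_s, (i < t)%N & conjugate (eps i) x &
            e = \sum_(i < s | (i < t)%N) eps i]].

Definition idem := {e : A | e * e == e}.

HB.instance Definition _ := SubChoice.on idem.

End Idempotents.

Section Corner.
Variables (K : comNzRingType) (A : algType K) (e : idem A).

Definition corner_pred : pred A := fun x => val e * x * val e == x.

Lemma corner_submod_closed : submod_closed corner_pred.
Proof.
split=> [|c x y /eqP xP /eqP yP]; rewrite /corner_pred unfold_in.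
  by rewrite mulr0 mul0r.
by rewrite mulrDr mulrDl -scalerAr -scalerAl xP yP.
Qed.

HB.instance Definition _ := GRing.isSubmodClosed.Build K A corner_pred
  corner_submod_closed.

Definition corner := {x : A | corner_pred x}.

HB.instance Definition _ := SubChoice.on corner.
HB.instance Definition _ := [SubChoice_isSubLmodule of corner by <:].

Lemma idem_mul : val e * val e = val e. Proof. exact/eqP/(valP e). Qed.

Lemma corner_oneP : corner_pred (val e).
Proof. by rewrite /corner_pred !idem_mul. Qed.

Lemma corner_mull (x : corner) : val e * val x = val x.
Proof. by rewrite -(eqP (valP x)) !mulrA idem_mul. Qed.

Lemma corner_mulr (x : corner) : val x * val e = val x.
Proof. by rewrite -(eqP (valP x)) -!mulrA idem_mul. Qed.

Lemma corner_mulP (x y : corner) : corner_pred (val x * val y).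
Proof. by rewrite /corner_pred mulrA corner_mull -mulrA corner_mulr. Qed.

Definition corner_one : corner := Sub (val e) corner_oneP.
Definition corner_mul (x y : corner) : corner :=
  Sub (val x * val y) (corner_mulP x y).

Lemma corner_mulA : associative corner_mul.
Proof. by move=> x y z; apply: val_inj; rewrite /= mulrA. Qed.

Lemma corner_mul1l : left_id corner_one corner_mul.
Proof. by move=> x; apply: val_inj; rewrite /= corner_mull. Qed.

Lemma corner_mul1r : right_id corner_one corner_mul.
Proof. by move=> x; apply: val_inj; rewrite /= corner_mulr. Qed.

Lemma corner_mulDl : left_distributive corner_mul +%R.
Proof. by move=> x y z; apply: val_inj; rewrite /= mulrDl. Qed.

Lemma corner_mulDr : right_distributive corner_mul +%R.
Proof. by move=> x y z; apply: val_inj; rewrite /= mulrDr. Qed.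

HB.instance Definition _ := GRing.Zmodule_isPzRing.Build corner
  corner_mulA corner_mul1l corner_mul1r corner_mulDl corner_mulDr.

End Corner.


Section Modules.
Variables (K : fieldType) (A : algType K).

Definition simple_module (S : lmodType A) : Prop :=
  (exists v : S, v != 0) /\
  forall N : S -> Prop,
    N 0 -> (forall u v, N u -> N v -> N (u + v)) ->
    (forall a v, N v -> N (a *: v)) ->
    (forall v, N v -> v = 0) \/ (forall v, N v).

(* End_A(S) = K for every simple A-module S *)
Definition splitting_field : Prop :=
  forall S : lmodType A, simple_module S ->
  forall f : {linear S -> S}, exists c : K, forall v, f v = c%:A *: v.

End Modules.


#[short(type="finMonoidType")]
HB.structure Definition FinMonoid := {M of Monoid M & Finite M}.

(* An alias of {ffun M -> R^o}, with the convolution product instead of the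
   pointwise one. *)
Definition monoid_algebra (M : finMonoidType) (R : comNzRingType) :=
  {ffun M -> R^o}.

Section MonoidAlgebra.
Variables (M : finMonoidType) (R : comNzRingType).
Local Notation RM := (monoid_algebra M R).

HB.instance Definition _ := Vector.copy RM {ffun M -> R^o}.

Definition madelta (m : M) : RM := [ffun m' => (m' == m)%:R].

Definition ma_mul (x y : RM) : RM :=
  [ffun m => \sum_a \sum_(b | (a * b)%g == m) x a * y b].

Lemma ma_mulE x y m :
  ma_mul x y m = \sum_a \sum_b (x a * y b) *+ ((a * b)%g == m).
Proof.
rewrite ffunE; apply: eq_bigr => a _; rewrite big_mkcond /=.
by apply: eq_bigr => b _; case: eqP.
Qed.

Lemma ma_mulA : associative ma_mul.
Proof.
move=> x y z; apply/ffunP => m; rewrite !ma_mulE.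
transitivity (\sum_a \sum_b \sum_c
    (x a * y b * z c) *+ ((a * b * c)%g == m)).
  apply: eq_bigr => a _.
  transitivity (\sum_d \sum_b \sum_c
      ((x a * y b * z c) *+ ((b * c)%g == d) *+ ((a * d)%g == m))).
    apply: eq_bigr => d _; rewrite ma_mulE mulr_sumr -sumrMnl.
    apply: eq_bigr => b _; rewrite mulr_sumr -sumrMnl; apply: eq_bigr => c _.
    by rewrite -!mulrnAr !mulrA.
  rewrite exchange_big; apply: eq_bigr => b _.
  rewrite exchange_big; apply: eq_bigr => c _.
  rewrite (bigD1 (b * c)%g) //= eqxx mulr1n mulgA big1 ?addr0 // => d.
  by rewrite eq_sym => /negbTE->; rewrite mulr0n mul0rn.
symmetry.
transitivity (\sum_d \sum_c \sum_a \sum_b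
    ((x a * y b * z c) *+ ((a * b)%g == d) *+ ((d * c)%g == m))).
  apply: eq_bigr => d _; apply: eq_bigr => c _.
  rewrite ma_mulE mulr_suml -sumrMnl.
  apply: eq_bigr => a _; rewrite mulr_suml -sumrMnl; apply: eq_bigr => b _.
  by rewrite mulrnAl.
rewrite exchange_big /=.
under eq_bigr => c _ do rewrite exchange_big /=.
rewrite exchange_big /=; apply: eq_bigr => a _.
under eq_bigr => c _ do rewrite exchange_big /=.
rewrite exchange_big /=; apply: eq_bigr => b _; apply: eq_bigr => c _.
rewrite (bigD1 (a * b)%g) //= eqxx mulr1n big1 ?addr0 // => d.
by rewrite eq_sym => /negbTE->; rewrite mulr0n mul0rn.
Qed.

Lemma ma_mul1l : left_id (madelta 1%g) ma_mul.
Proof.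
move=> x; apply/ffunP => m; rewrite ma_mulE (bigD1 1%g) //= [X in _ + X]big1 ?addr0.
  rewrite (bigD1 m) //= ffunE mul1g !eqxx mul1r big1 ?addr0 // => b.
  by rewrite mul1g => /negbTE->.
by move=> a /negbTE a1; apply: big1 => b _; rewrite ffunE a1 mul0r mul0rn.
Qed.

Lemma ma_mul1r : right_id (madelta 1%g) ma_mul.
Proof.
move=> x; apply/ffunP => m; rewrite ma_mulE exchange_big (bigD1 1%g) //=.
rewrite [X in _ + X]big1 ?addr0.
  rewrite (bigD1 m) //= ffunE mulg1 !eqxx mulr1 big1 ?addr0 // => a.
  by rewrite mulg1 => /negbTE->.
by move=> b /negbTE b1; apply: big1 => a _; rewrite ffunE b1 mulr0 mul0rn.
Qed.

Lemma ma_mulDl : left_distributive ma_mul +%R.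
Proof.
move=> x y z; apply/ffunP => m; rewrite [RHS]ffunE !ma_mulE -big_split /=.
apply: eq_bigr => a _; rewrite -big_split; apply: eq_bigr => b _.
by rewrite ffunE mulrDl mulrnDl.
Qed.

Lemma ma_mulDr : right_distributive ma_mul +%R.
Proof.
move=> x y z; apply/ffunP => m; rewrite [RHS]ffunE !ma_mulE -big_split /=.
apply: eq_bigr => a _; rewrite -big_split; apply: eq_bigr => b _.
by rewrite ffunE mulrDr mulrnDl.
Qed.

Lemma madelta1_neq0 : madelta 1%g != 0.
Proof. by apply/eqP => /ffunP/(_ 1%g)/eqP; rewrite !ffunE eqxx oner_eq0. Qed.

HB.instance Definition _ := GRing.Zmodule_isNzRing.Build RM
  ma_mulA ma_mul1l ma_mul1r ma_mulDl ma_mulDr madelta1_neq0.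

Lemma ma_scaleE (c : R) (x : RM) m : (c *: x) m = c * x m.
Proof. exact: (ffunE (fun a => c * x a) m). Qed.

Lemma ma_scaleAl (c : R) (x y : RM) : c *: (x * y) = (c *: x) * y.
Proof.
apply/ffunP => m; rewrite ma_scaleE !ma_mulE mulr_sumr.
apply: eq_bigr => a _; rewrite mulr_sumr; apply: eq_bigr => b _.
by rewrite ma_scaleE -mulrA mulrnAr.
Qed.

HB.instance Definition _ := GRing.Lmodule_isLalgebra.Build R RM ma_scaleAl.

Lemma ma_scaleAr (c : R) (x y : RM) : c *: (x * y) = x * (c *: y).
Proof.
apply/ffunP => m; rewrite ma_scaleE !ma_mulE mulr_sumr.
apply: eq_bigr => a _; rewrite mulr_sumr; apply: eq_bigr => b _.
by rewrite ma_scaleE mulrnAr mulrCA.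
Qed.

HB.instance Definition _ := GRing.Lalgebra_isAlgebra.Build R RM ma_scaleAr.

End MonoidAlgebra.

Section MapMonoidAlgebra.
Variables (M : finMonoidType) (R S : comNzRingType) (h : {rmorphism R -> S}).

Definition map_ma (x : monoid_algebra M R) : monoid_algebra M S :=
  [ffun m => h (x m)].

Lemma map_maM x y : map_ma (x * y) = map_ma x * map_ma y.
Proof.
apply/ffunP => m; rewrite ffunE [in LHS]ma_mulE [in RHS]ma_mulE rmorph_sum.
apply: eq_bigr => a _; rewrite rmorph_sum; apply: eq_bigr => b _.
by rewrite !ffunE rmorphMn rmorphM.
Qed.

Lemma map_ma_idem (e : idem (monoid_algebra M R)) :
  map_ma (val e) * map_ma (val e) == map_ma (val e).
Proof. by rewrite -map_maM (eqP (valP e)). Qed.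

Definition map_idem (e : idem (monoid_algebra M R)) :
  idem (monoid_algebra M S) :=
  exist (fun x => x * x == x) (map_ma (val e)) (map_ma_idem e).

End MapMonoidAlgebra.


Section Torsion.
Variable V : zmodType.

(* The torsion subgroup of A / B, seen inside V / B *)
Definition quot_torsion (A : V -> Prop) (B : zsubgroup V) : zquot B -> Prop :=
  fun x => (exists2 a, A a & x = \pi_(zquot B) a) /\
           exists2 n, (0 < n)%N & x *+ n = 0.

(* X is finite and p divides its cardinality *)
Definition dvd_card (T : eqType) (p : nat) (X : T -> Prop) : Prop :=
  exists s : seq T, [/\ uniq s, forall x, x \in s <-> X x & (p %| size s)%N].

Definition dvd_torsion (p : nat) (A : V -> Prop) (B : zsubgroup V) : Prop :=
  dvd_card p (@quot_torsion A B).

End Torsion.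


Section AtIdempotent.
Variable M : finMonoidType.
Local Open Scope group_scope.

Definition midem := {f : M | f * f == f}.

Variable f : midem.
Local Notation f0 := (val f).

Lemma midemE : f0 * f0 = f0. Proof. exact/eqP/(valP f). Qed.

Definition unit_at : pred M := fun m =>
  (f0 * m * f0 == m) &&
  [exists n, [&& f0 * n * f0 == n, m * n == f0 & n * m == f0]].

Definition maxgroup := {m : M | unit_at m}.

HB.instance Definition _ := SubFinite.on maxgroup.

Lemma maxgroup_f (g : maxgroup) :
  f0 * val g = val g /\ val g * f0 = val g.
Proof.
have /andP[/eqP gP _] := valP g; rewrite -gP.
by split; rewrite -?mulgA ?midemE // !mulgA midemE.
Qed.

Lemma maxgroup_oneP : unit_at f0.
Proof.
rewrite /unit_at !midemE eqxx /=; apply/existsP; exists f0.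
by rewrite !midemE !eqxx.
Qed.

Lemma maxgroup_mulP (g h : maxgroup) : unit_at (val g * val h).
Proof.
have [fg gf] := maxgroup_f g; have [fh hf] := maxgroup_f h.
have /andP[_ /existsP[g' /and3P[/eqP g'P /eqP gg' /eqP g'g]]] := valP g.
have /andP[_ /existsP[h' /and3P[/eqP h'P /eqP hh' /eqP h'h]]] := valP h.
rewrite /unit_at mulgA fg -mulgA hf eqxx /=; apply/existsP; exists (h' * g').
have fg' : f0 * g' = g' by rewrite -g'P !mulgA midemE.
have g'f : g' * f0 = g' by rewrite -g'P -!mulgA midemE.
have fh' : f0 * h' = h' by rewrite -h'P !mulgA midemE.
apply/and3P; split; apply/eqP.
- by rewrite mulgA fh' -mulgA g'f.
- by rewrite mulgA -[val g * val h * h']mulgA hh' gf gg'.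
- by rewrite mulgA -[h' * g' * val g]mulgA g'g -mulgA fh h'h.
Qed.

Definition maxgroup_one : maxgroup := Sub f0 maxgroup_oneP.
Definition maxgroup_mul (g h : maxgroup) : maxgroup :=
  Sub (val g * val h) (maxgroup_mulP g h).

Lemma maxgroup_mulA : associative maxgroup_mul.
Proof. by move=> x y z; apply: val_inj; rewrite /= mulgA. Qed.

Lemma maxgroup_mul1l : left_id maxgroup_one maxgroup_mul.
Proof. by move=> x; apply: val_inj; rewrite /= (maxgroup_f x).1. Qed.

Lemma maxgroup_mul1r : right_id maxgroup_one maxgroup_mul.
Proof. by move=> x; apply: val_inj; rewrite /= (maxgroup_f x).2. Qed.

HB.instance Definition _ := isMonoid.Build maxgroup
  maxgroup_mulA maxgroup_mul1l maxgroup_mul1r.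

Definition Lclass := {m : M | [set x * m | x : M] == [set x * f0 | x : M]}.
Definition Rclass := {m : M | [set m * x | x : M] == [set f0 * x | x : M]}.

HB.instance Definition _ := SubFinite.on Lclass.
HB.instance Definition _ := SubFinite.on Rclass.

Lemma Rclass_actP (g : maxgroup) (r : Rclass) :
  [set val g * val r * x | x : M] == [set f0 * x | x : M].
Proof.
have /eqP rP := valP r; have [fg gf] := maxgroup_f g.
have /andP[_ /existsP[g' /and3P[/eqP g'P /eqP gg' _]]] := valP g.
have fg' : f0 * g' = g' by rewrite -g'P !mulgA midemE.
apply/eqP/setP => m; apply/imsetP/imsetP => -[x _ ->].
  by exists (val g * val r * x); rewrite // !mulgA fg.
have: g' * (f0 * x) \in [set val r * y | y : M].
  by rewrite rP; apply/imsetP; exists (g' * (f0 * x)); rewrite // [RHS]mulgA fg'.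
by case/imsetP=> y _ ry; exists y; rewrite // -mulgA -ry mulgA gg' mulgA midemE.
Qed.

Definition Rclass_act (g : maxgroup) (r : Rclass) : Rclass :=
  exist _ (val g * val r) (Rclass_actP g r).

Local Open Scope ring_scope.

Definition ZG := monoid_algebra maxgroup int.
Definition ZL := {ffun Lclass -> int^o}.
Definition ZR := {ffun Rclass -> int^o}.

Definition ZRdelta (r : Rclass) : ZR := [ffun r' => (r' == r)%:R].

Definition ZR_act (a : ZG) (y : ZR) : ZR :=
  \sum_g \sum_r (a g * y r) *: ZRdelta (Rclass_act g r).

(* Hom_ZG(ZR, ZG), as a subgroup of Hom_Z(ZR, ZG) *)
Definition ZRdual : 'Hom(ZR, ZG) -> Prop :=
  fun psi => forall (a : ZG) (y : ZR), psi (ZR_act a y) = a * psi y.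

Definition phi_basis (l : Lclass) (r : Rclass) : ZG :=
  if (insub (val r * val l)%g : option maxgroup) is Some g then madelta int g else 0.

Definition phi_fun (l : Lclass) (y : ZR) : ZG := \sum_r y r *: phi_basis l r.

Lemma phi_fun_is_linear l : linear (phi_fun l).
Proof.
move=> c x y; rewrite /phi_fun scaler_sumr -big_split /=.
by apply: eq_bigr => r _; rewrite !ffunE scalerDl scalerA.
Qed.

HB.instance Definition _ l := GRing.isLinear.Build int ZR ZG *:%R (phi_fun l)
  (phi_fun_is_linear l).

Definition phi (x : ZL) : 'Hom(ZR, ZG) := \sum_l x l *: linfun (phi_fun l).

Lemma phiE x y : phi x y = \sum_l \sum_r (x l * y r) *: phi_basis l r.
Proof.
rewrite sum_lfunE; apply: eq_bigr => l _.
rewrite scale_lfunE lfunE /= scaler_sumr.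
by apply: eq_bigr => r _; rewrite scalerA.
Qed.

Definition phi_image : 'Hom(ZR, ZG) -> Prop := fun psi => exists x, psi = phi x.

Lemma phi_image0 : phi_image 0.
Proof.
by exists 0; rewrite /phi big1 // => l _; rewrite ffunE scale0r.
Qed.

Lemma phi_imageB u v : phi_image u -> phi_image v -> phi_image (u - v).
Proof.
move=> [x ->] [y ->]; exists (x - y); rewrite /phi -sumrB.
by apply: eq_bigr => l _; rewrite !ffunE scalerBl.
Qed.

Definition phi_image_zsub : zsubgroup 'Hom(ZR, ZG) :=
  ZSubgroup phi_image0 phi_imageB.

End AtIdempotent.

Definition strongly_modular (M : finMonoidType) (p : nat) : Prop :=
  exists f : midem M,
    (p %| #|{: maxgroup f}|)%N \/ dvd_torsion p (@ZRdual M f) (phi_image_zsub f).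


(* rad(QM) \cap ZM, ZM being embedded in QM *)
Definition int_radical (M : finMonoidType) : monoid_algebra M int -> Prop :=
  fun x => jacobson_radical (map_ma (intr : {rmorphism int -> rat}) x).

Definition is_loewy_length (M : finMonoidType) (n : nat) : Prop :=
  let nilp m := forall x : monoid_algebra M rat,
    ideal_pow (@jacobson_radical (monoid_algebra M rat)) m x -> x = 0 in
  nilp n /\ forall m, nilp m -> (n <= m)%N.

Definition modular (M : finMonoidType) (p : nat) : Prop :=
  strongly_modular M p \/
  exists n s, [/\ is_loewy_length M n, (1 <= s < n)%N &
    dvd_torsion p (ideal_pow (@int_radical M) s)
                  (ideal_pow_zsub (@int_radical M) s.+1)].


Section ModularSystem.
Variable O : idomainType.

Definition unique_maximal_ideal (m : O -> Prop) : Prop :=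
  maximal_left_ideal m /\
  forall m', maximal_left_ideal m' -> forall x, m' x <-> m x.

(* A local principal ideal domain that is not a field *)
Definition discrete_valuation_ring (m : O -> Prop) : Prop :=
  [/\ forall I : O -> Prop, left_ideal I ->
        exists g, forall x, I x <-> exists a, x = a * g,
      unique_maximal_ideal m &
      exists2 x, m x & x != 0].

Definition adically_complete (m : O -> Prop) : Prop :=
  forall u : nat -> O,
    (forall N, exists n0, forall i j, (n0 <= i)%N -> (n0 <= j)%N ->
       ideal_pow m N (u i - u j)) ->
    exists l, forall N, exists n0, forall i, (n0 <= i)%N ->
       ideal_pow m N (u i - l).

(* The last conditions say that F is the field of fractions of O, through
   iota, and that k is its residue field O / m, through rho. *)
Definition modular_system (p : nat) (F k : fieldType)
    (iota : {rmorphism O -> F}) (rho : {rmorphism O -> k}) : Prop :=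
  exists m : O -> Prop,
    [/\ discrete_valuation_ring m /\ adically_complete m,
        [pchar O] =i pred0,
        injective iota /\
        (forall x, exists a b, b != 0 /\ x = iota a / iota b),
        (forall y, exists a, y = rho a) /\ (forall a, rho a = 0 <-> m a) &
        p \in [pchar k]].

End ModularSystem.


Record quiver := Quiver {
  vertex : finType;
  arrow : finType;
  src : arrow -> vertex;
  tgt : arrow -> vertex
}.

Section Paths.
Variable Q : quiver.
Implicit Types (v : vertex Q) (s t : seq (arrow Q)).

(* The arrows of a path are listed in the order in which they are travelled. *)
Fixpoint walk v s : bool :=
  if s is a :: s' then (src a == v) && walk (tgt a) s' else true.

Definition walk_end v s := last v (map (@tgt Q) s).

Definition qpath := {x : vertex Q * seq (arrow Q) | walk x.1 x.2}.

HB.instance Definition _ := SubChoice.on qpath.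

Definition psrc (p : qpath) := (val p).1.
Definition parrows (p : qpath) := (val p).2.
Definition ptgt (p : qpath) := walk_end (psrc p) (parrows p).

Lemma walk_cat v s t : walk v (s ++ t) = walk v s && walk (walk_end v s) t.
Proof. by elim: s v => //= a s IHs v; rewrite IHs andbA. Qed.

Lemma walk_end_cat v s t : walk_end v (s ++ t) = walk_end (walk_end v s) t.
Proof. by rewrite /walk_end map_cat last_cat. Qed.

Lemma walk1 (a : arrow Q) : walk (src a) [:: a].
Proof. by rewrite /= eqxx. Qed.

Definition empty_path v : qpath := exist _ (v, [::]) isT.
Definition arrow_path (a : arrow Q) : qpath :=
  exist _ (src a, [:: a]) (walk1 a).

(* The concatenation p q, from right to left: first q, then p *)
Definition pcomp (p q : qpath) : option qpath :=
  if ptgt q == psrc p then insub (psrc q, parrows q ++ parrows p) else None.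

Variant pcomp_spec (p q : qpath) : option qpath -> Type :=
| PCompSome r of ptgt q = psrc p & psrc r = psrc q & ptgt r = ptgt p &
    parrows r = parrows q ++ parrows p : pcomp_spec p q (Some r)
| PCompNone of ptgt q <> psrc p : pcomp_spec p q None.

Lemma pcompP p q : pcomp_spec p q (pcomp p q).
Proof.
rewrite /pcomp; case: eqP => [tq|]; last by constructor.
have w : walk (psrc q) (parrows q ++ parrows p).
  by rewrite walk_cat (valP q) -/(ptgt q) tq (valP p).
rewrite insubT; constructor=> //.
by rewrite {1}/ptgt /psrc /parrows /= walk_end_cat -/(ptgt q) tq.
Qed.

Lemma qpath_inj p q : psrc p = psrc q -> parrows p = parrows q -> p = q.
Proof.
move=> s t; apply: val_inj; rewrite [val p]surjective_pairing.
by rewrite [val q]surjective_pairing; congr (_, _).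
Qed.

Lemma pcompA p q r :
  obind (pcomp p) (pcomp q r) = obind (pcomp^~ r) (pcomp p q).
Proof.
case: (pcompP q r) (pcompP p q) => [s qr ss st sa|qr] [t pq ts tt ta|pq] //=.
- case: (pcompP p s) (pcompP t r) => [u ps us ut ua|ps] [w tr ws wt wa|tr] //.
  + congr Some; apply: qpath_inj; first by rewrite us ws.
    by rewrite ua wa sa ta catA.
  + by case: tr; rewrite ts.
  + by case: ps; rewrite st.
- by case: pcompP => // u ps; case: pq; rewrite -st.
- by case: pcompP => // u tr; case: qr; rewrite -ts.
Qed.

Lemma pcomp_emptyl v q :
  pcomp (empty_path v) q = if ptgt q == v then Some q else None.
Proof.
case: pcompP => [r qv rs _ ra|]; last by move/eqP/negbTE->.
by rewrite qv eqxx; congr Some; apply: qpath_inj; rewrite // ra cats0.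
Qed.

Lemma pcomp_emptyr p v :
  pcomp p (empty_path v) = if psrc p == v then Some p else None.
Proof.
case: pcompP => [r pv rs _ ra|]; rewrite eq_sym; last by move/eqP/negbTE->.
by rewrite -pv eqxx; congr Some; apply: qpath_inj; rewrite // rs -pv.
Qed.

End Paths.

(* Finitely supported functions on paths: the free R-module on paths *)
Definition path_algebra (R : comNzRingType) (Q : quiver) := {malg R[qpath Q]}.

HB.instance Definition _ (R : comNzRingType) (Q : quiver) :=
  GRing.Lmodule.copy (path_algebra R Q) {malg R[qpath Q]}.

HB.lock Definition pterm (R : comNzRingType) (Q : quiver) (c : R)
    (p : qpath Q) : path_algebra R Q := << c *g p >>.

Definition pmono (R : comNzRingType) (Q : quiver) (c : R)
    (o : option (qpath Q)) : path_algebra R Q :=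
  if o is Some p then pterm c p else 0.

HB.lock Definition pa_mul (R : comNzRingType) (Q : quiver)
    (x y : path_algebra R Q) : path_algebra R Q :=
  \sum_(p <- msupp x) \sum_(q <- msupp y) pmono (x@_p * y@_q) (pcomp p q).

Section PathAlgebra.
Variables (R : comNzRingType) (Q : quiver).
Local Notation RQ := (path_algebra R Q).
Implicit Types (x y z : RQ) (p q r : qpath Q) (c d : R).

Definition pa_one : RQ := \sum_v pterm 1 (empty_path v).

Local Notation pterm := (@pterm R Q).
Local Notation pmono := (@pmono R Q).
Local Notation pa_mul := (@pa_mul R Q).

Lemma mcoeff_pterm c p q : (pterm c p)@_q = c *+ (p == q).
Proof. by rewrite pterm.unlock mcoeffU. Qed.

Lemma pterm0 p : pterm 0 p = 0.
Proof. by rewrite pterm.unlock monalgU0. Qed.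

Lemma ptermD p : {morph pterm^~ p : c d / c + d}.
Proof. by move=> c d; rewrite pterm.unlock monalgUD. Qed.

Lemma msupp_pterm c p : (msupp (pterm c p) `<=` [fset p])%fset.
Proof. by rewrite pterm.unlock msuppU_le. Qed.

Lemma ptermE x : x = \sum_(p <- msupp x) pterm x@_p p.
Proof. by rewrite [LHS]monalgE; apply: eq_bigr => p _; rewrite pterm.unlock. Qed.

Lemma pmono0 o : pmono 0 o = 0.
Proof. by case: o => //= p; apply: pterm0. Qed.

Lemma pmonoD o : {morph pmono^~ o : c d / c + d}.
Proof. by case: o => [p|] c d /=; rewrite ?ptermD ?addr0. Qed.

Lemma pa_mulw (D E : {fset qpath Q}) x y :
  (msupp x `<=` D)%fset -> (msupp y `<=` E)%fset ->
  pa_mul x y = \sum_(p <- D) \sum_(q <- E) pmono (x@_p * y@_q) (pcomp p q).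
Proof.
move=> xD yE; rewrite pa_mul.unlock (big_fset_incl _ xD) /= => [|p _ /mcoeff_outdom xp].
  apply: eq_bigr => p _; apply: big_fset_incl => // q _ /mcoeff_outdom ->.
  by rewrite mulr0 pmono0.
by rewrite big1 // => q _; rewrite xp mul0r pmono0.
Qed.

Lemma pa_mulDl : left_distributive pa_mul +%R.
Proof.
move=> x y z; pose D := (msupp x `|` msupp y)%fset.
rewrite (@pa_mulw D (msupp z) (x + y)) ?msuppD_le //.
rewrite (@pa_mulw D (msupp z) x) ?fsubsetUl //.
rewrite (@pa_mulw D (msupp z) y) ?fsubsetUr // -big_split /=.
apply: eq_bigr => p _; rewrite -big_split; apply: eq_bigr => q _ /=.
by rewrite mcoeffD mulrDl pmonoD.
Qed.

Lemma pa_mulDr : right_distributive pa_mul +%R.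
Proof.
move=> x y z; pose D := (msupp y `|` msupp z)%fset.
rewrite (@pa_mulw (msupp x) D x (y + z)) ?msuppD_le //.
rewrite (@pa_mulw (msupp x) D x y) ?fsubsetUl //.
rewrite (@pa_mulw (msupp x) D x z) ?fsubsetUr // -big_split /=.
apply: eq_bigr => p _; rewrite -big_split; apply: eq_bigr => q _ /=.
by rewrite mcoeffD mulrDr pmonoD.
Qed.

Lemma pa_mulUU c d p q :
  pa_mul (pterm c p) (pterm d q) = pmono (c * d) (pcomp p q).
Proof.
rewrite (pa_mulw (msupp_pterm c p) (msupp_pterm d q)) !big_seq_fset1.
by rewrite 2!mcoeff_pterm !eqxx.
Qed.

Lemma pa_mul0l y : pa_mul 0 y = 0.
Proof. by apply: (addIr (pa_mul 0 y)); rewrite -pa_mulDl !add0r. Qed.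

Lemma pa_mul0r x : pa_mul x 0 = 0.
Proof. by apply: (addIr (pa_mul x 0)); rewrite -pa_mulDr !add0r. Qed.

Lemma pa_ind (P : RQ -> Prop) :
  P 0 -> (forall x y, P x -> P y -> P (x + y)) ->
  (forall c p, P (pterm c p)) -> forall x, P x.
Proof. by move=> P0 PD PU x; rewrite [x]ptermE; apply: big_ind. Qed.

Lemma pa_mulUo c d p o :
  pa_mul (pterm c p) (pmono d o) = pmono (c * d) (obind (pcomp p) o).
Proof. by case: o => [q|]; [exact: pa_mulUU|exact: pa_mul0r]. Qed.

Lemma pa_muloU c d o q :
  pa_mul (pmono c o) (pterm d q) = pmono (c * d) (obind (fun p => pcomp p q) o).
Proof. by case: o => [p|]; [exact: pa_mulUU|exact: pa_mul0l]. Qed.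

Lemma pa_mulA : associative pa_mul.
Proof.
elim/pa_ind => [|x x' IHx IHx'|c p] y z.
- by rewrite !pa_mul0l.
- by rewrite !pa_mulDl IHx IHx'.
elim/pa_ind: y => [|y y' |d q].
- by move: (pterm c p) => u; rewrite pa_mul0l pa_mul0r pa_mul0l.
- move: (pterm c p) => u IHy IHy'.
  by rewrite pa_mulDl !pa_mulDr pa_mulDl IHy IHy'.
elim/pa_ind: z => [|z z'|e r].
- by move: (pterm c p) (pterm d q) => u v; rewrite !pa_mul0r.
- move: (pterm c p) (pterm d q) => u v IHz IHz'.
  by rewrite !pa_mulDr IHz IHz'.
rewrite [X in pa_mul _ X = _]pa_mulUU [X in _ = pa_mul X _]pa_mulUU.
by rewrite [LHS]pa_mulUo [RHS]pa_muloU mulrA pcompA.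
Qed.

Lemma pa_oneE x (F : vertex Q -> RQ) :
  (forall v, pa_mul (pterm 1 (empty_path v)) x = F v) ->
  pa_mul pa_one x = \sum_v F v.
Proof.
move=> FP; rewrite /pa_one (big_morph (pa_mul^~ x) (id1 := 0) (op1 := +%R)).
- exact: eq_bigr.
- by move=> u v; apply: pa_mulDl.
- exact: pa_mul0l.
Qed.

Lemma pa_oneEr x (F : vertex Q -> RQ) :
  (forall v, pa_mul x (pterm 1 (empty_path v)) = F v) ->
  pa_mul x pa_one = \sum_v F v.
Proof.
move=> FP; rewrite /pa_one (big_morph (pa_mul x) (id1 := 0) (op1 := +%R)).
- exact: eq_bigr.
- by move=> u v; apply: pa_mulDr.
- exact: pa_mul0r.
Qed.

Lemma pa_mul1l : left_id pa_one pa_mul.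
Proof.
elim/pa_ind => [|x y IHx IHy|c q]; first by rewrite pa_mul0r.
  by rewrite pa_mulDr IHx IHy.
rewrite (pa_oneE (fun v => pa_mulUU _ _ _ _)) (bigD1 (ptgt q)) //=.
rewrite pcomp_emptyl eqxx mul1r big1 ?addr0 // => v /negbTE qv.
by rewrite pcomp_emptyl eq_sym qv.
Qed.

Lemma pa_mul1r : right_id pa_one pa_mul.
Proof.
elim/pa_ind => [|x y IHx IHy|c p]; first by rewrite pa_mul0l.
  by rewrite pa_mulDl IHx IHy.
rewrite (pa_oneEr (fun v => pa_mulUU _ _ _ _)) (bigD1 (psrc p)) //=.
rewrite pcomp_emptyr eqxx mulr1 big1 ?addr0 // => v /negbTE pv.
by rewrite pcomp_emptyr eq_sym pv.
Qed.

HB.instance Definition _ := GRing.Zmodule_isPzRing.Build RQ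
  pa_mulA pa_mul1l pa_mul1r pa_mulDl pa_mulDr.

Lemma scale_pterm (c d : R) p :
  c *: (pterm d p) = (pterm (c * d) p).
Proof. by apply/malgP => q; rewrite mcoeffZ !mcoeff_pterm mulrnAr. Qed.

Lemma scale_pmono c d o : c *: pmono d o = pmono (c * d) o.
Proof. by case: o => [p|] /=; [apply: scale_pterm|rewrite scaler0]. Qed.

Lemma pa_scaleAl c x y : c *: (x * y) = (c *: x) * y.
Proof.
elim/pa_ind: x => [|x x' IHx IHx'|a p]; first by rewrite scaler0 !mul0r scaler0.
  by rewrite scalerDr !mulrDl scalerDr IHx IHx'.
elim/pa_ind: y => [|y y' IHy IHy'|b q]; first by rewrite !mulr0 scaler0.
  by rewrite !mulrDr scalerDr IHy IHy'.
rewrite scale_pterm [in LHS]/GRing.mul [in RHS]/GRing.mul /= !pa_mulUU.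
by rewrite scale_pmono mulrA.
Qed.

Lemma pa_scaleAr c x y : c *: (x * y) = x * (c *: y).
Proof.
elim/pa_ind: x => [|x x' IHx IHx'|a p]; first by rewrite !mul0r scaler0.
  by rewrite !mulrDl scalerDr IHx IHx'.
elim/pa_ind: y => [|y y' IHy IHy'|b q]; first by rewrite scaler0 !mulr0 scaler0.
  by rewrite scalerDr !mulrDr scalerDr IHy IHy'.
rewrite scale_pterm [in LHS]/GRing.mul [in RHS]/GRing.mul /= !pa_mulUU.
by rewrite scale_pmono mulrCA.
Qed.

End PathAlgebra.

Section PathAlgebraQuotient.
Variables (R : comNzRingType) (Q : quiver) (I : ideal (path_algebra R Q)).
Local Notation A := (path_algebra R Q).
Local Notation QI := (ring_quot I).

Definition quot_scale (c : R) : QI -> QI := lift_op1 QI ( *:%R c).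

Lemma idealZ c (x : A) : I x -> I (c *: x).
Proof. by move=> Ix; rewrite -[x]mul1r pa_scaleAl; apply: idealMl. Qed.

Lemma pi_scale c (x : A) : \pi_QI (c *: x) = quot_scale c (\pi_QI x).
Proof.
rewrite /quot_scale -lock; apply/esym/ring_quotP.
by rewrite -scalerBr; apply: idealZ; apply: ring_quotK.
Qed.

Lemma quot_scaleA a b v :
  quot_scale a (quot_scale b v) = quot_scale (a * b) v.
Proof. by elim/quotW: v => x; rewrite -!pi_scale scalerA. Qed.

Lemma quot_scale1 : left_id 1 quot_scale.
Proof. by elim/quotW=> x; rewrite -pi_scale scale1r. Qed.

Lemma quot_scaleDr : right_distributive quot_scale +%R.
Proof.
move=> c; elim/quotW=> x; elim/quotW=> y.
by rewrite -raddfD -!pi_scale -raddfD scalerDr.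
Qed.

Lemma quot_scaleDl v : {morph quot_scale^~ v : a b / a + b}.
Proof.
by move=> a b; elim/quotW: v => x; rewrite -!pi_scale -raddfD scalerDl.
Qed.

HB.instance Definition _ := GRing.Zmodule_isLmodule.Build R QI
  quot_scaleA quot_scale1 quot_scaleDr quot_scaleDl.

End PathAlgebraQuotient.


Section BaseChange.
Variables (R S : comNzRingType) (h : {rmorphism R -> S}) (Q : quiver).
Local Notation RQ := (path_algebra R Q).
Local Notation SQ := (path_algebra S Q).

Definition map_pa (x : RQ) : SQ := \sum_(p <- msupp x) (pterm (h x@_p) p).

Lemma mcoeff_map_pa x p : (map_pa x)@_p = h x@_p.
Proof.
rewrite {2}[x]ptermE !raddf_sum /=.
by apply: eq_bigr => q _; rewrite !mcoeff_pterm rmorphMn.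
Qed.

Lemma map_paD x y : map_pa (x + y) = map_pa x + map_pa y.
Proof. by apply/malgP => p; rewrite mcoeffD !mcoeff_map_pa mcoeffD rmorphD. Qed.

Lemma map_pa0 : map_pa 0 = 0.
Proof. by apply: (addIr (map_pa 0)); rewrite -map_paD !add0r. Qed.

Lemma map_pterm c p : map_pa (pterm c p) = (pterm (h c) p).
Proof. by apply/malgP => q; rewrite mcoeff_map_pa !mcoeff_pterm rmorphMn. Qed.

Lemma map_paM x y : map_pa (x * y) = map_pa x * map_pa y.
Proof.
elim/pa_ind: x => [|x x' IHx IHx'|a p]; first by rewrite !(mul0r, map_pa0).
  by rewrite mulrDl !map_paD mulrDl IHx IHx'.
elim/pa_ind: y => [|y y' IHy IHy'|b q]; first by rewrite !(mulr0, map_pa0).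
  by rewrite mulrDr !map_paD mulrDr IHy IHy'.
rewrite !map_pterm [in LHS]/GRing.mul [in RHS]/GRing.mul /= !pa_mulUU -rmorphM.
by case: pcomp => [r|] /=; rewrite ?map_pterm ?map_pa0.
Qed.

Variable I : ideal RQ.

(* The natural map S (x)_R I -> SQ sends c (x) x to c *: map_pa x; an element
   of S (x)_R I is represented by a sequence of pairs (c, x). *)
Definition natural_map (s : seq (S * RQ)) : SQ :=
  \sum_(u <- s) u.1 *: map_pa u.2.

Definition base_change_mem : SQ -> Prop := fun y =>
  exists2 s : seq (S * RQ), forall u, u \in s -> I u.2 & y = natural_map s.

Lemma base_change_mem0 : base_change_mem 0.
Proof. by exists [::] => //; rewrite /natural_map big_nil. Qed.

Lemma base_change_memD x y :
  base_change_mem x -> base_change_mem y -> base_change_mem (x + y).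
Proof.
move=> [s sP ->] [t tP ->]; exists (s ++ t); last by rewrite /natural_map big_cat.
by move=> u; rewrite mem_cat => /orP[/sP|/tP].
Qed.

Lemma base_change_memN x : base_change_mem x -> base_change_mem (- x).
Proof.
move=> [s sP ->]; exists [seq (- u.1, u.2) | u <- s].
  by move=> _ /mapP[u /sP Iu ->].
rewrite /natural_map big_map raddf_sum.
by apply: eq_bigr => u _; rewrite scaleNr.
Qed.

Lemma base_change_memB x y :
  base_change_mem x -> base_change_mem y -> base_change_mem (x - y).
Proof. by move=> Ix Iy; apply/base_change_memD/base_change_memN. Qed.

Definition base_change_zsub : zsubgroup SQ :=
  ZSubgroup base_change_mem0 base_change_memB.

Lemma pterm_scale (c : S) (p : qpath Q) :
  (pterm c p) = c *: map_pa (pterm 1 p) :> SQ.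
Proof. by rewrite map_pterm rmorph1 scale_pterm mulr1. Qed.

Lemma base_change_memMl (a x : SQ) :
  base_change_mem x -> base_change_mem (a * x).
Proof.
elim/pa_ind: a => [|a b IHa IHb|c p] Ix.
- by rewrite mul0r; apply: base_change_mem0.
- by rewrite mulrDl; apply: base_change_memD; auto.
case: Ix => s sP ->; exists [seq (c * u.1, (pterm 1 p) * u.2 : RQ) | u <- s].
  by move=> _ /mapP[u /sP Iu ->]; apply: idealMl.
rewrite /natural_map big_map mulr_sumr; apply: eq_bigr => u _ /=.
by rewrite map_paM pterm_scale -pa_scaleAl -pa_scaleAr scalerA.
Qed.

Lemma base_change_memMr (a x : SQ) :
  base_change_mem x -> base_change_mem (x * a).
Proof.
elim/pa_ind: a => [|a b IHa IHb|c p] Ix.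
- by rewrite mulr0; apply: base_change_mem0.
- by rewrite mulrDr; apply: base_change_memD; auto.
case: Ix => s sP ->; exists [seq (c * u.1, u.2 * (pterm 1 p) : RQ) | u <- s].
  by move=> _ /mapP[u /sP Iu ->]; apply: idealMr.
rewrite /natural_map big_map mulr_suml; apply: eq_bigr => u _ /=.
by rewrite map_paM pterm_scale -pa_scaleAr -pa_scaleAl scalerA.
Qed.

(* S (x)_R I regarded as an ideal of SQ, i.e. the image of natural_map *)
Definition base_change : ideal SQ :=
  @Ideal SQ base_change_zsub base_change_memMl base_change_memMr.

(* \sum_(u <- s) u.1 (x) u.2 = 0 in S (x)_R I, through the universal property:
   it is killed by every R-balanced biadditive map on S x I. *)
Definition tensor_eq0 (s : seq (S * RQ)) : Prop :=
  forall (V : zmodType) (beta : S -> RQ -> V),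
    (forall c d x, I x -> beta (c + d) x = beta c x + beta d x) ->
    (forall c x y, I x -> I y -> beta c (x + y) = beta c x + beta c y) ->
    (forall c a x, I x -> beta (c * h a) x = beta c (a *: x)) ->
    \sum_(u <- s) beta u.1 u.2 = 0.

Definition natural_map_injective : Prop :=
  forall s : seq (S * RQ), (forall u, u \in s -> I u.2) ->
    natural_map s = 0 -> tensor_eq0 s.

End BaseChange.

Section Admissible.
Variables (K : fieldType) (Q : quiver).

Definition arrow_ideal : path_algebra K Q -> Prop :=
  generated_ideal (fun x => exists a, x = (pterm 1 (arrow_path a))).

Definition admissible (I : ideal (path_algebra K Q)) : Prop :=
  exists2 a, (2 <= a)%N &
    (forall x, ideal_pow arrow_ideal a x -> I x) /\
    (forall x, I x -> ideal_pow arrow_ideal 2 x).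

(* KQ / I and e A e are isomorphic as K-algebras. Rings may be trivial here
   (KQ = 0 when Q has no vertex), hence not lalgType's, and the isomorphism
   is a bijective ring morphism that is K-linear. *)
Definition presents_corner (I : ideal (path_algebra K Q)) (A : algType K)
    (e : idem A) : Prop :=
  exists f : {rmorphism ring_quot I -> corner e}, scalable f /\ bijective f.

End Admissible.

(* Main.v *)
(** For a commutative ring K, let N_K be the set of x in KM such that the sum of x n over
    the n with r n l = f vanishes for all idempotents f, all r in fM and all l in Mf. It is a
    nilpotent ideal, and it is the radical of KM when K is a field in which all |G_f| are
    invertible, since a nilpotent element of the corner at f has trace 0 on K G_f.

    If p is not strongly modular, the matrix of each phi_f has a quasi-inverse over O, so
    that every element of N_k lifts to N_O: correct a lift at one idempotent f at a time.
    If p is not modular, J^2 is p-pure in J, and N_O^2 is pure in N_O.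

    Idempotents lift from kM to OM by completeness. A corner of kM at a primitive idempotent
    is k + N_k, so its lift is O + N_O up to completeness, which stays primitive over F.
    Now let the vertices be the primitive summands of e, and let the arrows be bases of the
    spaces e_w N_k e_v modulo N_k^2, lifted to N_O. The evaluation map from OQ to te OM te is
    surjective by Nakayama's lemma; its kernel I is pure, hence I becomes the kernel of the
    evaluation maps over F and k. Both are admissible because the arrows remain free modulo
    the squared radical, by purity of N_O^2. *)

Require Import Defs.
From HB Require Import structures.
From mathcomp Require Import all_boot all_order all_algebra.
From mathcomp Require Import boolp finmap monalg zify ring.

Set Implicit Arguments.
Unset Strict Implicit.
Unset Printing Implicit Defensive.

Import Order.TTheory GRing.Theory Num.Theory.
Local Open Scope ring_scope.
Local Open Scope quotient_scope.

(** * The radical cut out by sandwich sums *)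

Section FiniteMonoid.
Variable M : finMonoidType.
Implicit Types x y z a b c f l r m n u v w : M.
Local Open Scope group_scope.

(** Nonmodularity is a statement about integral lattices, while the lifting takes place over O. The
    bridge is a matrix identity C C' C = N C with p not dividing N. Smith normal form extracts it
    from p-purity of the column lattice of C; it survives every base change, and N becomes a unit of
    O. It is applied to two matrices. A homomorphism from ZR_f to ZG_f is determined by its
    coefficient at f, which may be any function on R_f; so coker phi_f is the cokernel of the 0-1
    matrix [r l = f], whose quasi-inverse solves the equations met in lifting N_k. The second matrix
    has as columns the products of integral generators of N_Z; its quasi-inverse carries purity of
    the squared radical from Z to O. The ideals N_K can be compared over Z, Q, O, F and k because
    their equations have coefficients 0 and 1. Limits in O are formed only for idempotents and
    units; elsewhere a quantity is shown to vanish by being divisible by all powers of pi. *)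

Lemma expg_periodic x : exists i h, (0 < h)%N /\ x ^+ (i + h) = x ^+ i.
Proof.
pose s := [seq x ^+ i | i <- iota 0 #|M|.+1].
have /uniqPn : ~~ uniq s.
  apply/negP => /card_uniqP; rewrite size_map size_iota => sM.
  by have := max_card (mem s); rewrite sM ltnn.
move=> /(_ 1)[i [j [ij]]]; rewrite size_map size_iota => js.
rewrite !(nth_map 0%N) ?size_iota ?(ltn_trans ij) //.
rewrite !nth_iota ?(ltn_trans ij) // !add0n => xij.
by exists i, (j - i)%N; rewrite subn_gt0 ij subnKC // ltnW.
Qed.

Lemma expg_fix x w h : x * w = x -> x * w ^+ h = x.
Proof. by move=> xw; elim: h => [|h IHh]; rewrite ?mulg1 // expgS mulgA xw. Qed.

Lemma sandwich_expg x u w h : x = u * x * w -> x = u ^+ h * x * w ^+ h.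
Proof.
move=> xE; elim: h => [|h IHh]; first by rewrite mulg1 mul1g.
by rewrite {1}xE {1}IHh [u ^+ _.+1]expgS [w ^+ _.+1]expgSr !mulgA.
Qed.

(** Choose [u ^+ (i + h) = u ^+ i] with [h > 0]. Iterating the hypothesis gives
    [x = u ^+ i * x * w ^+ i]; multiplying by [w ^+ h] and replacing [u ^+ i] by [u ^+ (i + h)]
    gives [x] back. *)
Lemma stable_right x u w :
  x = u * x * w -> exists2 h, (0 < h)%N & x * w ^+ h = x.
Proof.
move=> xE; have [i [h [h0 uh]]] := expg_periodic u; exists h => //.
have -> : x * w ^+ h = u ^+ i * x * w ^+ (i + h).
  by rewrite expgnDr mulgA -(sandwich_expg i xE).
by rewrite -uh -(sandwich_expg (i + h) xE).
Qed.

Lemma stable_left x u w :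
  x = u * x * w -> exists2 h, (0 < h)%N & u ^+ h * x = x.
Proof.
move=> xE; have [i [h [h0 wh]]] := expg_periodic w; exists h => //.
have -> : u ^+ h * x = u ^+ (i + h) * x * w ^+ i.
  by rewrite addnC expgnDr -!mulgA [u ^+ i * _]mulgA -(sandwich_expg i xE).
by rewrite -wh -(sandwich_expg (i + h) xE).
Qed.

Lemma right_stability x y u v :
  x = u * (x * y) * v -> exists q, x * y * q = x.
Proof.
rewrite mulgA -[_ * y * v]mulgA => /stable_right[[//|h] _ xh].
by exists (v * (y * v) ^+ h); rewrite -[RHS]xh expgS !mulgA.
Qed.

Lemma left_stability x y u v :
  x = u * (y * x) * v -> exists q, q * (y * x) = x.
Proof.
rewrite mulgA => /stable_left[[//|h] _ xh].
by exists ((u * y) ^+ h * u); rewrite -[RHS]xh expgSr !mulgA.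
Qed.

Lemma idem_expg x : exists2 h, (0 < h)%N & x ^+ h * x ^+ h = x ^+ h.
Proof.
have [i [h [h0 xh]]] := expg_periodic x.
have xhk k j : (i <= j)%N -> x ^+ (j + h * k) = x ^+ j.
  move=> ij; elim: k => [|k IHk]; first by rewrite muln0 addn0.
  have -> : (j + h * k.+1 = (i + h) + (h * k + (j - i)))%N.
    by rewrite mulnS -{1}(subnKC ij); lia.
  rewrite expgnDr xh -expgnDr; have -> : (i + (h * k + (j - i)) = j + h * k)%N by lia.
  by [].
(* A multiple of the period [h] that is at least the preperiod [i]: doubling this exponent does not
   change the power. *)
exists (h * i.+1)%N; first by rewrite muln_gt0 h0.
by rewrite -expgnDr xhk //; nia.
Qed.

Definition J_le x y := [exists u, exists v, x == u * y * v].

Lemma J_leP x y : reflect (exists u v, x = u * y * v) (J_le x y).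
Proof.
apply: (iffP existsP) => [[u /existsP[v /eqP->]]|[u [v ->]]]; first by exists u, v.
by exists u; apply/existsP; exists v.
Qed.

Lemma J_le_refl x : J_le x x.
Proof. by apply/J_leP; exists 1, 1; rewrite mul1g mulg1. Qed.

Lemma J_le_mul u x v : J_le (u * x * v) x.
Proof. by apply/J_leP; exists u, v. Qed.

Lemma J_le_mull u x : J_le (u * x) x.
Proof. by apply/J_leP; exists u, 1; rewrite mulg1. Qed.

Lemma J_le_mulr x v : J_le (x * v) x.
Proof. by apply/J_leP; exists 1, v; rewrite mul1g. Qed.

Lemma J_le_trans y x z : J_le x y -> J_le y z -> J_le x z.
Proof.
move=> /J_leP[u [v ->]] /J_leP[u' [v' ->]].
by apply/J_leP; exists (u * u'), (v' * v); rewrite !mulgA.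
Qed.

Lemma right_stable x y : J_le x (x * y) -> exists q, x * y * q = x.
Proof. by move=> /J_leP[u [v]] /right_stability. Qed.

Lemma left_stable x y : J_le x (y * x) -> exists q, q * (y * x) = x.
Proof. by move=> /J_leP[u [v]] /left_stability. Qed.

(** Stability gives [m] a right and a left inverse relative to [f]; cut down to fMf, they
    coincide. *)
Lemma local_unit f m : f * f = f -> f * m = m -> m * f = m -> J_le f m ->
  exists n, [/\ f * n = n, n * f = n, m * n = f & n * m = f].
Proof.
move=> ff fm mf fJ.
have [q mq] : exists q, f * m * q = f by apply: right_stable; rewrite fm.
have [q' mq'] : exists q, q * (m * f) = f by apply: left_stable; rewrite mf.
rewrite fm in mq; rewrite mf in mq'.
pose n := f * q * f; pose n' := f * q' * f.
have fn : f * n = n by rewrite /n !mulgA ff.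
have nf : n * f = n by rewrite /n -!mulgA ff.
have n'f : n' * f = n' by rewrite /n' -!mulgA ff.
have mn : m * n = f by rewrite /n !mulgA mf mq ff.
have n'm : n' * m = f by rewrite /n' -!mulgA fm mq' ff.
by exists n; split=> //; rewrite -[in LHS]fn -n'm -[n' * m * n]mulgA mn n'f n'm.
Qed.

Lemma J_equiv_idem f g : f * f = f -> g * g = g -> J_le f g -> J_le g f ->
  exists s t, [/\ f * s = s, s * g = s, g * t = t, t * f = t & s * t = f /\ t * s = g].
Proof.
move=> ff gg /J_leP[s0 [t0 fE]] /J_leP[p [q gE]].
pose s := f * s0 * g; pose t := g * t0 * f.
have st : s * t = f.
  rewrite /s /t !mulgA -[_ * g * g]mulgA gg.
  have -> : f * s0 * g * t0 * f = f * (s0 * g * t0) * f by rewrite !mulgA.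
  by rewrite -fE !ff.
have fs : f * s = s by rewrite /s !mulgA ff.
have sg : s * g = s by rewrite /s -!mulgA gg.
have gt : g * t = t by rewrite /t !mulgA gg.
have tf : t * f = t by rewrite /t -!mulgA ff.
exists s, t; split=> //; split=> //.
have ts2 : (t * s) * (t * s) = t * s by rewrite mulgA -[t * s * t]mulgA st tf.
have [||| n [gn ng tsn ntsE]] := @local_unit g (t * s) gg.
- by rewrite mulgA gt.
- by rewrite -mulgA sg.
- apply/J_leP; exists (p * s), (t * q).
  by rewrite gE -[in LHS]ff -[in LHS]st !mulgA.
have : t * s * (t * s * n) = t * s by rewrite tsn -mulgA sg.
by rewrite mulgA ts2 tsn.
Qed.

(* For J-equivalent a, b, c, the equation a n b = c in n is one of the equations
   r n l = f, f idempotent, which define sandwich_radical. *)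
Lemma J_triple a b c n0 : a * n0 * b = c -> J_le a c -> J_le b c -> J_le a b ->
  J_le b a -> exists f r l, [/\ f * f = f, f * r = r, l * f = l &
    forall n, (a * n * b == c) = (r * n * l == f)].
Proof.
move=> cE ac bc ab ba.
have /J_leP[u [v aE]] : J_le a (a * (n0 * b)) by rewrite mulgA cE.
rewrite mulgA -[_ * (n0 * b) * v]mulgA in aE.
(* An idempotent power [f] of [w] fixes [a] on the right. As [w] starts with [n0 * b], it lies
   J-below [b], and stability recovers [f] from [a] (by [w0]), [f] from [f * n0 * b] (by [z]) and
   [b] from [b * z * f] (by [q]). These factors translate one equation into the other. *)
set w := n0 * b * v in aE; have [[//|h] _ awh] := stable_right aE.
have [[//|k] _ ww] := idem_expg w; set f := w ^+ k.+1 in ww.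
have af : a * f = a.
  have ff i : f ^+ i.+1 = f by elim: i => // i IHi; rewrite expgS IHi.
  by rewrite -[in RHS](expg_fix k.+1 awh) expgnAC -/f ff.
have fb : J_le f b.
  apply/J_leP; exists n0, (v * w ^+ k); rewrite /f expgS /w !mulgA; done.
have [w0 w0a] : exists q, q * (a * f) = f.
  by apply: left_stable; rewrite af; apply: J_le_trans ba.
rewrite af in w0a.
have [z xz] : exists q, (f * n0 * b) * q = f.
  have [|q fq] := @right_stable f (n0 * b); last by exists q; rewrite -[f * n0 * b]mulgA.
  apply: (J_le_trans fb); apply: (J_le_trans bc); rewrite -cE -af -!mulgA.
  exact: J_le_mull.
have [q bq] : exists q, b * (z * f) * q = b.
  apply: right_stable; apply: (J_le_trans bc); rewrite -cE.
  apply: (J_le_trans (J_le_mulr _ _)); apply: (J_le_trans (J_le_mulr _ _)).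
  rewrite -af; apply: (J_le_trans (J_le_mull _ _)).
  have {1}-> : f = f * n0 * (b * (z * f)) by rewrite !mulgA xz ww.
  exact: J_le_mull.
exists f, f, (b * z * f); split=> //; first by rewrite -mulgA ww.
move=> n; apply/eqP/eqP => [nE|nE].
  have : f * n * b = f * n0 * b by rewrite -w0a -!mulgA [a * (n * _)]mulgA nE -cE !mulgA.
  by move=> E; rewrite !mulgA E xz ww.
have E x : f * x * b = f * x * (b * z * f) * q by rewrite -{1}bq !mulgA.
have E0 : f * n0 * (b * z * f) = f by rewrite !mulgA xz ww.
by rewrite -cE -af -![a * f * _]mulgA -![a * _ * _]mulgA E nE -[in LHS]E0 -E.
Qed.

End FiniteMonoid.

(** * Sandwich sums and nilpotency *)

Section Sandwich.
Variables (M : finMonoidType) (K : comNzRingType).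
Local Notation KM := (monoid_algebra M K).
Implicit Types (x y z : KM) (a b c f r l m n : M).

Definition sandwich c x a b : K := \sum_(n | (a * n * b)%g == c) x n.

(* The equations only involve the coefficients 0 and 1, so that this radical makes sense
   over every ring. Over a field in which all |G_f| are invertible it is the Jacobson
   radical. *)
Definition sandwich_radical x : Prop := forall f r l,
  (f * f = f)%g -> (f * r = r)%g ->
  (l * f = l)%g -> sandwich f x r l = 0.

Lemma ma_mul3E x y z c :
  (x * y * z) c = \sum_a \sum_b x a * z b * sandwich c y a b.
Proof.
transitivity (\sum_d \sum_b \sum_a \sum_n
    ((x a * y n * z b) *+ ((a * n)%g == d) *+ ((d * b)%g == c))).
  rewrite [in LHS]ma_mulE; apply: eq_bigr => d _; apply: eq_bigr => b _.
  rewrite [X in X * _]ma_mulE mulr_suml -sumrMnl.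
  apply: eq_bigr => a _; rewrite mulr_suml -sumrMnl; apply: eq_bigr => n _.
  by rewrite mulrnAl.
rewrite exchange_big /=.
under eq_bigr => b _ do rewrite exchange_big /=.
rewrite exchange_big /=; apply: eq_bigr => a _; apply: eq_bigr => b _.
rewrite exchange_big /= /sandwich mulr_sumr [RHS]big_mkcond /=.
apply: eq_bigr => n _.
rewrite (bigD1 (a * n)%g) //= eqxx mulr1n big1 ?addr0.
  by rewrite mulrAC; case: eqP.
by move=> d; rewrite eq_sym => /negbTE->; rewrite mulr0n mul0rn.
Qed.

Lemma sandwich_delta c x a b :
  sandwich c x a b = (madelta K a * x * madelta K b) c.
Proof.
rewrite ma_mul3E (bigD1 a) //= [X in _ + X]big1 ?addr0.
  rewrite (bigD1 b) //= [X in _ + X]big1 ?addr0 => [|b' /negbTE bb].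
    by rewrite !ffunE !eqxx !mul1r.
  by rewrite !ffunE bb mulr0 mul0r.
by move=> a' /negbTE aa; apply: big1 => b' _; rewrite !ffunE aa !mul0r.
Qed.

Lemma ma_expand x : x = \sum_a x a *: madelta K a.
Proof.
apply/ffunP => m; rewrite sum_ffunE (bigD1 m) //= [X in _ + X]big1 ?addr0.
  by rewrite ma_scaleE ffunE eqxx mulr1.
by move=> a /negbTE am; rewrite ma_scaleE ffunE eq_sym am mulr0.
Qed.

Lemma madeltaM a b : madelta K (a * b)%g = madelta K a * madelta K b.
Proof.
apply/ffunP => m; rewrite [RHS]ma_mulE (bigD1 a) //= [X in _ + X]big1 ?addr0.
  rewrite (bigD1 b) //= [X in _ + X]big1 ?addr0 => [|b' /negbTE bb].
    by rewrite !ffunE !eqxx mul1r eq_sym.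
  by rewrite !ffunE bb mulr0 mul0rn.
by move=> a' /negbTE aa; apply: big1 => b' _; rewrite !ffunE aa !mul0r mul0rn.
Qed.

Lemma sandwich_mul c x y z r l : sandwich c (x * y * z) r l =
  \sum_a \sum_b x a * z b * sandwich c y (r * a)%g (b * l)%g.
Proof.
have E : madelta K r * (x * y * z) * madelta K l = \sum_a \sum_b
    (x a * z b) *: (madelta K (r * a)%g * y * madelta K (b * l)%g).
  rewrite {1}[x]ma_expand {1}[z]ma_expand !mulr_suml mulr_sumr mulr_suml.
  apply: eq_bigr => a _; rewrite !mulr_sumr mulr_suml; apply: eq_bigr => b _.
  by rewrite !madeltaM -!(scalerAl, scalerAr) scalerA !mulrA mulrC.
rewrite sandwich_delta E sum_ffunE; apply: eq_bigr => a _.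
rewrite sum_ffunE; apply: eq_bigr => b _.
by rewrite ma_scaleE sandwich_delta.
Qed.

Lemma sandwichD c x y r l :
  sandwich c (x + y) r l = sandwich c x r l + sandwich c y r l.
Proof. by rewrite -big_split; apply: eq_bigr => n _; rewrite ffunE. Qed.

Lemma sandwichZ c k x r l : sandwich c (k *: x) r l = k * sandwich c x r l.
Proof. by rewrite mulr_sumr; apply: eq_bigr => n _; rewrite ma_scaleE. Qed.

Lemma sandwich0 c r l : sandwich c (0 : KM) r l = 0.
Proof. by apply: big1 => n _; rewrite ffunE. Qed.

Lemma sandwich_radical0 : sandwich_radical 0.
Proof. by move=> *; apply: sandwich0. Qed.

Lemma sandwich_radicalD x y :
  sandwich_radical x -> sandwich_radical y -> sandwich_radical (x + y).
Proof. by move=> Nx Ny f r l *; rewrite sandwichD Nx ?Ny ?addr0. Qed.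

Lemma sandwich_radicalZ k x : sandwich_radical x -> sandwich_radical (k *: x).
Proof. by move=> Nx f r l *; rewrite sandwichZ Nx ?mulr0. Qed.

Lemma sandwich_radicalM x y z :
  sandwich_radical y -> sandwich_radical (x * y * z).
Proof.
move=> Ny f r l ff fr lf; rewrite sandwich_mul big1 // => a _; apply: big1 => b _.
by rewrite Ny ?mulr0 // ?mulgA ?fr // -mulgA lf.
Qed.

Lemma sandwich_radicalMl x y : sandwich_radical y -> sandwich_radical (x * y).
Proof. by rewrite -[x * y]mulr1; apply: sandwich_radicalM. Qed.

Lemma sandwich_radicalMr x y : sandwich_radical y -> sandwich_radical (y * x).
Proof. by rewrite -[y * x]mul1r mulrA; apply: sandwich_radicalM. Qed.

Definition supported (I : {set M}) x := forall m, m \notin I -> x m = 0.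

Lemma supportedM (I : {set M}) x y : (forall u m, m \in I -> (m * u)%g \in I) ->
  supported I x -> supported I (x * y).
Proof.
move=> II xI m mI; rewrite [LHS]ma_mulE big1 // => a _; apply: big1 => b _.
have [/(II b)|/xI->] := boolP (a \in I); last by rewrite mul0r mul0rn.
by case: eqP => // ->; rewrite (negbTE mI).
Qed.

Definition monoid_ideal (I : {set M}) :=
  forall u m v, m \in I -> (u * m * v)%g \in I.

(** The coefficient at [c] combines the sums [sandwich c y a b] with [a] and [b] in the supports. If
    [c] lies J-above [m], so do [a] and [b]; by maximality all are J-equivalent to [m], and
    [J_triple] turns the sum into one that vanishes on the radical. *)
Lemma nilpotency_step (I : {set M}) m x y z : monoid_ideal I ->
  (forall n, n \in I -> J_le m n -> J_le n m) ->
  supported I x -> sandwich_radical y -> supported I z ->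
  supported [set n in I | ~~ J_le m n] (x * y * z).
Proof.
move=> II mmax xI Ny zI c; rewrite inE negb_and negbK ma_mul3E => cI.
rewrite big1 // => a _; apply: big1 => b _.
have [aI|/xI->] := boolP (a \in I); last by rewrite !mul0r.
have [bI|/zI->] := boolP (b \in I); last by rewrite mulr0 mul0r.
suff -> : sandwich c y a b = 0 by rewrite mulr0.
have [n0 /eqP n0E|no] := pickP (fun n => (a * n * b)%g == c); last first.
  by apply: big1 => n; rewrite no.
have {}cI : J_le m c.
  case/orP: cI => // /negP[]; rewrite -n0E.
  by have := II 1%g a (n0 * b)%g aI; rewrite mul1g mulgA.
have ca : J_le c a by rewrite -n0E -mulgA J_le_mulr.
have cb : J_le c b by rewrite -n0E J_le_mull.
have ma := J_le_trans cI ca; have mb := J_le_trans cI cb.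
have am := mmax _ aI ma; have bm := mmax _ bI mb.
have [//||||f [r [l [ff fr lf E]]]] := J_triple n0E.
- exact: J_le_trans cI.
- exact: J_le_trans cI.
- exact: J_le_trans mb.
- exact: J_le_trans ma.
by rewrite /sandwich (eq_bigl _ _ E); apply: Ny.
Qed.

(** Supports shrink by J-classes: if products of length [e] live on the ideal [I], a product of
    length 2e + 1 or more is an [x * y * z] as in [nilpotency_step], up to a further right factor,
    and loses a maximal J-class of [I]. *)
Lemma sandwich_radical_nilpotent : exists e, forall s : seq KM,
  (forall x, x \in s -> sandwich_radical x) -> (e <= size s)%N ->
  \prod_(x <- s) x = 0.
Proof.
suff /(_ #|M|)[I [e [_ cI sI]]] k : exists (I : {set M}) e, [/\ monoid_ideal I,
    (#|I| <= #|M| - k)%N & forall s : seq KM,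
    (forall x, x \in s -> sandwich_radical x) -> (e <= size s)%N ->
    supported I (\prod_(x <- s) x)].
  exists e => s Ns es; apply/ffunP => m; rewrite (sI s Ns es) ?ffunE //.
  by move: cI; rewrite subnn leqn0 cards_eq0 => /eqP->; rewrite inE.
elim: k => [|k [I [e [II cI sI]]]].
  exists setT, 0%N; split; first by move=> *; rewrite inE.
    by rewrite subn0 max_card.
  by move=> s _ _ m; rewrite inE.
have [I0|[m0 m0I]] := set_0Vmem I.
  by exists I, e; split=> //; rewrite I0 cards0.
(* Maximising the number of elements J-below makes [m] a J-maximal element of [I]. *)
have [m mI mmax] := @arg_maxnP _ m0 (mem I) (fun m => #|[set n | J_le n m]|) m0I.
have {}mmax n : n \in I -> J_le m n -> J_le n m.
  move=> /mmax nI mn; have /subset_leqif_cards[le1 /esym] : [set n | J_le n m] \subset [set n' | J_le n' n].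
    by apply/subsetP => q; rewrite !inE => /J_le_trans; apply.
  rewrite eqn_leq le1 (nI : (_ <= _)%N) => /eqP/setP/(_ n).
  by rewrite !inE J_le_refl.
pose I' := [set n in I | ~~ J_le m n].
have I'I : monoid_ideal I'.
  move=> u n v; rewrite !inE => /andP[nI mn]; rewrite II //=; apply: contra mn.
  by move=> /J_le_trans; apply; apply: J_le_mul.
exists I', (e + e.+1)%N; split=> //.
  have : (#|I'| < #|I|)%N.
    apply: proper_card; apply/properP; split.
      by apply/subsetP => n; rewrite inE => /andP[].
    by exists m; [exact: mI | rewrite inE J_le_refl andbF].
  by lia.
move=> s sN es.
have [s1 [y [s2 [s3 [sE s1e s2e]]]]] : exists s1 y s2 s3,
    [/\ s = s1 ++ y :: s2 ++ s3, e = size s1 & e = size s2].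
  exists (take e s), (nth 0 s e), (take e (drop e.+1 s)), (drop e (drop e.+1 s)).
  rewrite cat_take_drop -drop_nth ?cat_take_drop; last by lia.
  by rewrite !size_takel ?size_drop //; lia.
rewrite sE big_cat big_cons big_cat /= !mulrA.
have Ns1 x : x \in s1 -> sandwich_radical x.
  by move=> xs; apply: sN; rewrite sE mem_cat xs.
have Ns2 x : x \in s2 -> sandwich_radical x.
  by move=> xs; apply: sN; rewrite sE !(mem_cat, in_cons) xs !orbT.
have Ny : sandwich_radical y.
  by apply: sN; rewrite sE !(mem_cat, in_cons) eqxx !orbT.
apply: supportedM => [u n nI|]; first by rewrite -[n]mul1g I'I.
by apply: nilpotency_step => //; apply: sI => //; rewrite -?s1e -?s2e.
Qed.

Lemma sandwich_radical_pow : exists e, forall (n : nat) x, (e <= n)%N ->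
  ideal_pow sandwich_radical n x -> x = 0.
Proof.
have [e eP] := sandwich_radical_nilpotent; exists e => n x en xe.
(* An ideal power is a nested sum; the list [s] accumulates the factors split off on the right. *)
suff {xe} P (k : nat) y (s : seq KM) : ideal_pow sandwich_radical k y ->
    (forall x, x \in s -> sandwich_radical x) -> (e <= k + size s)%N ->
    y * \prod_(x <- s) x = 0.
  by rewrite -[x]mulr1 -(big_nil (GRing.one _) *%R predT id) (P n) ?addn0.
elim: k y s => [|k IHk] y s /= yn sN ek; first by rewrite eP ?mulr0.
case: yn => t tP ->; rewrite mulr_suml big_seq big1 // => u /tP[u1 u2].
rewrite -mulrA; have := IHk u.1 (u.2 :: s); rewrite big_cons; apply=> //.
  by move=> z; rewrite inE => /orP[/eqP->|/sN].
by rewrite /= addnS.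
Qed.

End Sandwich.

Lemma sandwich_map (M : finMonoidType) (R S : comNzRingType)
    (h : {rmorphism R -> S}) c (x : monoid_algebra M R) r l :
  sandwich c (map_ma h x) r l = h (sandwich c x r l).
Proof. by rewrite rmorph_sum; apply: eq_bigr => n _; rewrite ffunE. Qed.

(** * Idempotents and the Jacobson radical *)

Section Idempotents.
Variable A : nzRingType.
Implicit Types a b c d e f g p u v x y : A.

(** Strong pi-regularity, which stands in for finite dimension below: [x ^+ n * y ^+ n] is then the
    idempotent of Fitting's decomposition. *)
Definition pi_regular := forall x, exists n y, x * y = y * x /\ x ^+ n = x ^+ n.+1 * y.

Definition corner_unit e x :=
  exists y, [/\ e * y = y, y * e = y, x * y = e & y * x = e].

Definition iso_idem e f := exists a b,
  [/\ e * a = a, a * f = a, f * b = b, b * e = b & a * b = e /\ b * a = f].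

Lemma iso_idem_sym e f : iso_idem e f -> iso_idem f e.
Proof. by case=> a [b [? ? ? ? [? ?]]]; exists b, a. Qed.

Lemma iso_idem_trans e f g : iso_idem e f -> iso_idem f g -> iso_idem e g.
Proof.
case=> a [b [ea af fb be [ab ba]]] [c [d [fc cg gd df [cd dc]]]].
exists (a * c), (d * b); split; rewrite ?mulrA ?ea ?gd // -?mulrA ?cg ?be //.
by rewrite [c * _]mulrA cd [b * (_ * _)]mulrA ba [f * b]fb fc ab dc.
Qed.

Lemma conjugate_trans e f g : conjugate e f -> conjugate f g -> conjugate e g.
Proof.
case=> u [v [uv vu ->]] [u' [v' [uv' vu' ->]]]; exists (u' * u), (v * v').
rewrite !mulrA -[u' * u * v]mulrA uv mulr1 uv'.
by rewrite -[v * v' * u']mulrA vu' mulr1 vu.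
Qed.

Lemma conjugate_iso e f : e * e = e -> conjugate e f -> iso_idem e f.
Proof.
move=> ee [u [v [uv vu ->]]]; exists (e * v), (u * e).
rewrite !mulrA ee -[u * e * e]mulrA ee; split=> //.
- by rewrite -!mulrA [v * (u * _)]mulrA vu mul1r mulrA ee.
- by rewrite -[u * e * v * u]mulrA vu mulr1 -!mulrA ee.
by split; rewrite ?ee // -[e * v * u]mulrA vu mulr1 ee.
Qed.

Lemma square0_units (d : A) : d * d = 0 -> (1 - d) * (1 + d) = 1 /\ (1 + d) * (1 - d) = 1.
Proof.
move=> dd; split.
  by rewrite mulrBl mul1r mulrDr mulr1 dd addr0 addrK.
by rewrite mulrDl mul1r mulrBr mulr1 dd subr0 subrK.
Qed.

(** The difference [d = f - e] has square zero, so [1 - d] is a unit with inverse [1 + d]; it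
    conjugates [e] to [f]. *)
Lemma conjugate_same_right_ideal e f : e * e = e -> f * f = f ->
  e * f = f -> f * e = e -> conjugate e f.
Proof.
move=> ee ff ef fe; pose d := f - e; exists (1 - d), (1 + d).
have d2 : d * d = 0 by rewrite /d mulrBl !mulrBr ff fe ef ee subrr.
have [-> ->] := square0_units d2; split=> //.
have ed : e * d = d by rewrite /d mulrBr ee ef.
have df : d * f = 0 by rewrite /d mulrBl ff ef subrr.
have edf : e + d = f by rewrite /d addrC subrK.
by rewrite -mulrA mulrDr mulr1 ed edf mulrBl mul1r df subr0.
Qed.

Lemma conjugate_same_left_ideal e f : e * e = e -> f * f = f ->
  e * f = e -> f * e = f -> conjugate e f.
Proof.
move=> ee ff ef fe; pose d := f - e; exists (1 + d), (1 - d).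
have d2 : d * d = 0.
  by rewrite /d mulrBl !mulrBr ff fe ef ee !subrr.
have [-> ->] := square0_units d2; split=> //.
have de : d * e = d by rewrite /d mulrBl ee fe.
have fd : f * d = 0 by rewrite /d mulrBr ff fe subrr.
have edf : e + d = f by rewrite /d addrC subrK.
by rewrite mulrDl mul1r de edf mulrBr mulr1 fd subr0.
Qed.

Lemma conjugate_orthogonal e f a b : e * e = e -> f * f = f -> e * f = 0 ->
  f * e = 0 -> e * a = a -> a * f = a -> f * b = b -> b * e = b ->
  a * b = e -> b * a = f -> conjugate e f.
Proof.
move=> ee ff ef fe ea af fb be ab ba.
have aa : a * a = 0 by rewrite -{1}af -{2}ea !mulrA -[a * f * e]mulrA fe mulr0 mul0r.
have bb : b * b = 0 by rewrite -{1}be -{2}fb !mulrA -[b * e * f]mulrA ef mulr0 mul0r.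
have ae : a * e = 0 by rewrite -af -mulrA fe mulr0.
have bf : b * f = 0 by rewrite -be -mulrA ef mulr0.
have fa : f * a = 0 by rewrite -ea mulrA fe mul0r.
have eb : e * b = 0 by rewrite -fb mulrA ef mul0r.
(* An involution that exchanges [e] and [f] through [a] and [b] and is the identity on
   [1 - e - f]. *)
pose u := 1 - e - f + a + b.
have uE : u * e = b by rewrite /u !mulrDl !mulNr mul1r ee fe ae be subrr subr0 !add0r.
have uf : u * f = a by rewrite /u !mulrDl !mulNr mul1r ff ef af bf subr0 subrr add0r addr0.
have ua : u * a = f by rewrite /u !mulrDl !mulNr mul1r ea fa aa ba subrr subr0 !add0r.
have ub : u * b = e by rewrite /u !mulrDl !mulNr mul1r eb fb ab bb subr0 subrr add0r addr0.
exists u, u; have uu : u * u = 1.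
  rewrite {2}/u !mulrDr !mulrN mulr1 uE uf ua ub /u.
  by rewrite addrK addrK subrK subrK.
split=> //.
by rewrite uE /u !mulrDr !mulrN mulr1 be bf ba bb subrr subr0 add0r addr0.
Qed.


(** Fitting: [g = x ^+ n * y ^+ n] is an idempotent of the corner at [e] with [x ^+ n * g = x ^+ n].
    Primitivity leaves [g = 0], so that [x] is nilpotent, or [g = e], so that [x ^+ n.-1 * y ^+ n],
    cut down by [e], inverts [x]. *)
Lemma primitive_dichotomy e x : pi_regular -> primitive_idempotent e ->
  e * x = x -> x * e = x -> (exists n, x ^+ n = 0) \/ corner_unit e x.
Proof.
move=> /(_ x)[n [y [xy xn]]] [ee _ prim] ex xe.
have {}xn : x ^+ n.+1 = x ^+ n.+2 * y by rewrite exprS {1}xn mulrA -exprS.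
move: n.+1 (ltn0Sn n) xn => {}n n0 xn.
have cxy : GRing.comm x y by [].
have xnk k : x ^+ n = x ^+ (n + k) * y ^+ k.
  elim: k => [|k IHk]; first by rewrite addn0 mulr1.
  rewrite {1}IHk addnC exprD xn mulrA -exprD -mulrA -exprS.
  by rewrite addnS addnC addnS.
pose g := x ^+ n * y ^+ n.
have eg : e * g = g by rewrite /g -(prednK n0) exprS !mulrA ex.
have ge : g * e = g.
  have cg : g = y ^+ n * x ^+ n by apply/commrX/commr_sym/commrX/commr_sym.
  have xne : x ^+ n * e = x ^+ n by rewrite -(prednK n0) exprSr -mulrA xe.
  by rewrite cg -mulrA xne.
have gx : x ^+ n * g = x ^+ n.
  rewrite /g mulrA -exprD -xnk; done.
have gg : g * g = g.
  have gxC : g * x ^+ n = x ^+ n * g.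
    by apply/commrX; rewrite /g; apply/commr_sym/commrM; [apply/commrX|apply/commrX].
  by rewrite {2}/g mulrA gxC gx.
have [||||g0|/subr0_eq eg'] := prim g (e - g) gg.
- by rewrite mulrBl !mulrBr ee eg ge gg subrr subr0.
- by rewrite mulrBr ge gg subrr.
- by rewrite mulrBl eg gg subrr.
- by rewrite addrC subrK.
  by left; exists n; rewrite -gx g0 mulr0.
right; exists (x ^+ n.-1 * y ^+ n * e).
have cy : x * (x ^+ n.-1 * y ^+ n) = (x ^+ n.-1 * y ^+ n) * x.
  by apply: commrM; [apply/commrX|apply/commrX].
have xE : x * (x ^+ n.-1 * y ^+ n) = g by rewrite mulrA -exprS prednK.
have ey : e * (x ^+ n.-1 * y ^+ n) = (x ^+ n.-1 * y ^+ n) * e.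
  have cz : GRing.comm (x ^+ n.-1 * y ^+ n) x by apply/commr_sym.
  rewrite eg'; apply/commr_sym; rewrite -xE; apply: commrM => //.
split; first by rewrite mulrA ey -mulrA ee.
- by rewrite -mulrA ee.
- by rewrite mulrA xE -eg' ee.
by rewrite -mulrA ex -cy xE.
Qed.

(** Locality of the corner at a primitive idempotent: if [x] is nilpotent, a geometric series
    inverts [y = e - x]. *)
Lemma corner_unit_split e x y : pi_regular -> primitive_idempotent e ->
  e * x = x -> x * e = x -> x + y = e -> corner_unit e x \/ corner_unit e y.
Proof.
move=> piA pe ex xe xy; have [ee _ _] := pe.
have [[n xn]|] := primitive_dichotomy piA pe ex xe; last by left.
right; have yE : y = e - x by rewrite -xy addrC addKr.
pose s := \sum_(i < n) x ^+ i.
have xs : (1 - x) * s = 1 by rewrite -opprB mulNr -subrX1 xn sub0r opprK.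
have cs : GRing.comm s (1 - x).
  apply/commr_sym/commr_sum => i _; apply/commrX/commr_sym/commrB => //.
  exact: commr1.
have yE1 : y = (1 - x) * e by rewrite yE mulrBl mul1r xe.
have yE2 : y = e * (1 - x) by rewrite yE mulrBr mulr1 ex.
have ye : y * e = y by rewrite yE1 -mulrA ee.
have ey : e * y = y by rewrite yE2 mulrA ee.
exists (e * s * e); split.
- by rewrite !mulrA ee.
- by rewrite -!mulrA ee.
- by rewrite !mulrA ye yE2 -[_ * s]mulrA xs mulr1 ee.
by rewrite -mulrA ey yE1 -mulrA [s * _]mulrA cs xs mul1r ee.
Qed.

Lemma corner_unit_of_left_inverse e x y : pi_regular -> primitive_idempotent e ->
  e * x = x -> x * e = x -> y * x = e -> corner_unit e x.
Proof.
move=> piA pe ex xe yx; have [ee e0 _] := pe.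
have [[n xn]|//] := primitive_dichotomy piA pe ex xe.
case/negP: e0; apply/eqP.
have <- : y ^+ n.+1 * x ^+ n.+1 = e.
  elim: n {xn} => [|n IHn]; first by rewrite !expr1.
  have exn : e * x ^+ n.+1 = x ^+ n.+1 by rewrite exprS mulrA ex.
  by rewrite exprSr (exprS x) -mulrA (mulrA y) yx exn IHn.
by rewrite (exprS x) xn !mulr0.
Qed.

Lemma corner_unit_add e x y : pi_regular -> primitive_idempotent e ->
  e * x = x -> x * e = x -> e * y = y -> y * e = y ->
  corner_unit e (x + y) -> corner_unit e x \/ corner_unit e y.
Proof.
move=> piA pe ex xe ey ye [z [ez ze _ zxy]]; have [ee _ _] := pe.
have [|||[w [_ _ _ wz]]|[w [_ _ _ wz]]] := @corner_unit_split e (z * x) (z * y) piA pe.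
- by rewrite mulrA ez.
- by rewrite -mulrA xe.
- by rewrite -mulrDr.
- by left; apply: (@corner_unit_of_left_inverse _ _ (w * z)); rewrite // -mulrA.
by right; apply: (@corner_unit_of_left_inverse _ _ (w * z)); rewrite // -mulrA.
Qed.

Lemma corner_unit_sum e (I : Type) (s : seq I) (x : I -> A) : pi_regular ->
  primitive_idempotent e -> (forall i, e * x i = x i) ->
  (forall i, x i * e = x i) -> corner_unit e (\sum_(i <- s) x i) ->
  exists i, corner_unit e (x i).
Proof.
move=> piA pe ex xe; have [ee e0 _] := pe.
elim: s => [|i s IHs].
  by rewrite big_nil => -[z [_ _ ]]; rewrite mul0r => /esym/eqP; rewrite (negbTE e0).
have es : e * (\sum_(j <- s) x j) = \sum_(j <- s) x j.
  by rewrite mulr_sumr; apply: eq_bigr.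
have se : (\sum_(j <- s) x j) * e = \sum_(j <- s) x j.
  by rewrite mulr_suml; apply: eq_bigr.
rewrite big_cons => /(corner_unit_add piA pe (ex i) (xe i) es se)[ui|/IHs//].
by exists i.
Qed.

(** [b * a] is an idempotent of the corner at [f], nonzero because [a * (b * a) * b = e];
    primitivity makes it [f]. *)
Lemma primitive_iso_of_nonzero e f a b : primitive_idempotent f -> e * e = e ->
  e != 0 ->
  e * a = a -> a * f = a -> f * b = b -> b * e = b -> a * b = e -> iso_idem e f.
Proof.
move=> [ff _ prim] ee e0 ea af fb be ab.
exists a, b; split=> //; split=> //.
pose g := b * a.
have fg : f * g = g by rewrite mulrA fb.
have gf : g * f = g by rewrite -mulrA af.
have gg : g * g = g by rewrite /g mulrA -[b * a * b]mulrA ab be.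
have [||||g0|/subr0_eq eg'] := prim g (f - g) gg.
- by rewrite mulrBl !mulrBr ff fg gf gg subrr subr0.
- by rewrite mulrBr gf gg subrr.
- by rewrite mulrBl fg gg subrr.
- by rewrite addrC subrK.
- case/negP: e0; apply/eqP.
  by rewrite -ee -[in LHS]ab mulrA -(mulrA a) -/g g0 mulr0 mul0r.
by [].
Qed.

(* If a(ebe) is invertible in eAe, then e is conjugate to the idempotent b(ebe)^-1,
   which has the same right ideal as f. *)
Lemma conjugate_of_corner_unit e f a b : e * e = e -> f * f = f ->
  e * a = a -> a * f = a -> f * b = b -> b * e = b -> a * b = e -> b * a = f ->
  corner_unit e (e * b) -> conjugate e f.
Proof.
move=> ee ff ea af fb be ab ba [c [ec ce bc cb]].
pose g := b * c.
have eg : e * g = e by rewrite /g mulrA bc.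
have ge : g * e = g by rewrite /g -mulrA ce.
have gg : g * g = g by rewrite -{1}ge -mulrA eg ge.
apply: (conjugate_trans (conjugate_same_left_ideal ee gg eg ge)).
apply: (conjugate_same_right_ideal gg ff).
  have fE : f = g * (e * b * a).
    have -> : g * (e * b * a) = b * (c * (e * b)) * a by rewrite /g !mulrA.
    by rewrite cb be ba.
  by rewrite fE mulrA gg.
by rewrite /g mulrA fb.
Qed.

(** By locality one summand of [e = a * e * b + a * (1 - e) * b] is a unit. In the first case
    [conjugate_of_corner_unit] applies. In the second, [e] is isomorphic to an idempotent [f']
    orthogonal to it, hence conjugate to [f'] by an exchange, and the first case holds for [f'] and
    [f]. *)
Lemma conjugate_of_iso e f : pi_regular -> primitive_idempotent e ->
  f * f = f -> iso_idem e f -> conjugate e f.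
Proof.
move=> piA pe ff [a [b [ea af fb be [ab ba]]]]; have [ee e0 _] := pe.
have [|||aeb|a1eb] := @corner_unit_split e (a * e * b) (a * (1 - e) * b) piA pe.
- by rewrite !mulrA ea.
- by rewrite -!mulrA be.
- by rewrite -mulrDl -mulrDr addrC subrK mulr1 ab.
- apply: (conjugate_of_corner_unit ee ff ea af fb be ab ba).
  case: aeb => c [ec ce xc cx].
  apply: (@corner_unit_of_left_inverse _ _ (c * a)) => //.
  - by rewrite mulrA ee.
  - by rewrite -mulrA be.
  by rewrite -[RHS]cx !mulrA.
case: a1eb => c [ec ce xc cx].
pose b' := (1 - e) * b; pose a' := c * a * (1 - e).
have e1 : e * (1 - e) = 0 by rewrite mulrBr mulr1 ee subrr.
have e1' : (1 - e) * e = 0 by rewrite mulrBl mul1r ee subrr.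
have ee1 : (1 - e) * (1 - e) = 1 - e by rewrite {1}mulrBl mul1r e1 subr0.
have ab' : a' * b' = e by rewrite /a' /b' !mulrA -[_ * (1 - e) * (1 - e)]mulrA ee1 -[RHS]cx !mulrA.
pose f' := b' * a'.
have b'e : b' * e = b' by rewrite /b' -mulrA be.
have ea' : e * a' = a' by rewrite /a' !mulrA ec.
have f'f' : f' * f' = f' by rewrite /f' mulrA -[b' * a' * b']mulrA ab' b'e.
have ef' : e * f' = 0 by rewrite /f' /b' !mulrA e1 !mul0r.
have f'e : f' * e = 0 by rewrite /f' /a' -!mulrA e1' !mulr0.
have fb' : f' * b' = b' by rewrite /f' -mulrA ab' b'e.
have af' : a' * f' = a' by rewrite /f' mulrA ab' ea'.
have cef' : conjugate e f'.
  exact: (conjugate_orthogonal ee f'f' ef' f'e ea' af' fb' b'e ab' erefl).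
apply: (conjugate_trans cef').
have a'b : a' * b = e by rewrite -[RHS]cx /a' !mulrA.
apply: (@conjugate_of_corner_unit f' f (b' * a) (b * a')) => //.
- by rewrite mulrA fb'.
- by rewrite -mulrA af.
- by rewrite mulrA fb.
- by rewrite -mulrA af'.
- by rewrite mulrA -[b' * a * b]mulrA ab b'e.
- by rewrite mulrA -[b * a' * b']mulrA ab' be ba.
exists f'; rewrite f'f'; have E : f' * (b * a') = f' by rewrite /f' mulrA -[b' * a' * b]mulrA a'b b'e.
by rewrite E f'f'.
Qed.

End Idempotents.

(** * The Jacobson radical of a monoid algebra over a field *)

Section FiniteDimension.
Variables (M : finMonoidType) (K : fieldType).
Local Notation KM := (monoid_algebra M K).

(** A subspace of maximal dimension inside [P] is all of [P], since adjoining a further vector would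
    enlarge it. *)
Lemma vspace_of_pred (V : vectType K) (P : V -> Prop) : P 0 ->
  (forall c x y, P x -> P y -> P (c *: x + y)) ->
  exists U : {vspace V}, forall x, x \in U <-> P x.
Proof.
move=> P0 PL.
pose q n := `[< exists U : {vspace V}, (forall x, x \in U -> P x) /\ \dim U = n >].
have q0 : exists n, q n.
  exists 0%N; apply/asboolP; exists 0%VS; rewrite dimv0; split=> // x.
  by rewrite memv0 => /eqP->.
have qb n : q n -> (n <= \dim {:V})%N.
  by move=> /asboolP[U [_ <-]]; apply/dimvS/subvf.
case: (ex_maxnP q0 qb) => n /asboolP[U [UP dU]] nmax.
exists U => x; split=> [/UP//|Px].
have /nmax : q (\dim (U + <[x]>)%VS).
  apply/asboolP; exists (U + <[x]>)%VS; split=> // y.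
  move=> /memv_addP[u uU [v /vlineP[c ->] ->]].
  by rewrite addrC; apply: PL => //; apply: UP.
rewrite -dU => dUx; have : (U == U + <[x]>)%VS by rewrite eqEdim addvSl.
by move=> /eqP->; apply: (subvP (addvSr U <[x]>)); apply: memv_line.
Qed.

(** The subspaces of all [x ^+ i * y] with [y] commuting with [x] decrease with [i]; by dimension
    they become stationary. *)
Lemma monoid_algebra_pi_regular : pi_regular KM.
Proof.
move=> x; pose P i (z : KM) := exists2 y, x * y = y * x & z = x ^+ i * y.
have U_ i : {U : {vspace KM} | forall z, z \in U <-> P i z}.
  apply: cid; apply: vspace_of_pred.
    by exists 0; rewrite ?mulr0 ?mul0r.
  move=> c _ _ [y xy ->] [z xz ->]; exists (c *: y + z).
    by rewrite mulrDr mulrDl -scalerAl -scalerAr xy xz.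
  by rewrite mulrDr scalerAr.
pose U i := sval (U_ i); have UP i z : z \in U i <-> P i z := svalP (U_ i) z.
have US i : (U i.+1 <= U i)%VS.
  apply/subvP => z /UP[y xy ->]; apply/UP; exists (x * y); first by rewrite {1}xy mulrA.
  by rewrite exprSr mulrA.
suff [n Un] : exists n, (U n <= U n.+1)%VS.
  have /(subvP Un)/UP[y xy E] : x ^+ n \in U n.
    by apply/UP; exists 1; rewrite ?mulr1 ?mul1r.
  by exists n, y.
apply: contrapT => /forallNP no.
have dU i : (i + \dim (U i) <= \dim (U 0%N))%N.
  elim: i => [|i IHi]; first by rewrite add0n.
  apply: leq_trans IHi; rewrite addSnnS leq_add2l ltn_neqAle dimvS // andbT.
  by apply/negP => dE; apply: (no i); move: (eqEdim (U i.+1) (U i)); rewrite US (eqP dE) leqnn => /eqP->.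
by have := dU (\dim (U 0%N)).+1; rewrite addSn ltnNge leq_addr.
Qed.

Lemma maximal_left_ideal_exists (I : KM -> Prop) : left_ideal I -> ~ I 1 ->
  exists2 m, maximal_left_ideal m & forall x, I x -> m x.
Proof.
move=> lI I1.
have vs (J : KM -> Prop) : left_ideal J ->
    exists U : {vspace KM}, forall x, x \in U <-> J x.
  move=> [J0 JD JM]; apply: vspace_of_pred => // c x y Jx Jy; apply: (JD) => //.
  by rewrite -[x]mul1r scalerAl; apply: JM.
pose q n := `[< exists (U : {vspace KM}) J, [/\ left_ideal J, ~ J 1,
  forall x, I x -> J x, forall x, x \in U <-> J x & \dim U = n] >].
have q0 : exists n, q n.
  by have [U UI] := vs I lI; exists (\dim U); apply/asboolP; exists U, I.
have qb n : q n -> (n <= \dim {:KM})%N.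
  by move=> /asboolP[U [J [_ _ _ _ <-]]]; apply/dimvS/subvf.
case: (ex_maxnP q0 qb) => n /asboolP[U [m [lm m1 Im Um dU]]] nmax.
exists m => //; split=> // J lJ J1 mJ x Jx.
have [W WJ] := vs J lJ.
have UW : (U <= W)%VS by apply/subvP => y /Um/mJ/WJ.
have : (\dim W <= n)%N.
  by apply: nmax; apply/asboolP; exists W, J; split=> // y /Im/mJ.
rewrite -dU => dW; have /eqP UWE : (U == W)%VS by rewrite eqEdim UW.
by apply/Um; rewrite UWE; apply/WJ.
Qed.

Lemma jacobson_radical_left (x a : KM) :
  jacobson_radical x -> jacobson_radical (a * x).
Proof. by move=> Jx m mm; have [[_ _ mM] _ _] := mm; apply: mM; apply: Jx. Qed.

Lemma jacobson_left_inverse (x : KM) : jacobson_radical x ->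
  exists y, y * (1 - x) = 1.
Proof.
move=> Jx; apply: contrapT => no.
have [||m mm mI] := @maximal_left_ideal_exists (fun z => exists y, z = y * (1 - x)).
- split; first by exists 0; rewrite mul0r.
    by move=> _ _ [y ->] [z ->]; exists (y + z); rewrite mulrDl.
  by move=> a _ [y ->]; exists (a * y); rewrite mulrA.
- by case=> y E; apply: no; exists y.
have [[m0 mD mM] m1 _] := mm; apply: m1.
rewrite -(subrK x 1); apply: mD; last exact: Jx.
by apply: mI; exists 1; rewrite mul1r.
Qed.

(** Pi-regularity gives [(1 - y * x) * x ^+ n = 0], and [1 - y * x] has a left inverse. *)
Lemma jacobson_radical_nil (x : KM) : jacobson_radical x -> exists n, x ^+ n = 0.
Proof.
move=> Jx; have [n [y [xy xn]]] := monoid_algebra_pi_regular x.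
have [u uE] := jacobson_left_inverse (jacobson_radical_left y Jx).
exists n; rewrite -[LHS]mul1r -uE -mulrA mulrBl mul1r -xy.
suff -> : x ^+ n - x * y * x ^+ n = 0 by rewrite mulr0.
have -> : x * y * x ^+ n = x ^+ n * (x * y).
  by apply/commrX/commr_sym/commrM.
by rewrite mulrA -exprSr -xn subrr.
Qed.

(** Were [x] outside [m], the left ideal m + I would contain [1 = a + b]; but [b] is nilpotent, so
    [a = 1 - b] would be a unit in [m]. *)
Lemma nilpotent_ideal_jacobson (I : KM -> Prop) e : two_sided_ideal I ->
  (forall x, ideal_pow I e x -> x = 0) -> forall x, I x -> jacobson_radical x.
Proof.
move=> [[I0 ID IM] IMr] nI x Ix m mm.
have [[m0 mD mM] m1 mmax] := mm.
apply: contrapT => mx; apply: m1.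
suff : m 1 by [].
have : exists a b, [/\ m a, I b & 1 = a + b].
  apply: contrapT => no.
  apply: mx; apply: (mmax (fun z => exists a b, [/\ m a, I b & z = a + b])).
  - split; first by exists 0, 0; rewrite addr0.
      move=> _ _ [a [b [ma Ib ->]]] [a' [b' [ma' Ib' ->]]].
      by exists (a + a'), (b + b'); split; auto; rewrite addrACA.
    move=> c _ [a [b [ma Ib ->]]]; exists (c * a), (c * b).
    by split; auto; rewrite mulrDr.
  - by move=> [a [b [ma Ib E]]]; apply: no; exists a, b.
  - by move=> z mz; exists z, 0; rewrite addr0.
  - by exists 0, x; rewrite add0r.
move=> [a [b [ma Ib E]]].
have bn : b ^+ e = 0.
  apply: nI; elim: (e) => //= e0 IHe; rewrite exprSr.
  by exists [:: (b ^+ e0, b)]; rewrite ?big_seq1 //= => u; rewrite inE => /eqP->.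
have -> : 1 = (\sum_(i < e) b ^+ i) * a.
  have -> : a = 1 - b by rewrite E addrK.
  have cb : GRing.comm (\sum_(i < e) b ^+ i) (1 - b).
    apply/commr_sym/commr_sum => i _; apply/commrX/commr_sym/commrB => //.
    exact: commr1.
  by rewrite cb -opprB mulNr -subrX1 bn sub0r opprK.
exact: mM.
Qed.


End FiniteDimension.

(** Since X - T divides X^e - T^e = X^e, determinants show that the characteristic polynomial
    divides a power of X. Being monic it is a power of X, so its subleading coefficient vanishes. *)
Lemma nilpotent_mxtrace (K : fieldType) n (T : 'M[K]_n) e : T ^+ e = 0 -> \tr T = 0.
Proof.
case: n T => [|n] T Te; first by rewrite /mxtrace big_ord0.
pose X : 'M[{poly K}]_n.+1 := 'X%:M; pose T' : 'M[{poly K}]_n.+1 := map_mx polyC T.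
have cXT : GRing.comm X T' by apply/esym; apply: scalar_mxC.
have XE : X ^+ e = ('X^e)%:M by rewrite -rmorphXn.
have TE i : T' ^+ i = map_mx polyC (T ^+ i).
  by elim: i => [|i IHi]; rewrite ?map_mx1 // !exprS IHi map_mxM.
have {}TE : T' ^+ e = 0 by rewrite TE Te raddf0.
have /(congr1 determinant) := subrXX_comm e cXT.
rewrite XE TE subr0 det_scalar det_mulmx -exprM -[\det (X - T')]/(char_poly T) => E.
have : (char_poly T %| ('X - 0%:P) ^+ (e * n.+1))%R.
  by rewrite subr0 E dvdp_mulr.
case/dvdp_exp_XsubCP => k _; rewrite subr0 => TX.
have {TX}TX : char_poly T = 'X^k.
  by apply/eqP; rewrite -eqp_monic ?monicXn ?char_poly_monic.
have kn : k = n.+1.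
  by have := size_char_poly T; rewrite TX size_polyXn => -[].
have := char_poly_trace T (ltn0Sn n).
by rewrite TX kn coefXn /= ltn_eqF // => /esym/eqP; rewrite oppr_eq0 => /eqP.
Qed.

(** * Traces on the algebras of the maximal subgroups *)

Section TraceForm.
Variables (M : finMonoidType) (K : fieldType) (f : midem M).
Local Notation KM := (monoid_algebra M K).
Local Notation f0 := (val f).
Local Notation G := (maxgroup f).

Lemma corner_support (z : KM) b : madelta K f0 * z * madelta K f0 = z -> z b != 0 ->
  (f0 * b = b)%g /\ (b * f0 = b)%g.
Proof.
move=> zE; rewrite -{1}zE -sandwich_delta => zb.
have [n /eqP <-|no] := pickP (fun n => (f0 * n * f0)%g == b).
  by rewrite !mulgA (midemE f) -!mulgA (midemE f).
by case/eqP: zb; apply: big1 => n; rewrite no.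
Qed.

Lemma unit_atP m g : (f0 * m = m)%g -> (m * f0 = m)%g -> unit_at f g -> J_le g m ->
  unit_at f m.
Proof.
move=> fm mf /andP[/eqP gE /existsP[g' /and3P[_ /eqP gg' _]]] gm.
have [|n [fn nf mn nm]] := local_unit (midemE f) fm mf.
  by apply: J_le_trans gm; rewrite -gg'; apply: J_le_mulr.
apply/andP; rewrite fm mf; split=> //; apply/existsP; exists n.
by rewrite fn nf mn nm !eqxx.
Qed.

(** Left multiplication by [x] on K G_f, products outside G_f being dropped. This respects products
    in the corner at [f] because a product in fMf can be a unit only if its factors are. *)
Definition regular_mx (x : KM) : 'M[K]_#|{: G}| :=
  \matrix_(i, j) (x * madelta K (val (enum_val j))) (val (enum_val i)).

Lemma regular_mx1 : regular_mx 1 = 1.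
Proof.
apply/matrixP => i j; rewrite !mxE mul1r ffunE.
by rewrite (inj_eq val_inj) (inj_eq enum_val_inj).
Qed.

Lemma mul_deltaE (x : KM) h g :
  (x * madelta K h) g = \sum_a x a *+ ((a * h)%g == g).
Proof.
rewrite [LHS]ma_mulE; apply: eq_bigr => a _.
rewrite (bigD1 h) //= [X in _ + X]big1 ?addr0.
  by rewrite ffunE eqxx mulr1.
by move=> b /negbTE bh; rewrite ffunE bh mulr0 mul0rn.
Qed.

Lemma regular_mxM (x y : KM) : madelta K f0 * y * madelta K f0 = y ->
  regular_mx (x * y) = regular_mx x *m regular_mx y.
Proof.
move=> yE; apply/matrixP => i j; rewrite !mxE.
set h := enum_val j; set g := enum_val i.
pose z := y * madelta K (val h).
have zE : madelta K f0 * z * madelta K f0 = z.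
  rewrite /z -{2}yE !mulrA -[_ * madelta K (val h) * _]mulrA -!madeltaM.
  by rewrite (maxgroup_f h).2 -{1}(maxgroup_f h).1 madeltaM !mulrA.
rewrite -mulrA -/z [LHS]ma_mulE exchange_big /=.
transitivity (\sum_(b | unit_at f b) \sum_a (x a * z b) *+ ((a * b)%g == val g)).
  rewrite [RHS]big_mkcond; apply: eq_bigr => b _.
  case: ifPn => // bG; apply: big1 => a _.
  have [->|zb] := eqVneq (z b) 0; first by rewrite mulr0 mul0rn.
  have [fb bf] := corner_support zE zb.
  case: eqP => // ab; case/negP: bG.
  apply: (unit_atP fb bf (valP g)).
  by have := J_le_mull a b; rewrite ab.
transitivity (\sum_(h' : G) (x * madelta K (val h')) (val g) * z (val h')).
  under eq_bigr => b _ do under eq_bigr => a _ do rewrite -mulrnAl.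
  under eq_bigr => b _ do rewrite -mulr_suml -mul_deltaE.
  rewrite (reindex_onto (val : G -> M) (insubd (maxgroup_one f))) /=.
    apply: eq_bigl => h'; rewrite (valP h') /=.
    by rewrite valKd eqxx.
  by move=> b ub; apply: (insubdK (maxgroup_one f) ub).
rewrite (reindex (@enum_val _ (mem {: G}))) /=; last first.
  by apply: onW_bij; apply: enum_val_bij.
by apply: eq_bigr => h' _; rewrite !mxE.
Qed.

(* y acts on K G_f with trace |G_f| y(f). *)
Lemma nilpotent_coef_idem (y : KM) e : #|{: G}|%:R != 0 :> K ->
  madelta K f0 * y * madelta K f0 = y -> y ^+ e = 0 -> y f0 = 0.
Proof.
move=> G0 yE ye.
have /nilpotent_mxtrace : regular_mx y ^+ e = 0.
  have <- : regular_mx (y ^+ e) = regular_mx y ^+ e.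
    elim: e {ye} => [|e IHe]; first exact: regular_mx1.
    by rewrite !exprSr regular_mxM // IHe.
  by apply/matrixP => i j; rewrite ye !mxE mul0r ffunE.
rewrite /mxtrace => tr; have [//|y0] := eqVneq (y f0) 0.
suff /eqP : y f0 *+ #|{: G}| = 0.
  by rewrite -[y f0 *+ _]mulr_natr mulf_eq0 (negPf G0) orbF => /eqP.
rewrite -[RHS]tr -[in LHS](card_ord #|{: G}|) -sumr_const; apply: eq_bigr => i _.
rewrite mxE mul_deltaE; set g := enum_val i.
have [_ /existsP[g' /and3P[_ /eqP gg' _]]] := andP (valP g).
rewrite (bigD1 f0) //= (maxgroup_f g).1 eqxx mulr1n big1 ?addr0 // => a af.
have [->|/(corner_support yE)[_ af0]] := eqVneq (y a) 0; first by rewrite mul0rn.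
case: eqP => // ag; case/eqP: af.
by rewrite -af0 -gg' mulgA ag.
Qed.

End TraceForm.

(** The sum for [f], [r], [l] is the coefficient at [f] of [R * x * L], an element of the corner at
    [f]. Its power of exponent n + 1 is [R * x * (L * R * x) ^+ n * L], so it is nilpotent and the
    trace argument applies. *)
Lemma nil_left_ideal_sandwich_radical (M : finMonoidType) (K : fieldType)
    (x : monoid_algebra M K) :
  (forall f : midem M, #|{: maxgroup f}|%:R != 0 :> K) ->
  (forall a, exists n, (a * x) ^+ n = 0) -> sandwich_radical x.
Proof.
move=> GK nilx f r l ff fr lf; rewrite sandwich_delta.
have fP : (f * f == f)%g by apply/eqP.
pose f' : midem M := exist _ f fP.
pose R := madelta K r; pose L := madelta K l.
have [n xn] := nilx (L * R).
apply: (@nilpotent_coef_idem M K f' _ n.+1 (GK f')).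
  by rewrite /= !mulrA -madeltaM fr -[_ * madelta K l * _]mulrA -madeltaM lf.
suff -> : (R * x * L) ^+ n.+1 = R * x * (L * R * x) ^+ n * L.
  by rewrite xn mulr0 mul0r.
elim: n {xn} => [|n IHn]; first by rewrite expr1 mulr1.
by rewrite exprSr IHn exprSr !mulrA.
Qed.

(** * Torsion and purity over the integers *)

Section Torsion.
Import VectorInternalTheory.
Variables (V : vectType int) (B : zsubgroup V).
Local Notation n := (dim V).

Definition ratr_row (v : V) : 'rV[rat]_n := map_mx intr (v2r v).

Lemma ratr_rowMz v c : ratr_row (v *~ c) = c%:~R *: ratr_row v.
Proof.
by apply/rowP => j; rewrite /ratr_row raddfMz /= -scaler_int intz !mxE rmorphM.
Qed.

Lemma ratr_row_sum (I : Type) (s : seq I) (c : I -> int) (b : I -> V) :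
  ratr_row (\sum_(i <- s) b i *~ c i) = \sum_(i <- s) (c i)%:~R *: ratr_row (b i).
Proof.
under [RHS]eq_bigr => i _ do rewrite -ratr_rowMz.
by rewrite /ratr_row !raddf_sum.
Qed.

Lemma zsub_sum (I : Type) (s : seq I) (b : I -> V) :
  (forall i, B (b i)) -> B (\sum_(i <- s) b i).
Proof.
move=> Bb; elim: s => [|i s IHs]; first by rewrite big_nil; apply: zsub0.
rewrite big_cons -[X in X + _]opprK addrC.
by apply: zsubB => //; rewrite -sub0r; apply: zsubB => //; apply: zsub0.
Qed.

Lemma zsubMz b c : B b -> B (b *~ c).
Proof.
move=> Bb; have BN x : B x -> B (- x).
  by move=> Bx; rewrite -sub0r; apply: zsubB => //; apply: zsub0.
have Bn k : B (b *+ k).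
  elim: k => [|k IHk]; first exact: zsub0.
  by rewrite mulrS addrC -[X in _ + X]opprK; apply: zsubB => //; apply: BN.
by case: c => k; [apply: Bn | apply/BN/Bn].
Qed.

(** Finitely many elements of [B] generate its rational span. A torsion vector is a rational
    combination of them; subtracting the integral parts of the coefficients leaves coordinates
    bounded by the sum [C] of all absolute values. *)
Lemma torsion_bounded : exists C : nat, forall v k, (0 < k)%N -> B (v *+ k) ->
  exists w, B (v - w) /\ forall j, `|v2r w 0 j| <= C%:Z.
Proof.
pose P d := `[< exists2 b : seq V, forall x, x \in b -> B x &
  \dim <<map ratr_row b>> = d >].
have P0 : exists d, P d by exists (\dim <<map ratr_row [::]>>); apply/asboolP; exists [::].
have Pb d : P d -> (d <= \dim {:'rV[rat]_n})%N.
  by move=> /asboolP[b _ <-]; apply/dimvS/subvf.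
case: (ex_maxnP P0 Pb) => d /asboolP[b bB bd] dmax.
have bspan x : B x -> ratr_row x \in <<map ratr_row b>>%VS.
  move=> Bx; have : P (\dim <<map ratr_row (x :: b)>>).
    by apply/asboolP; exists (x :: b) => // y; rewrite inE => /orP[/eqP->|/bB].
  move/dmax; rewrite -bd => le.
  have sub : (<<map ratr_row b>> <= <<map ratr_row (x :: b)>>)%VS.
    by rewrite /= span_cons addvSr.
  have /eqP -> : (<<map ratr_row b>> == <<map ratr_row (x :: b)>>)%VS.
    by rewrite eqEdim sub le.
  by rewrite memv_span // mem_head.
pose X := in_tuple (map ratr_row b).
pose bi (i : 'I_(size (map ratr_row b))) := nth 0 b i.
have sb (i : 'I_(size (map ratr_row b))) : (i < size b)%N.
  by rewrite -(size_map ratr_row).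
have biB i : B (bi i).
  exact/bB/mem_nth/sb.
have qbi (i : 'I_(size (map ratr_row b))) : X`_i = ratr_row (bi i).
  by rewrite /X /= (nth_map 0) // sb.
pose C := (\sum_i \sum_j absz (v2r (bi i) 0%R j))%N.
exists C => v k k0 Bv.
have vX : ratr_row v \in <<X>>%VS.
  have -> : ratr_row v = k%:R^-1 *: ratr_row (v *+ k).
    by rewrite pmulrn ratr_rowMz scalerA mulVf ?scale1r // ?intr_eq0 ?pnatr_eq0 -lt0n.
  by apply/memvZ/bspan.
pose c i := coord X i (ratr_row v).
pose u := \sum_i bi i *~ Num.floor (c i).
exists (v - u); split.
  by rewrite opprB addrC subrK; apply: zsub_sum => i; apply: zsubMz.
move=> j; rewrite -(ler_int rat).
have -> : (`|v2r (v - u) 0 j|)%:~R = `|ratr_row (v - u) 0 j| :> rat.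
  by rewrite intr_norm !mxE.
have -> : ratr_row (v - u) = \sum_i (c i - (Num.floor (c i))%:~R) *: ratr_row (bi i).
  transitivity (ratr_row v - ratr_row u); first by rewrite /ratr_row !raddfB.
  rewrite {1}(coord_span vX) /u ratr_row_sum -sumrB; apply: eq_bigr => i _.
  by rewrite scalerBl qbi.
rewrite summxE; apply: le_trans (ler_norm_sum _ _ _) _.
rewrite [leRHS](_ : _ = \sum_i \sum_j `|ratr_row (bi i) 0 j|); last first.
  rewrite -pmulrn /C natr_sum; apply: eq_bigr => i _; rewrite natr_sum.
  by apply: eq_bigr => j' _; rewrite natr_absz intr_norm !mxE.
apply: ler_sum => i _; rewrite mxE normrM (bigD1 j) //=.
apply: (@le_trans _ _ `|ratr_row (bi i) 0 j|); last by rewrite lerDl sumr_ge0.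
rewrite ler_piMl ?normr_ge0 //.
have /andP[fl lf] := floor_itv (c i).
by rewrite ger0_norm ?subr_ge0 // lerBlDr; apply/ltW; rewrite addrC -(intrD _ _ 1).
Qed.

Definition box_row C (k : {ffun 'I_n -> 'I_(C + C).+1}) : 'rV[int]_n :=
  \row_j ((k j)%:Z - C%:Z).

Lemma pi_quotD (x y : V) : \pi_(zquot B) (x + y) = \pi x + \pi y.
Proof. by rewrite !piE. Qed.

Lemma pi_quot0 : \pi_(zquot B) 0 = 0.
Proof. by apply: (addIr (\pi 0)); rewrite add0r -pi_quotD addr0. Qed.

Lemma pi_quotMn (x : V) k : \pi_(zquot B) (x *+ k) = \pi x *+ k.
Proof.
by elim: k => [|k IHk]; rewrite ?mulr0n ?pi_quot0 // !mulrS pi_quotD IHk.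
Qed.

Lemma quot_torsion_finite (A : V -> Prop) :
  exists2 s : seq (zquot B), uniq s & forall x, x \in s <-> @quot_torsion V A B x.
Proof.
have [C CP] := torsion_bounded.
pose all_ := [seq \pi_(zquot B) (r2v (box_row k)) | k : {ffun 'I_n -> 'I_(C + C).+1}].
exists (undup [seq x <- all_ | `[< @quot_torsion V A B x >]]); first exact: undup_uniq.
move=> x; rewrite mem_undup mem_filter; split=> [/andP[/asboolP]//|xT].
apply/andP; split; first exact/asboolP.
have [[v Av xv] [k k0 xk]] := xT.
have Bv : B (v *+ k).
  have /zquotP : \pi_(zquot B) (v *+ k) = \pi_(zquot B) 0.
    by rewrite pi_quotMn -xv xk pi_quot0.
  by rewrite subr0.
have [w [vw wC]] := CP v k k0 Bv.
rewrite xv (iffRL (@zquotP V B v w) vw).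
have wb j : (absz (v2r w 0%R j + C%:Z)%R < (C + C).+1)%N by have := wC j; lia.
apply/mapP; exists [ffun j => Ordinal (wb j)]; first by rewrite mem_enum.
congr (\pi _); apply: v2r_inj; rewrite r2vK; apply/rowP => j.
have boxE z : `|z| <= C%:Z -> z = (absz (z + C%:Z))%:Z - C%:Z by lia.
by rewrite mxE ffunE /=; apply/boxE/wC.
Qed.

(** Translation by the class [t] of [a], which has order [p], permutes the finite torsion set.
    Comparing the sums of its elements gives [t *+ size s = 0]. *)
Lemma torsion_witness_dvd (A : V -> Prop) p a : prime p ->
  (forall x y, A x -> A y -> A (x + y)) ->
  A a -> B (a *+ p) -> ~ B a -> dvd_torsion p A B.
Proof.
move=> p_pr AD Aa Bpa Ba; have [s s_uniq sP] := quot_torsion_finite A.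
exists s; split=> //.
pose t : zquot B := \pi a.
have tp : t *+ p = 0.
  rewrite -pi_quotMn -pi_quot0; apply/zquotP; by rewrite subr0.
have t0 : t != 0.
  by apply/eqP; rewrite -pi_quot0 => /zquotP; rewrite subr0.
have st x : x \in s -> x + t \in s.
  move=> /sP[[b Ab ->] [k k0 bk]]; apply/sP; split.
    by exists (b + a); rewrite ?pi_quotD //; apply: AD.
  exists (k * p)%N; first by rewrite muln_gt0 k0 prime_gt0.
  by rewrite mulrnDl mulrnA bk mul0rn add0r mulnC mulrnA tp mul0rn.
have sum_t : t *+ size s = 0.
  apply: (addrI (\sum_(x <- s) x)); rewrite addr0.
  have -> : t *+ size s = \sum_(x <- s) t by rewrite big_const_seq count_predT iter_addr_0.
  rewrite -big_split /= -(big_map (+%R^~ t) predT id).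
  apply: perm_big; apply: uniq_perm => //.
    by rewrite map_inj_uniq // => x y /addIr.
  have sub : {subset [seq x + t | x <- s] <= s} by move=> _ /mapP[x /st xs ->].
  have um : uniq [seq (x : zquot B) + t | x <- s] by rewrite map_inj_uniq // => x y /addIr.
  have sm : (size s <= size [seq (x + t)%R | x <- s])%N by rewrite size_map.
  by have [_ E] := uniq_min_size um sub sm.
apply: contraNT t0 => ndvd.
have : coprime p (size s) by rewrite prime_coprime.
move=> /(coprimeP _ (prime_gt0 p_pr))[[u v] /= uv].
rewrite -[t]mulr1n -uv mulrnBr; last by lia.
by rewrite mulnC mulrnA tp mul0rn mulnC mulrnA sum_t mul0rn subr0.
Qed.

Lemma no_dvd_torsion (A : V -> Prop) p a : prime p ->
  (forall x y, A x -> A y -> A (x + y)) -> ~ dvd_torsion p A B ->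
  A a -> B (a *+ p) -> B a.
Proof.
move=> p_pr AD nd Aa Bpa; apply: contrapT => Ba; apply: nd.
exact: (torsion_witness_dvd p_pr AD Aa Bpa Ba).
Qed.

End Torsion.

(** * Smith normal form, purity and integral kernels *)

Definition smith_mx m n (d : seq int) : 'M[int]_(m, n) :=
  \matrix_(i, j) (d`_i *+ (i == j :> nat)).

Lemma smith_mulE (R : comNzRingType) (h : {rmorphism int -> R}) m n q d
    (y : 'M[R]_(n, q)) (i : 'I_m) k :
  (map_mx h (smith_mx m n d) *m y) i k =
  if insub (i : nat) is Some j then h d`_i * y j k else 0.
Proof.
rewrite !mxE; case: insubP => [j _ ji|ni].
  have ij : (i : nat) == j by rewrite -[(j : nat)]/(val j) ji.
  rewrite (bigD1 j) //= !mxE ij mulr1n big1 ?addr0 // => j' jj'.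
  rewrite !mxE; case: eqP => [ij'|_]; last by rewrite mulr0n rmorph0 mul0r.
  by case/eqP: jj'; apply: val_inj; rewrite /= -ij' (eqP ij).
apply: big1 => j _; rewrite !mxE; case: eqP => [ij|_]; last by rewrite rmorph0 mul0r.
by rewrite ij ltn_ord in ni.
Qed.

Lemma smith_mulE_int m n q d (y : 'M[int]_(n, q)) (i : 'I_m) k :
  (smith_mx m n d *m y) i k =
  if insub (i : nat) is Some j then d`_i * y j k else 0.
Proof.
rewrite -(smith_mulE idfun); congr ((_ *m _) _ _).
by apply/matrixP => a b; rewrite [in RHS]mxE.
Qed.

(* [c'] is a multiple, prime to [p], of a generalised inverse of [c]. *)
Lemma pure_mx_quasi_inverse p m n (c : 'M[int]_(m, n)) : prime p ->
  (forall (v : 'cV_m) (w : 'cV_n), v *+ p = c *m w -> exists u, v = c *m u) ->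
  exists (c' : 'M[int]_(n, m)) N, ~~ (p %| N)%N /\ c *m c' *m c = c *+ N.
Proof.
move=> p_pr pure_c.
have [L uL [R uR [d _ cE]]] := int_Smith_normal_form c.
rewrite -/(smith_mx m n d) in cE.
(* If [d_i = q * p], then [p] times the vector [q *: (L *m ei)] lies in the image of [c]; by purity
   so does the vector. Comparing coordinate [i] in Smith form shows that [q] is a multiple of
   [d_i = q * p], so [p] would be a unit. *)
have pd i j : (i < m)%N -> (j < n)%N -> i = j -> d`_i != 0 -> ~~ (p %| absz (d`_i)%R)%N.
  move=> im jn ij di0; apply/negP => pd.
  have [q dq] : exists q : int, d`_i = q * p%:Z.
    by have /dvdzP[q ->] : (p%:Z %| d`_i)%Z by []; exists q.
  pose ei : 'cV[int]_m := delta_mx (Ordinal im) 0.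
  pose ej : 'cV[int]_n := delta_mx (Ordinal jn) 0.
  have De : smith_mx m n d *m ej = d`_i *: ei.
    apply/matrixP => a b; rewrite smith_mulE_int !mxE.
    case: insubP => [j' _ j'a|na] /=.
      rewrite mxE -!val_eqE /= (ord1 b) eqxx andbT andbT j'a -ij.
      by case: eqP => [->|]; rewrite ?mulr0 ?mulr1.
    rewrite -val_eqE /=; case: eqP => [ai|]; last by rewrite mulr0.
    by rewrite ai ij jn in na.
  have [u uE] : exists u, q *: (L *m ei) = c *m u.
    apply: (pure_c _ (invmx R *m ej)).
    rewrite cE !mulmxA mulmxK // -mulmxA De dq -scalemxAr -scaler_nat scalerA.
    by rewrite natz mulrC.
  have {}uE : q *: ei = smith_mx m n d *m (R *m u).
    have := congr1 (mulmx (invmx L)) uE.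
    by rewrite cE -scalemxAr !mulmxA mulVmx // !mul1mx.
  have /(congr1 (fun x : 'cV_m => x (Ordinal im) 0)) := uE.
  rewrite smith_mulE_int !mxE !eqxx mulr1 /=.
  case: insubP => [j' _ _|]; last by rewrite ij jn.
  rewrite dq => qE.
  have q0 : q != 0 by apply: contraNneq di0 => q0; rewrite dq q0 mul0r.
  move/eqP: qE; rewrite -{1}[q]mulr1 -mulrA (inj_eq (mulfI q0)) => /eqP pE.
  have : (p%:Z %| 1)%Z by apply/dvdzP; eexists; rewrite mulrC; apply: pE.
  rewrite dvdzE /= dvdn1 => /eqP p1.
  by rewrite p1 in p_pr.
pose P i := [&& (i < m)%N, (i < n)%N & d`_i != 0].
(* A common multiple of the nonzero invariant factors; its quotients by them form the diagonal of
   the quasi-inverse. *)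
pose N := (\prod_(i < m | P i) absz (d`_i)%R)%N.
have pN : ~~ (p %| N)%N.
  rewrite /N; elim/big_ind: _ => [|x y px py|i /and3P[im jn di0]].
  - by rewrite dvdn1; apply: contraL p_pr => /eqP->.
  - by rewrite Euclid_dvdM // negb_or px.
  exact: (pd _ _ im jn).
have dN i : P i -> exists e, e * d`_i = N%:Z.
  move=> Pi; have /and3P[im _ _] := Pi.
  have : (d`_i %| N%:Z)%Z.
    by rewrite /N (bigD1 (Ordinal im)) //= PoszM dvdz_mulr // /dvdz /=.
  by move=> /dvdzP[e E]; exists e; rewrite -E.
pose e i := if pselect (P i) is left Pi then sval (cid (dN i Pi)) else 0.
have eP i : P i -> e i * d`_i = N%:Z.
  by move=> Pi; rewrite /e; case: pselect => // Pi'; case: cid.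
pose E : 'M[int]_(n, m) := smith_mx n m [seq e i | i <- iota 0 n].
have DED : smith_mx m n d *m E *m smith_mx m n d = smith_mx m n d *+ N.
  apply/matrixP => i k; rewrite -mulmxA smith_mulE_int mulmxnE.
  case: insubP => [j jn ji|ni].
    have ij : (i : nat) = j by rewrite -[(j : nat)]/(val j) ji.
    have ji' : insub (j : nat) = Some i by rewrite -ij; apply: valK.
    rewrite smith_mulE_int ji' mxE (nth_map 0%N) ?size_iota //= nth_iota // add0n -ij.
    have [->|di0] := eqVneq d`_i 0; first by rewrite !mul0rn mul0r.
    rewrite !mulrnAr -mulrnA mulnC mulrnA; congr (_ *+ _).
    rewrite mulrA [d`_i * e i]mulrC eP; first by rewrite mulr_natl || rewrite -mulr_natl natz.
    by rewrite /P ltn_ord ij ltn_ord -ij.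
  rewrite mxE; case: eqP => [ik|_]; last by rewrite !mul0rn.
  by rewrite ik ltn_ord in ni.
exists (invmx R *m E *m invmx L), N; split=> //.
rewrite cE; have -> : L *m smith_mx m n d *m R *m (invmx R *m E *m invmx L) *m
    (L *m smith_mx m n d *m R) = L *m (smith_mx m n d *m E *m smith_mx m n d) *m R.
  by rewrite !mulmxA mulmxK // mulmxKV // !mulmxA.
by rewrite DED -!scaler_nat -scalemxAr -scalemxAl.
Qed.

(** In Smith coordinates the kernel is spanned by the basis vectors whose invariant factor is zero
    or absent. Nonzero factors stay nonzero in a domain containing the integers, so the same
    integral matrix spans the kernel there. *)
Lemma int_kernel_mx m n (c : 'M[int]_(m, n)) : exists v : 'M[int]_n,
  c *m v = 0 /\ forall (R : idomainType) (x : 'cV[R]_n), injective (intr : int -> R) ->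
    map_mx intr c *m x = 0 -> exists y, x = map_mx intr v *m y.
Proof.
have [L uL [U uU [d _ cE]]] := int_Smith_normal_form c.
rewrite -/(smith_mx m n d) in cE.
pose k (j : nat) := (j < m)%N && (d`_j != 0).
pose E : 'M[int]_n := diag_mx (\row_j (~~ k j)%:R).
have SE : smith_mx m n d *m E = 0.
  apply/matrixP => i j; rewrite mul_mx_diag !mxE.
  case: eqP => [ij|_]; last by rewrite mul0r.
  rewrite /k -ij ltn_ord /= negbK; case: eqP => [->|_]; first by rewrite mul0r.
  by rewrite mulr0.
exists (invmx U *m E); split.
  by rewrite cE mulmxA mulmxK // -mulmxA SE mulmx0.
move=> R x injR cx.
have map_unit q (A : 'M[int]_q) : A \in unitmx -> map_mx (intr : int -> R) A \in unitmx.
  by rewrite !unitmxE det_map_mx; apply: rmorph_unit.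
exists (map_mx intr U *m x).
have Sx : map_mx intr (smith_mx m n d) *m (map_mx intr U *m x) = 0.
  apply: (can_inj (mulKmx (map_unit _ _ uL))).
  by rewrite mulmx0 -[RHS]cx cE !map_mxM !mulmxA.
have Ux : map_mx intr E *m (map_mx intr U *m x) = map_mx intr U *m x.
  move: (map_mx intr U *m x) Sx => y Sy; apply/colP => j.
  rewrite map_diag_mx mul_diag_mx !mxE.
  have [kj|_] := boolP (k j); last by rewrite mul1r.
  rewrite mul0r; have /andP[jm dj] := kj.
  have /colP/(_ (Ordinal jm)) := Sy.
  rewrite smith_mulE (_ : insub _ = Some j) ?mxE; last exact: (valK j).
  have d0 : (d`_j)%:~R != 0 :> R by apply: contra dj => /eqP dj0; apply/eqP/injR; rewrite dj0.
  by move=> /eqP; rewrite mulf_eq0 (negbTE d0) => /eqP->.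
by rewrite map_mxM -mulmxA Ux mulmxA -map_mxM mulVmx // map_mx1 mul1mx.
Qed.

Section FunctionForm.
Variables S T : finType.

Lemma pure_quasi_inverse p (c : S -> T -> int) : prime p ->
  (forall (v : S -> int) (w : T -> int),
     (forall s, v s *+ p = \sum_t c s t * w t) ->
     exists u, forall s, v s = \sum_t c s t * u t) ->
  exists (c' : T -> S -> int) N, ~~ (p %| N)%N /\ forall s t,
    \sum_t' \sum_s' c s t' * c' t' s' * c s' t = c s t *+ N.
Proof.
move=> p_pr pure_c.
pose C := \matrix_(i < #|S|, j < #|T|) c (enum_val i) (enum_val j).
have [|C' [N [pN CC]]] := @pure_mx_quasi_inverse p _ _ C p_pr.
  move=> v w vw.
  have [s|u uE] := pure_c (fun s => v (enum_rank s) 0) (fun t => w (enum_rank t) 0).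
    have /matrixP/(_ (enum_rank s) 0) := vw; rewrite mulmxnE mxE => ->.
    rewrite (reindex (@enum_rank T)) /=; last by apply: onW_bij; apply: enum_rank_bij.
    by apply: eq_bigr => t _; rewrite mxE !enum_rankK.
  exists (\col_j u (enum_val j)); apply/colP => i.
  rewrite mxE -[i in LHS]enum_valK uE.
  rewrite (reindex (@enum_val _ (mem T))) /=; last by apply: onW_bij; apply: enum_val_bij.
  by apply: eq_bigr => j _; rewrite !mxE.
exists (fun t s => C' (enum_rank t) (enum_rank s)), N; split=> // s t.
have /matrixP/(_ (enum_rank s) (enum_rank t)) := CC.
rewrite mulmxnE [C _ _]mxE !enum_rankK => <-.
rewrite exchange_big mxE (reindex (@enum_rank S)) /=; last by apply: onW_bij; apply: enum_rank_bij.
apply: eq_bigr => s' _; rewrite !mxE (reindex (@enum_rank T)) /=; last by apply: onW_bij; apply: enum_rank_bij.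
by rewrite mulr_suml; apply: eq_bigr => t' _; rewrite !mxE !enum_rankK.
Qed.

Lemma int_kernel (c : S -> T -> int) : exists v : T -> T -> int,
  (forall j s, \sum_t c s t * v t j = 0) /\
  forall (R : idomainType) (x : T -> R), injective (intr : int -> R) ->
    (forall s, \sum_t (c s t)%:~R * x t = 0) ->
    exists y, forall t, x t = \sum_j (v t j)%:~R * y j.
Proof.
pose C := \matrix_(i < #|S|, j < #|T|) c (enum_val i) (enum_val j).
have [V [CV VP]] := int_kernel_mx C.
exists (fun t j => V (enum_rank t) (enum_rank j)); split=> [j s|R x injR cx].
  have /matrixP/(_ (enum_rank s) (enum_rank j)) := CV; rewrite !mxE => CVj; rewrite -[RHS]CVj.
  rewrite [RHS](reindex (@enum_rank T)) /=; last by apply: onW_bij; apply: enum_rank_bij.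
  by apply: eq_bigr => t _; rewrite mxE !enum_rankK.
have [|y yE] := VP R (\col_j x (enum_val j)) injR.
  apply/colP => i; rewrite !mxE -[RHS](cx (enum_val i)).
  rewrite [RHS](reindex (@enum_val _ (mem T))) /=; last by apply: onW_bij; apply: enum_val_bij.
  by apply: eq_bigr => j _; rewrite !mxE.
exists (fun t => y (enum_rank t) 0) => t.
have /colP/(_ (enum_rank t)) := yE; rewrite !mxE enum_rankK => ->.
rewrite (reindex (@enum_rank T)) /=; last by apply: onW_bij; apply: enum_rank_bij.
by apply: eq_bigr => j _; rewrite !mxE.
Qed.

End FunctionForm.

(** * The cokernel of phi as the cokernel of a 0-1 matrix *)

Section AtIdempotent.
Variables (M : finMonoidType) (f : midem M).
Local Notation f0 := (val f).
Local Notation G := (maxgroup f).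

Lemma maxgroup_inverse (g : G) : exists h : G, (g * h = 1 /\ h * g = 1)%g.
Proof.
have /andP[/eqP gP /existsP[n /and3P[/eqP nP /eqP gn /eqP ng]]] := valP g.
have nG : unit_at f n.
  rewrite /unit_at nP eqxx; apply/existsP; exists (val g).
  by rewrite gP gn ng !eqxx.
by exists (Sub n nG); split; apply: val_inj.
Qed.

Definition maxgroup_inv (g : G) : G := sval (cid (maxgroup_inverse g)).

Lemma maxgroup_mulgV (g : G) : (g * maxgroup_inv g = 1)%g.
Proof. by rewrite /maxgroup_inv; case: cid => h []. Qed.

Lemma maxgroup_mulVg (g : G) : (maxgroup_inv g * g = 1)%g.
Proof. by rewrite /maxgroup_inv; case: cid => h []. Qed.

Lemma maxgroup_inv_uniq (g h : G) : (h * g = 1)%g -> maxgroup_inv g = h.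
Proof. by move=> hg; rewrite -[LHS]mul1g -hg -mulgA maxgroup_mulgV mulg1. Qed.

Lemma maxgroup_inv1 : maxgroup_inv 1%g = 1%g.
Proof. by apply: maxgroup_inv_uniq; rewrite mulg1. Qed.

Lemma Rclass_f (r : Rclass f) : (f0 * val r = val r)%g.
Proof.
have : val r \in [set (val r * x)%g | x : M].
  by apply/imsetP; exists 1%g; rewrite ?mulg1.
by rewrite (eqP (valP r)) => /imsetP[x _ ->]; rewrite mulgA midemE.
Qed.

Lemma Lclass_f (l : Lclass f) : (val l * f0 = val l)%g.
Proof.
have : val l \in [set (x * val l)%g | x : M].
  by apply/imsetP; exists 1%g; rewrite ?mul1g.
by rewrite (eqP (valP l)) => /imsetP[x _ ->]; rewrite -mulgA midemE.
Qed.

Lemma RclassP r : (f0 * r = r)%g -> (exists x, r * x = f0)%g ->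
  [set (r * x)%g | x : M] == [set (f0 * x)%g | x : M].
Proof.
move=> fr [x rx]; apply/eqP/setP => m; apply/imsetP/imsetP => -[y _ ->].
  by exists (r * y)%g; rewrite // mulgA fr.
by exists (x * y)%g; rewrite // mulgA rx.
Qed.

Lemma LclassP l : (l * f0 = l)%g -> (exists x, x * l = f0)%g ->
  [set (x * l)%g | x : M] == [set (x * f0)%g | x : M].
Proof.
move=> lf [x xl]; apply/eqP/setP => m; apply/imsetP/imsetP => -[y _ ->].
  by exists (y * l)%g; rewrite // -mulgA lf.
by exists (y * x)%g; rewrite // -mulgA xl.
Qed.

Lemma Rclass_act1 (r : Rclass f) : Rclass_act 1%g r = r.
Proof. by apply: val_inj; rewrite /= Rclass_f. Qed.

Lemma Rclass_actM (g h : G) (r : Rclass f) :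
  Rclass_act (g * h)%g r = Rclass_act g (Rclass_act h r).
Proof. by apply: val_inj; rewrite /= mulgA. Qed.

Lemma delta_mul_coef (g h : G) (z : ZG f) :
  (madelta int g * z) h = z (maxgroup_inv g * h)%g.
Proof.
rewrite [LHS]ma_mulE (bigD1 g) //= [X in _ + X]big1 ?addr0; last first.
  by move=> a /negbTE ag; apply: big1 => b _; rewrite ffunE ag mul0r mul0rn.
rewrite (bigD1 (maxgroup_inv g * h)%g) //= [X in _ + X]big1 ?addr0.
  by rewrite ffunE eqxx mul1r mulgA maxgroup_mulgV mul1g eqxx.
move=> b bh; case: eqP => // gb; case/eqP: bh.
by rewrite -gb mulgA maxgroup_mulVg mul1g.
Qed.

Section Extension.
Variable v : Rclass f -> int.

(** Equivariance leaves no choice: a homomorphism whose coefficient at the identity of G_f is [v]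
    must have the coefficient [v] of g^-1 r at [g]. *)
Definition dual_basis (r : Rclass f) : ZG f :=
  [ffun g => v (Rclass_act (maxgroup_inv g) r)].

Definition dual_extension (y : ZR f) : ZG f := \sum_r y r *: dual_basis r.

Lemma dual_extension_is_linear : linear dual_extension.
Proof.
move=> c x y; rewrite /dual_extension scaler_sumr -big_split /=.
by apply: eq_bigr => r _; rewrite !ffunE scalerDl scalerA.
Qed.

HB.instance Definition _ := GRing.isLinear.Build int (ZR f) (ZG f) *:%R
  dual_extension dual_extension_is_linear.

Lemma dual_extension_delta r : dual_extension (ZRdelta r) = dual_basis r.
Proof.
rewrite /dual_extension (bigD1 r) //= [X in _ + X]big1 ?addr0.
  by rewrite ffunE eqxx scale1r.
by move=> r' /negbTE rr; rewrite ffunE rr scale0r.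
Qed.

Lemma dual_basis_act g r : dual_basis (Rclass_act g r) = madelta int g * dual_basis r.
Proof.
apply/ffunP => h; rewrite [RHS]delta_mul_coef !ffunE -Rclass_actM; congr (v (Rclass_act _ _)).
apply/esym/maxgroup_inv_uniq.
by rewrite mulgA -[(maxgroup_inv h * g * _)%g]mulgA maxgroup_mulgV mulg1 maxgroup_mulVg.
Qed.

Lemma dual_extension_ZRdual : ZRdual (linfun dual_extension).
Proof.
move=> a y; rewrite !lfunE /= /ZR_act linear_sum /=.
rewrite {2}/dual_extension {2}[a]ma_expand mulr_suml; apply: eq_bigr => g _.
rewrite linear_sum mulr_sumr; apply: eq_bigr => r _.
rewrite linearZ /= dual_extension_delta dual_basis_act.
by rewrite -scalerAl -scalerAr scalerA.
Qed.

End Extension.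

Lemma phi_basisE (l : Lclass f) (r : Rclass f) g :
  phi_basis l r g = ((val r * val l)%g == val g)%:R.
Proof.
rewrite /phi_basis; case: insubP => [g' _ g'E|ng].
  by rewrite ffunE -val_eqE g'E eq_sym.
by rewrite ffunE; case: eqP => // E; rewrite E (valP g) in ng.
Qed.

Lemma act_inv_eq (g : G) (r : Rclass f) (l : Lclass f) :
  ((val (Rclass_act (maxgroup_inv g) r) * val l)%g == f0) =
  ((val r * val l)%g == val g).
Proof.
have gg' : (val g * val (maxgroup_inv g))%g = f0 := congr1 val (maxgroup_mulgV g).
have g'g : (val (maxgroup_inv g) * val g)%g = f0 := congr1 val (maxgroup_mulVg g).
apply/eqP/eqP => /= [E|E].
  have := congr1 (fun z => (val g * z)%g) E.
  by rewrite !mulgA gg' Rclass_f (maxgroup_f g).2.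
by rewrite -mulgA E.
Qed.

(** Taking coefficients at [f] turns [ZRdual] into the lattice of integral functions on R_f, and
    [phi_image] into the lattice spanned by the columns of [r l = f]. *)
Lemma phi_pure p : prime p -> ~ dvd_torsion p (@ZRdual M f) (phi_image_zsub f) ->
  forall (v : Rclass f -> int) (w : Lclass f -> int),
    (forall r : Rclass f, v r *+ p = \sum_(l : Lclass f) ((val r * val l)%g == f0)%:R * w l) ->
    exists u, forall r : Rclass f, v r = \sum_(l : Lclass f) ((val r * val l)%g == f0)%:R * u l.
Proof.
move=> p_pr ntors v w vw.
have [||x xE] := no_dvd_torsion p_pr _ ntors (dual_extension_ZRdual v).
- by move=> x y Dx Dy a z; rewrite !add_lfunE Dx Dy mulrDr.
- exists [ffun l => w l : int^o]; apply/lfunP => y.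
  rewrite phiE; apply/ffunP => g.
  have -> : (linfun (dual_extension v) *+ p) y = dual_extension v y *+ p.
    by rewrite -scaler_nat scale_lfunE lfunE /= natz -[p%:Z]natz scaler_nat.
  rewrite ffunMnE sum_ffunE exchange_big /= sum_ffunE -sumrMnl; apply: eq_bigr => r _.
  rewrite sum_ffunE ma_scaleE ffunE -mulrnAr vw mulr_sumr; apply: eq_bigr => l _.
  rewrite ma_scaleE phi_basisE ffunE act_inv_eq.
  by rewrite [RHS]mulrC mulrCA [w l * y r]mulrC.
exists x => r.
have /ffunP/(_ 1%g) := congr1 (fun h : 'Hom(ZR f, ZG f) => h (ZRdelta r)) xE.
rewrite lfunE /= dual_extension_delta ffunE maxgroup_inv1 Rclass_act1 => ->.
rewrite phiE sum_ffunE; apply: eq_bigr => l _.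
rewrite sum_ffunE (bigD1 r) //= [X in _ + X]big1 ?addr0 => [|r' /negbTE rr].
  by rewrite ma_scaleE phi_basisE ffunE eqxx mulr1 mulrC.
by rewrite ma_scaleE ffunE rr mulr0 mul0r.
Qed.

End AtIdempotent.

Section IntegralRadical.
Variable M : finMonoidType.
Local Notation ZM := (monoid_algebra M int).
Local Notation QM := (monoid_algebra M rat).
Local Notation to_rat := (intr : {rmorphism int -> rat}).

Lemma card_maxgroup_gt0 (f : midem M) : (0 < #|{: maxgroup f}|)%N.
Proof. by apply/card_gt0P; exists 1%g. Qed.

Lemma sandwich_radical_ideal (K : comNzRingType) :
  two_sided_ideal (@sandwich_radical M K).
Proof.
split; first split.
- exact: sandwich_radical0.
- exact: sandwich_radicalD.
- by move=> a x; apply: sandwich_radicalMl.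
by move=> a x; apply: sandwich_radicalMr.
Qed.

Lemma jacobson_sandwich_radical (K : fieldType) (x : monoid_algebra M K) :
  (forall f : midem M, #|{: maxgroup f}|%:R != 0 :> K) ->
  jacobson_radical x <-> sandwich_radical x.
Proof.
move=> GK; split=> [Jx|Nx].
  apply: nil_left_ideal_sandwich_radical => // a.
  by apply: jacobson_radical_nil; apply: jacobson_radical_left.
have [e eP] := sandwich_radical_pow M K.
exact: (nilpotent_ideal_jacobson (sandwich_radical_ideal K) (eP e ^~ (leqnn e))).
Qed.

Lemma rat_card_neq0 (f : midem M) : #|{: maxgroup f}|%:R != 0 :> rat.
Proof. by rewrite pnatr_eq0 -lt0n card_maxgroup_gt0. Qed.

Lemma int_radicalP (x : ZM) : int_radical x <-> sandwich_radical x.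
Proof.
rewrite /int_radical jacobson_sandwich_radical; last exact: rat_card_neq0.
split=> Nx f r l ff fr lf; last by rewrite sandwich_map Nx.
have := Nx f r l ff fr lf; rewrite sandwich_map => /eqP.
by rewrite intr_eq0 => /eqP.
Qed.

Lemma ideal_pow_sub (A : pzRingType) (I J : A -> Prop) n x :
  (forall y, I y -> J y) -> ideal_pow I n x -> ideal_pow J n x.
Proof.
move=> IJ; elim: n x => //= n IHn x [s sP ->]; exists s => // u /sP[u1 u2].
by split; [apply: IHn | apply: IJ].
Qed.

Lemma loewy_length_exists : exists n, @is_loewy_length M n.
Proof.
have [e eP] := sandwich_radical_pow M rat.
pose q n := `[< forall x : QM, ideal_pow (@jacobson_radical QM) n x -> x = 0 >].
have q0 : exists n, q n.
  exists e; apply/asboolP => x xe; apply: (eP e) => //; apply: ideal_pow_sub xe => y.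
  by rewrite jacobson_sandwich_radical //; apply: rat_card_neq0.
case: (ex_minnP q0) => n /asboolP nP nmin; exists n; split=> // m mP.
by apply: nmin; apply/asboolP.
Qed.

(** The torsion condition at [s = 1], available when the Loewy length exceeds 1; otherwise the
    radical is zero. *)
Lemma sandwich_square_pure p : prime p -> ~ modular M p -> forall x : ZM,
  sandwich_radical x -> ideal_prod (@sandwich_radical M int) (@sandwich_radical M int) (x *+ p) ->
  ideal_prod (@sandwich_radical M int) (@sandwich_radical M int) x.
Proof.
move=> p_pr nmod x Nx Npx.
have NJ y : sandwich_radical y -> int_radical y := iffRL (int_radicalP y).
have JN y : int_radical y -> sandwich_radical y := iffLR (int_radicalP y).
have [n nL] := loewy_length_exists; have [n0 nmin] := nL.
have [n1|n1] := leqP n 1.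
  suff -> : x = 0 by exists [::]; rewrite ?big_nil.
  have : map_ma to_rat x = 0.
    apply: n0; case: n n1 {nL nmin} => [|[|]] // _.
    exists [:: (1, map_ma to_rat x)]; rewrite ?big_seq1 ?mul1r // => u.
    by rewrite inE => /eqP -> /=; split=> //; apply: NJ.
  move=> /ffunP mx; apply/ffunP => m; have := mx m; rewrite !ffunE => /eqP.
  by rewrite intr_eq0 => /eqP.
have nt : ~ dvd_torsion p (ideal_pow (@int_radical M) 1)
    (ideal_pow_zsub (@int_radical M) 2).
  by move=> t; apply: nmod; right; exists n, 1%N; split.
have /= [|||s sP ->] := no_dvd_torsion p_pr _ nt (a := x).
- move=> y z Jy Jz; rewrite -[z]opprK; apply: (@ideal_powB _ _ 1) => //.
  exact: (@ideal_powN _ _ 1).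
- exists [:: (1, x)]; rewrite ?big_seq1 ?mul1r // => u.
  by rewrite inE => /eqP -> /=; split=> //; apply: NJ.
- case: Npx => s sP ->; exists s => // u /sP[u1 u2]; split; last exact: NJ.
  exists [:: (1, u.1)]; rewrite ?big_seq1 ?mul1r // => w.
  by rewrite inE => /eqP -> /=; split=> //; apply: NJ.
exists s => // u /sP[[t tP ->] u2]; split; last exact: JN.
elim: t tP => [|w t IHt] tP; first by rewrite big_nil; apply: sandwich_radical0.
rewrite big_cons; apply: sandwich_radicalD; last first.
  by apply: IHt => z zt; apply: tP; rewrite inE zt orbT.
by apply/sandwich_radicalMl/JN; case: (tP w (mem_head _ _)).
Qed.

End IntegralRadical.

(** * Lifting the radical and idempotents *)

Section CompleteSystem.
Variables (O : idomainType) (F k : fieldType).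
Variables (iota : {rmorphism O -> F}) (rho : {rmorphism O -> k}).

(** A modular system expressed through a uniformizer: powers of the maximal ideal become
    divisibility by powers of [pi], and completeness concerns sequences whose n-th step is divisible
    by [pi ^+ n]. *)
Record complete_system (p : nat) (pi : O) : Prop := CompleteSystem {
  residue_surj : forall y, exists a, rho a = y;
  residue_ker : forall a, rho a = 0 <-> exists b, a = b * pi;
  residue_unit : forall a, rho a != 0 -> a \is a GRing.unit;
  uniformizer_neq0 : pi != 0;
  separated : forall a, (forall n, exists b, a = b * pi ^+ n) -> a = 0;
  complete_seq : forall u : nat -> O,
    (forall n, exists b, u n.+1 - u n = b * pi ^+ n) ->
    exists l, forall n, exists b, l - u n = b * pi ^+ n;
  intr_inj_system : injective (intr : int -> O);
  fraction_inj : injective iota;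
  fractionP : forall x, exists a b, b != 0 /\ x = iota a / iota b;
  residue_pchar : p \in [pchar k]
}.

Lemma ideal_pow_principal (m : O -> Prop) pi n x :
  (forall x, m x <-> exists a, x = a * pi) ->
  ideal_pow m n x <-> exists b, x = b * pi ^+ n.
Proof.
move=> mP; elim: n x => [|n IHn] x /=.
  by split=> // _; exists x; rewrite mulr1.
split=> [[s sP ->]|[b ->]].
  elim: s sP => [|u s IHs] sP; first by exists 0; rewrite big_nil mul0r.
  have [|b bE] := IHs; first by move=> v vs; apply: sP; rewrite inE vs orbT.
  have [/IHn[c cE] /mP[d dE]] := sP u (mem_head _ _).
  exists (c * d + b); rewrite big_cons bE cE dE mulrDl exprSr; congr (_ + _).
  by rewrite mulrACA.
exists [:: (b * pi ^+ n, pi)] => [u|]; last by rewrite big_seq1 exprSr mulrA.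
rewrite inE => /eqP-> /=; split; first by apply/IHn; exists b.
by apply/mP; exists 1; rewrite mul1r.
Qed.

Lemma modular_system_complete p : modular_system p iota rho ->
  exists pi, complete_system p pi.
Proof.
case=> m [[[pid [mmax _] [x0 mx0 x00]] compl] O0 [inj frac] [surj ker] pk].
have [lm m1 mmax'] := mmax; have [m0 mD mM] := lm.
have [pi mP] := pid m lm.
have powP n x := ideal_pow_principal n x mP.
have mpi : m pi by apply/mP; exists 1; rewrite mul1r.
have pi0 : pi != 0.
  by apply: contraNneq x00 => pi0; have /mP[a ->] := mx0; rewrite pi0 mulr0.
(* Krull intersection: a generator [g] of the intersection is [h * pi] with [h] again in it, so
   [g * (1 - b * pi) = 0], and [1 - b * pi] is nonzero since [m] is proper. *)
have sep a : (forall n, exists b, a = b * pi ^+ n) -> a = 0.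
  move=> an; pose I x := forall n, exists b, x = b * pi ^+ n.
  have [|g gP] := pid I.
    split.
    - by move=> n; exists 0; rewrite mul0r.
    - by move=> x y Ix Iy n; have [b ->] := Ix n; have [c ->] := Iy n; exists (b + c); rewrite mulrDl.
    - by move=> c x Ix n; have [b ->] := Ix n; exists (c * b); rewrite mulrA.
  have Ig : I g by apply/gP; exists 1; rewrite mul1r.
  have [h gh] := Ig 1%N; rewrite expr1 in gh.
  have /gP[b hb] : I h.
    move=> n; have [c cE] := Ig n.+1; exists c.
    by apply: (mulIf pi0); rewrite -gh cE exprSr mulrA.
  have /eqP : g * (1 - b * pi) = 0.
    by rewrite mulrBr mulr1 mulrA [g * b]mulrC -hb -gh subrr.
  rewrite mulf_eq0 => /orP[/eqP g0|].
    by have /gP[c ->] : I a by []; rewrite g0 mulr0.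
  rewrite subr_eq0 => /eqP b1; case: m1; rewrite b1.
  exact: mM.
have comp u : (forall n, exists b, u n.+1 - u n = b * pi ^+ n) ->
    exists l, forall n, exists b, l - u n = b * pi ^+ n.
  move=> un.
  have un' n i : exists b, u (n + i)%N - u n = b * pi ^+ n.
    elim: i => [|i [b bE]]; first by exists 0; rewrite addn0 subrr mul0r.
    have [c cE] := un (n + i)%N; exists (c * pi ^+ i + b).
    rewrite mulrDl -mulrA -exprD [(i + n)%N]addnC -cE -bE addnS.
    by ring.
  have [|l lP] := compl u.
    move=> n; exists n => i j ni nj; apply/powP.
    have [b bE] := un' n (i - n)%N; have [c cE] := un' n (j - n)%N.
    exists (b - c); rewrite mulrBl -bE -cE !subnKC //.
    by ring.
  exists l => n; have [n0 /(_ (n0 + n)%N)] := lP n.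
  rewrite leq_addr => /(_ isT)/powP[b bE].
  have [c cE] := un' n n0; exists (c - b).
  by rewrite mulrBl -bE -cE [(n0 + n)%N]addnC; ring.
(* The partial geometric sums converge to the inverse. *)
have unit_m x : m x -> (1 - x) \is a GRing.unit.
  move=> /mP[c xc]; pose u n := \sum_(i < n) x ^+ i.
  have [|l lP] := comp u.
    move=> n; exists (c ^+ n); rewrite /u big_ord_recr /= [_ + x ^+ n]addrC addrK.
    by rewrite xc exprMn.
  suff /eqP : (1 - x) * l - 1 = 0.
    by rewrite subr_eq0 => /eqP xl; apply/unitrPr; exists l.
  apply: sep => n; have [b bE] := lP n; exists ((1 - x) * b - c ^+ n).
  rewrite [RHS]mulrBl -[(1 - x) * b * _]mulrA -bE mulrBr /u -exprMn -xc.
  have -> : (1 - x) * \sum_(i < n) x ^+ i = 1 - x ^+ n.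
    by rewrite -[1 - x]opprB mulNr -subrX1 opprB.
  by ring.
exists pi; split=> //.
- by move=> y; have [a ->] := surj y; exists a.
- by move=> a; rewrite ker; apply: mP.
- move=> a ra.
  have : exists x b, m x /\ 1 = x + b * a.
    apply: contrapT => no; case/negP: ra; apply/eqP/ker.
    apply: (mmax' (fun y => exists x b, m x /\ y = x + b * a)).
    + split; first by exists 0, 0; rewrite mul0r addr0.
        move=> _ _ [x [b [mx ->]]] [x' [b' [mx' ->]]]; exists (x + x'), (b + b').
        by split; [apply: mD | rewrite mulrDl addrACA].
      move=> c _ [x [b [mx ->]]]; exists (c * x), (c * b).
      by split; [apply: mM | rewrite mulrDr mulrA].
    + by move=> [x [b [mx E]]]; apply: no; exists x, b.
    + by move=> x mx; exists x, 0; rewrite mul0r addr0.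
    by exists 0, 1; rewrite mul1r add0r.
  move=> [x [b [mx E]]]; have := unit_m x mx; rewrite {1}E addrC addKr.
  by rewrite unitrM => /andP[].
- have natO n : (0 < n)%N -> n%:R != 0 :> O.
    by move=> n0; apply/negP => /natf0_pchar[] // q; rewrite O0.
  have int0 (c : int) : c%:~R = 0 :> O -> c = 0.
    case: c => [[|n]|n] // /eqP; first by rewrite -pmulrn (negbTE (natO _ _)).
    by rewrite NegzE mulrNz oppr_eq0 -pmulrn (negbTE (natO _ _)).
  move=> a b ab; apply/eqP; rewrite -subr_eq0; apply/eqP/int0.
  by rewrite mulrzBr ab subrr.
Qed.

End CompleteSystem.

Section Convolution.
Variable R : comNzRingType.

Definition kernel_comp (S T U : finType) (a : S -> T -> R) (b : T -> U -> R) : S -> U -> R :=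
  fun s u => \sum_t a s t * b t u.

Local Notation "a ** b" := (kernel_comp a b) (at level 40, left associativity).

Lemma kernel_compA (S T U V : finType) (a : S -> T -> R) (b : T -> U -> R)
  (c : U -> V -> R) : a ** (b ** c) = a ** b ** c.
Proof.
apply/funext => s; apply/funext => v; rewrite /kernel_comp.
under eq_bigr => t _ do rewrite mulr_sumr.
rewrite exchange_big; apply: eq_bigr => u _; rewrite mulr_suml.
by apply: eq_bigr => t _; rewrite mulrA.
Qed.

Lemma kernel_compZl (S T U : finType) x (a : S -> T -> R) (b : T -> U -> R) :
  (fun s t => x * a s t) ** b = fun s u => x * (a ** b) s u.
Proof.
apply/funext => s; apply/funext => u; rewrite /kernel_comp mulr_sumr.
by apply: eq_bigr => t _; rewrite mulrA.
Qed.

Lemma kernel_compZr (S T U : finType) x (a : S -> T -> R) (b : T -> U -> R) :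
  a ** (fun s t => x * b s t) = fun s u => x * (a ** b) s u.
Proof.
apply/funext => s; apply/funext => u; rewrite /kernel_comp mulr_sumr.
by apply: eq_bigr => t _; rewrite mulrCA.
Qed.

End Convolution.
Notation "a ** b" := (kernel_comp a b) (at level 40, left associativity).

Lemma ma_subE (M : finMonoidType) (R : comNzRingType) (x y : monoid_algebra M R) m :
  (x - y) m = x m - y m.
Proof. by rewrite !ffunE. Qed.

Section MapMonoidAlgebra.
Variables (M : finMonoidType) (R S : comNzRingType) (h : {rmorphism R -> S}).
Local Notation hM := (@map_ma M R S h).

Lemma map_maD x y : hM (x + y) = hM x + hM y.
Proof. by apply/ffunP => m; rewrite !ffunE rmorphD. Qed.

Lemma map_ma0 : hM 0 = 0.
Proof. by apply/ffunP => m; rewrite !ffunE rmorph0. Qed.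

Lemma map_maN x : hM (- x) = - hM x.
Proof. by apply/ffunP => m; rewrite !ffunE rmorphN. Qed.

Lemma map_maB x y : hM (x - y) = hM x - hM y.
Proof. by rewrite map_maD map_maN. Qed.

Lemma map_maZ c x : hM (c *: x) = h c *: hM x.
Proof. by apply/ffunP => m; rewrite ffunE !ma_scaleE rmorphM ffunE. Qed.

Lemma map_ma1 : hM 1 = 1.
Proof. by apply/ffunP => m; rewrite !ffunE rmorph_nat. Qed.

Lemma map_ma_sum (I : Type) (s : seq I) (P : pred I) x :
  hM (\sum_(i <- s | P i) x i) = \sum_(i <- s | P i) hM (x i).
Proof. exact: (big_morph hM map_maD map_ma0). Qed.

Lemma map_ma_inj : injective h -> injective hM.
Proof.
move=> hi x y /ffunP xy; apply/ffunP => m; apply: hi.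
by have := xy m; rewrite !ffunE.
Qed.

Lemma map_ma_radical x : sandwich_radical x -> sandwich_radical (hM x).
Proof. by move=> Nx f r l *; rewrite sandwich_map Nx ?rmorph0. Qed.

End MapMonoidAlgebra.

Section Classes.
Variables (M : finMonoidType) (f : midem M) (R : comNzRingType).
Local Notation f0 := (val f).
Local Notation G := (maxgroup f).
Implicit Types (y : monoid_algebra M R) (r : Rclass f) (l : Lclass f) (g : G).

(** An equation [a * n * b = f] puts [a] in R_f and [b] in L_f; for all other pairs the sum is
    empty. *)
Lemma sandwich_class (x : monoid_algebra M R) :
  (forall r l, sandwich f0 x (val r) (val l) = 0) ->
  forall a b : M, (f0 * a = a)%g -> (b * f0 = b)%g -> sandwich f0 x a b = 0.
Proof.
move=> x0 a b fa bf.
have [n0 /eqP n0E|no] := pickP (fun n => (a * n * b)%g == f0); last first.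
  by apply: big1 => n; rewrite no.
have aP : [set (a * x)%g | x : M] == [set (f0 * x)%g | x : M].
  by apply: RclassP => //; exists (n0 * b)%g; rewrite mulgA.
have bP : [set (x * b)%g | x : M] == [set (x * f0)%g | x : M].
  by apply: LclassP => //; exists (a * n0)%g.
exact: (x0 (exist _ a aP) (exist _ b bP)).
Qed.

Lemma Lclass_actP l g : [set (x * (val l * val g))%g | x : M] == [set (x * f0)%g | x : M].
Proof.
apply: LclassP; first by rewrite -mulgA (maxgroup_f g).2.
have : f0 \in [set (x * val l)%g | x : M].
  by rewrite (eqP (valP l)); apply/imsetP; exists f0; rewrite ?midemE.
case/imsetP => x _ fx; exists (val (maxgroup_inv g) * x)%g.
rewrite mulgA -[(_ * x * val l)%g]mulgA -fx (maxgroup_f _).2.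
exact: (congr1 val (maxgroup_mulVg g)).
Qed.

Definition Lclass_act l g : Lclass f := exist _ (val l * val g)%g (Lclass_actP l g).

Definition pairing r l : R := ((val r * val l)%g == f0)%:R.

Definition sandwich_kernel y r l : R := sandwich f0 y (val r) (val l).

(** [r * (n * l) = f] forces [n * l] into L_f, so the sandwich matrix has the pairing as a left
    factor, and symmetrically as a right factor. Hence a quasi-inverse of the pairing can solve
    equations with this matrix as right-hand side. *)
Lemma sandwich_kernel_left y :
  sandwich_kernel y = pairing ** (fun l' l => \sum_(n | (n * val l)%g == val l') y n).
Proof.
apply/funext => r; apply/funext => l; rewrite /kernel_comp.
under [RHS]eq_bigr => l' _ do rewrite big_mkcond mulr_sumr.
rewrite exchange_big /= /sandwich_kernel /sandwich big_mkcond; apply: eq_bigr => n _.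
have [nl|nl] := boolP [exists l' : Lclass f, val l' == (n * val l)%g].
  have [l' /eqP l'E] := existsP nl.
  rewrite (bigD1 l') //= [X in _ + X]big1 ?addr0 => [|l'' /eqP ll].
    rewrite l'E eqxx /pairing l'E mulgA.
    by case: eqP => _; rewrite ?mul1r ?mul0r.
  case: eqP => [E|_]; last by rewrite mulr0.
  by case: ll; apply: val_inj; rewrite l'E E.
rewrite big1 => [|l' _]; last first.
  case: eqP => [E|_]; last by rewrite mulr0.
  by case/existsP: nl; exists l'; rewrite E.
case: eqP => // rnl; case/existsP: nl.
have lP : [set (x * (n * val l))%g | x : M] == [set (x * f0)%g | x : M].
  apply: LclassP; first by rewrite -mulgA Lclass_f.
  by exists (val r); rewrite mulgA.
by exists (exist _ (n * val l)%g lP : Lclass f).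
Qed.

Lemma sandwich_kernel_right y :
  sandwich_kernel y = (fun r r' => \sum_(n | (val r * n)%g == val r') y n) ** pairing.
Proof.
apply/funext => r; apply/funext => l; rewrite /kernel_comp.
under [RHS]eq_bigr => r' _ do rewrite big_mkcond mulr_suml.
rewrite exchange_big /= /sandwich_kernel /sandwich big_mkcond; apply: eq_bigr => n _.
have [rn|rn] := boolP [exists r' : Rclass f, val r' == (val r * n)%g].
  have [r' /eqP r'E] := existsP rn.
  rewrite (bigD1 r') //= [X in _ + X]big1 ?addr0 => [|r'' /eqP rr].
    rewrite r'E eqxx /pairing r'E.
    by case: eqP => _; rewrite ?mulr1 ?mulr0.
  case: eqP => [E|_]; last by rewrite mul0r.
  by case: rr; apply: val_inj; rewrite r'E E.
rewrite big1 => [|r' _]; last first.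
  case: eqP => [E|_]; last by rewrite mul0r.
  by case/existsP: rn; exists r'; rewrite E.
case: eqP => // rnl; case/existsP: rn.
have rP : [set (val r * n * x)%g | x : M] == [set (f0 * x)%g | x : M].
  apply: RclassP; first by rewrite mulgA Rclass_f.
  by exists (val l).
by exists (exist _ (val r * n)%g rP : Rclass f).
Qed.

Lemma sandwich_kernel_act y g r l :
  sandwich_kernel y (Rclass_act g r) (Lclass_act l (maxgroup_inv g)) =
  sandwich_kernel y r l.
Proof.
have gg' : (val g * val (maxgroup_inv g))%g = f0 := congr1 val (maxgroup_mulgV g).
have g'g : (val (maxgroup_inv g) * val g)%g = f0 := congr1 val (maxgroup_mulVg g).
apply: eq_bigl => n; apply/eqP/eqP => /= [E|E].
  have := congr1 (fun z => (val (maxgroup_inv g) * z * val g)%g) E.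
  by rewrite !mulgA g'g Rclass_f -!mulgA g'g Lclass_f !mulgA (maxgroup_f _).2 g'g.
have -> : (val g * val r * n * (val l * val (maxgroup_inv g)) =
  val g * (val r * n * val l) * val (maxgroup_inv g))%g by rewrite !mulgA.
by rewrite E (maxgroup_f g).2.
Qed.

(* r l0 r0 l = f forces r0 l to be a unit g of fMf, with inverse r l0. *)
Lemma pairing_product r0 l0 r l :
  ((val r * (val l0 * val r0) * val l)%g == f0)%:R =
  \sum_(g : G) pairing (Rclass_act g r) l0 * pairing r0 (Lclass_act l (maxgroup_inv g)).
Proof.
have gg' g : (val g * val (maxgroup_inv g))%g = f0 := congr1 val (maxgroup_mulgV g).
have g'g g : (val (maxgroup_inv g) * val g)%g = f0 := congr1 val (maxgroup_mulVg g).
have pE g : pairing r0 (Lclass_act l (maxgroup_inv g)) = ((val r0 * val l)%g == val g)%:R.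
  congr (_%:R); congr nat_of_bool; apply/eqP/eqP => /= [E|E].
    have := congr1 (fun z => (z * val g)%g) E.
    by rewrite -!mulgA g'g Lclass_f (maxgroup_f g).1.
  by rewrite mulgA E gg'.
under eq_bigr => g _ do rewrite pE.
have [rl|rl] := boolP (unit_at f (val r0 * val l)%g); last first.
  rewrite big1 => [|g _]; last first.
    case: eqP => [E|_]; last by rewrite mulr0.
    by rewrite E (valP g) in rl.
  case: eqP => // E; case/negP: rl.
  apply: (@unit_atP M f _ f0) => //.
  - by rewrite mulgA Rclass_f.
  - by rewrite -mulgA Lclass_f.
  - exact: maxgroup_oneP.
  have E' : (val r * val l0 * (val r0 * val l))%g = f0 by rewrite -[RHS]E !mulgA.
  by have := J_le_mull (val r * val l0)%g (val r0 * val l)%g; rewrite E'.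
have [g gE] : exists g : G, val g = (val r0 * val l)%g.
  by exists (Sub (val r0 * val l)%g rl).
rewrite (bigD1 g) //= gE eqxx mulr1 big1 ?addr0 => [|g' g'g'']; last first.
  case: eqP => [E|_]; last by rewrite mulr0.
  by case/eqP: g'g''; apply: val_inj; move: E; rewrite -gE => ->.
have -> : (val r * (val l0 * val r0) * val l = val r * val l0 * val g)%g.
  by rewrite gE !mulgA.
congr (_%:R); congr nat_of_bool; apply/eqP/eqP => /= E.
  have rl0 : (val r * val l0 = val (maxgroup_inv g))%g.
    have := congr1 (fun z => (z * val (maxgroup_inv g))%g) E.
    by rewrite -!mulgA gg' Lclass_f (maxgroup_f _).1.
  by rewrite -mulgA rl0 gg'.
have rl0 : (val r * val l0 = val (maxgroup_inv g))%g.
  have := congr1 (fun z => (val (maxgroup_inv g) * z)%g) E.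
  by rewrite !mulgA g'g Rclass_f (maxgroup_f _).2.
by rewrite rl0 g'g.
Qed.

End Classes.

(** * Lifting elements of the radical *)

Section LiftRadical.
Variables (O : idomainType) (F k : fieldType).
Variables (iota : {rmorphism O -> F}) (rho : {rmorphism O -> k}).
Variables (p : nat) (pi : O).
Hypothesis sys : complete_system iota rho p pi.
Hypothesis p_prime : prime p.
Variable M : finMonoidType.
Hypothesis nonmod : ~ modular M p.

Lemma unit_natr n : ~~ (p %| n)%N -> (n%:R : O) \is a GRing.unit.
Proof.
move=> pn; apply: (residue_unit sys); rewrite rmorph_nat.
by rewrite -(dvdn_pcharf (residue_pchar sys)).
Qed.

Lemma unit_residue_neq0 a : a \is a GRing.unit -> rho a != 0.
Proof. by move=> ua; rewrite -unitfE; apply: rmorph_unit. Qed.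

Lemma card_maxgroup_unit (f : midem M) : #|{: maxgroup f}|%:R \is a (@GRing.unit O).
Proof.
apply: unit_natr; apply/negP => pG; apply: nonmod; left; exists f; by left.
Qed.

Lemma pairing_quasi_inverse (f : midem M) :
  exists c' : Lclass f -> Rclass f -> O,
    @pairing M f O ** c' ** @pairing M f O = @pairing M f O.
Proof.
have ntors : ~ dvd_torsion p (@ZRdual M f) (phi_image_zsub f).
  by move=> t; apply: nonmod; left; exists f; right.
have [c' [N [pN cP]]] := pure_quasi_inverse p_prime (phi_pure p_prime ntors).
exists (fun l r => N%:R^-1 * (c' l r)%:~R).
rewrite kernel_compZr kernel_compZl; apply/funext => r; apply/funext => l.
apply: (canLR (mulKr (unit_natr pN))).
have /esym := congr1 (intr : int -> O) (cP r l).
rewrite rmorphMn rmorph_nat rmorph_sum /= => E.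
rewrite [RHS]mulr_natl [RHS]E /kernel_comp.
rewrite /=; under eq_bigr => s _ do rewrite mulr_suml.
rewrite exchange_big; apply: eq_bigr => t _; rewrite rmorph_sum.
by apply: eq_bigr => s _; rewrite !rmorphM !rmorph_nat.
Qed.

(* If c is the matrix of the pairing (r, l) |-> [r l = f] and c c' c = c, then
   X = c' z c' solves c X c = z; summing X l r over all products l r counts every
   value |G_f| times. *)
Lemma lift_step (f : midem M) (y : monoid_algebra M O) :
  (forall r l, exists z, sandwich_kernel (f := f) y r l = pi * z) ->
  exists2 x : monoid_algebra M O, forall m, ~~ J_le m (val f) -> x m = 0
    & forall a b, (val f * a = a)%g -> (b * val f = b)%g ->
      sandwich (val f) (y - pi *: x) a b = 0.
Proof.
move=> yz; have [c' cc] := pairing_quasi_inverse f.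
have pi0 := uniformizer_neq0 sys.
pose z r l := sval (cid (yz r l)).
have zE : sandwich_kernel y = (fun r l => pi * z r l).
  by apply/funext => r; apply/funext => l; rewrite /z; case: cid.
pose X := c' ** z ** c'; pose c := @pairing M f O.
have cXc : c ** X ** c = z.
  have E : c ** (c' ** sandwich_kernel y ** c') ** c = sandwich_kernel y.
    have [Y DY] : exists Y, sandwich_kernel y = c ** Y.
      by eexists; apply: sandwich_kernel_left.
    have [Z DZ] : exists Z, sandwich_kernel y = Z ** c.
      by eexists; apply: sandwich_kernel_right.
    have L1 : c ** c' ** sandwich_kernel y = sandwich_kernel y.
      by rewrite DY kernel_compA cc.
    have L2 : sandwich_kernel y ** c' ** c = sandwich_kernel y.
      by rewrite DZ -!kernel_compA [c ** (c' ** c)]kernel_compA cc.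
    by rewrite !kernel_compA L1 L2.
  move: E; rewrite zE kernel_compZr kernel_compZl kernel_compZr kernel_compZl => E.
  apply/funext => r; apply/funext => l; apply: (mulfI pi0).
  by have := congr1 (fun h => h r l) E.
pose G := maxgroup f; pose u : O := #|{: G}|%:R.
have uU : u \is a GRing.unit by apply: card_maxgroup_unit.
exists (u^-1 *: \sum_l \sum_r X l r *: madelta O (val l * val r)%g).
  move=> m mf; rewrite ma_scaleE sum_ffunE big1 ?mulr0 // => l _.
  rewrite sum_ffunE big1 // => r _; rewrite ma_scaleE ffunE.
  case: eqP => [mE|_]; last by rewrite mulr0.
  by case/negP: mf; rewrite mE -(Lclass_f l) J_le_mul.
apply: sandwich_class => r l.
have sumZ (I : finType) (h : I -> monoid_algebra M O) :
    sandwich (val f) (\sum_i h i) (val r) (val l) = \sum_i sandwich (val f) (h i) (val r) (val l).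
  exact: (big_morph _ (fun x y => sandwichD _ x y _ _) (sandwich0 _ _ _ _)).
rewrite -scaleN1r sandwichD !sandwichZ sumZ.
have -> : \sum_l0 sandwich (val f) (\sum_r0 X l0 r0 *: madelta O (val l0 * val r0)%g)
    (val r) (val l) = u * z r l.
  (* [z] inherits the invariance of the sandwich matrix under G_f, so the summands are all equal to
     [z r l]. *)
  transitivity (\sum_(g : G) z (Rclass_act g r) (Lclass_act l (maxgroup_inv g))).
    rewrite -cXc.
    transitivity (\sum_l0 \sum_r0 \sum_(g : G) X l0 r0 *
        (pairing O (Rclass_act g r) l0 * pairing O r0 (Lclass_act l (maxgroup_inv g)))).
      apply: eq_bigr => l0 _; rewrite sumZ; apply: eq_bigr => r0 _.
      rewrite sandwichZ -mulr_sumr -pairing_product; congr (_ * _).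
      rewrite /sandwich big_mkcond (bigD1 (val l0 * val r0)%g) //= [X in _ + X]big1 ?addr0.
        by rewrite ffunE eqxx; case: eqP.
      by move=> n /negbTE nn; rewrite ffunE nn; case: ifP.
    under eq_bigr => l0 _ do rewrite exchange_big /=.
    rewrite exchange_big /=; apply: eq_bigr => g _.
    rewrite exchange_big /=; apply: eq_bigr => r0 _; rewrite mulr_suml.
    by apply: eq_bigr => l0 _; rewrite mulrA [X in X * _]mulrC.
  rewrite -[u]mulr1 -mulrA mul1r mulr_natl -sumr_const; apply: eq_bigr => g _.
  apply: (mulfI pi0); have := sandwich_kernel_act y g r l.
  by rewrite zE.
rewrite mulKr // mulN1r.
have := congr1 (fun h => h r l) zE; rewrite /sandwich_kernel => ->.
by rewrite subrr.
Qed.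

Lemma residue_eq0 a : rho a = 0 -> exists z, a = pi * z.
Proof. by move=> /(residue_ker sys)[b ->]; exists b; rewrite mulrC. Qed.

Lemma map_ma_surj (x : monoid_algebra M k) : exists y, map_ma rho y = x.
Proof.
pose g c := sval (cid (residue_surj sys c)).
exists [ffun m => g (x m)]; apply/ffunP => m; rewrite !ffunE /g.
by case: cid.
Qed.

Lemma residue_pi : rho pi = 0.
Proof. by apply/(residue_ker sys); exists 1; rewrite mul1r. Qed.

(** The idempotents are treated in order of decreasing principal ideals: the correction at [f] is
    supported J-below [f], so it can disturb only the equations at idempotents J-below [f]. *)
Lemma lift_radical (x : monoid_algebra M k) : sandwich_radical x ->
  exists2 y, map_ma rho y = x & sandwich_radical y.
Proof.
move=> Nx; pose size_J (f : midem M) := #|[set m | J_le m (val f)]|.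
pose ge_J : rel (midem M) := fun f g => (size_J g <= size_J f)%N.
suff P (s : seq (midem M)) : sorted ge_J s -> exists2 y, map_ma rho y = x &
    forall f, f \in s -> forall a b, (val f * a = a)%g -> (b * val f = b)%g ->
      sandwich (val f) y a b = 0.
  have [|y yx ys] := P (sort ge_J (enum {: midem M})).
    by apply: sort_sorted => f g; apply: leq_total.
  exists y => // f a b ff fa bf.
  have fP : (f * f == f)%g by apply/eqP.
  by apply: (ys (exist _ f fP)); rewrite ?mem_sort ?mem_enum.
elim/last_ind: s => [|s f IHs] sf.
  by have [y yx] := map_ma_surj x; exists y.
have /andP[ss sfs] : sorted ge_J s && all (ge_J^~ f) s.
  rewrite -rev_sorted rev_rcons /= in sf.
  have tr : transitive (fun f0 f1 : midem M => ge_J f1 f0).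
    by move=> a b c ba cb; apply: leq_trans ba cb.
  by rewrite -rev_sorted (path_sorted sf) -all_rev (order_path_min tr sf).
have [y yx ys] := IHs ss.
have [r l|z zf yz] := @lift_step f y.
  apply: residue_eq0; rewrite /sandwich_kernel -sandwich_map yx Nx ?midemE //.
  - exact: Rclass_f.
  - exact: Lclass_f.
exists (y - pi *: z).
  by rewrite map_maB map_maZ residue_pi scale0r subr0.
move=> g; rewrite mem_rcons inE => /orP[/eqP->//|gs] a b ga bg.
(* An earlier [g] below [f] has a principal ideal at least as large, hence is J-equivalent to [f];
   its equations are those at [f], transported by [s'] and [t]. *)
have [gf|gf] := boolP (J_le (val g) (val f)).
  have fg : J_le (val f) (val g).
    have /subset_leqif_cards[le1 eq1] :
        [set m | J_le m (val g)] \subset [set m | J_le m (val f)].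
      by apply/subsetP => m; rewrite !inE => /J_le_trans; apply.
    have := allP sfs g gs; rewrite /ge_J /size_J => le2.
    move: eq1; rewrite eqn_leq le1 le2 => /esym/eqP/setP/(_ (val f)).
    by rewrite !inE J_le_refl.
  have [s' [t [gs' sf' ft tg [st ts]]]] := J_equiv_idem (midemE g) (midemE f) gf fg.
  have E n : ((a * n * b)%g == val g) = ((t * a * n * (b * s'))%g == val f).
    apply/eqP/eqP => E.
      have := congr1 (fun z => (t * z * s')%g) E.
      by rewrite !mulgA tg ts.
    have := congr1 (fun z => (s' * z * t)%g) E.
    by rewrite !mulgA st ga sf' st -!mulgA st bg.
  rewrite /sandwich (eq_bigl _ _ E); apply: yz.
    by rewrite mulgA ft.
  by rewrite -mulgA sf'.
have -> : sandwich (val g) (y - pi *: z) a b = sandwich (val g) y a b.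
  apply: eq_bigr => n /eqP nE; rewrite ma_subE ma_scaleE zf ?mulr0 ?subr0 //.
  by apply: contra gf; rewrite -nE => nf; apply: J_le_trans (J_le_mul _ _ _) nf.
exact: ys.
Qed.

End LiftRadical.

(** * Purity of the squared radical over O *)

Definition radical_square (M : finMonoidType) (R : comNzRingType) :=
  ideal_prod (@sandwich_radical M R) (@sandwich_radical M R).

Section RadicalSquare.
Variables (M : finMonoidType).

Section Ring.
Variable R : comNzRingType.
Implicit Types x y : monoid_algebra M R.

Lemma radical_square0 : radical_square (0 : monoid_algebra M R).
Proof. by exists [::]; rewrite ?big_nil. Qed.

Lemma radical_squareD x y : radical_square x -> radical_square y -> radical_square (x + y).
Proof.
move=> [s sP ->] [t tP ->]; exists (s ++ t); last by rewrite big_cat.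
by move=> u; rewrite mem_cat => /orP[/sP|/tP].
Qed.

Lemma radical_square_mul x y : sandwich_radical x -> sandwich_radical y ->
  radical_square (x * y).
Proof.
by move=> Nx Ny; exists [:: (x, y)]; rewrite ?big_seq1 // => u; rewrite inE => /eqP->.
Qed.

Lemma radical_square_ind (P : monoid_algebra M R -> Prop) : P 0 ->
  (forall x y, P x -> P y -> P (x + y)) ->
  (forall x y, sandwich_radical x -> sandwich_radical y -> P (x * y)) ->
  forall x, radical_square x -> P x.
Proof.
move=> P0 PD PM _ [s sP ->]; elim: s sP => [|u s IHs] sP; first by rewrite big_nil.
rewrite big_cons; apply: PD; last by apply: IHs => v vs; apply: sP; rewrite inE vs orbT.
by have [u1 u2] := sP u (mem_head _ _); apply: PM.
Qed.

Lemma radical_squareMl x y : radical_square y -> radical_square (x * y).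
Proof.
elim/radical_square_ind => [|a b Ia Ib|a b Na Nb].
- by rewrite mulr0; apply: radical_square0.
- by rewrite mulrDr; apply: radical_squareD.
by rewrite mulrA; apply: radical_square_mul => //; apply: sandwich_radicalMl.
Qed.

Lemma radical_squareMr x y : radical_square y -> radical_square (y * x).
Proof.
elim/radical_square_ind => [|a b Ia Ib|a b Na Nb].
- by rewrite mul0r; apply: radical_square0.
- by rewrite mulrDl; apply: radical_squareD.
by rewrite -mulrA; apply: radical_square_mul => //; apply: sandwich_radicalMr.
Qed.

Lemma radical_squareZ c x : radical_square x -> radical_square (c *: x).
Proof.
by move=> x2; rewrite -[x]mul1r scalerAl; apply: radical_squareMl.
Qed.

Lemma radical_square_sub x : radical_square x -> sandwich_radical x.
Proof.
elim/radical_square_ind => [|a b Ia Ib|a b Na Nb].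
- exact: sandwich_radical0.
- exact: sandwich_radicalD.
exact: sandwich_radicalMl.
Qed.

Lemma radical_square_sum (I : Type) (s : seq I) (P : pred I) (x : I -> monoid_algebra M R) :
  (forall i, P i -> radical_square (x i)) -> radical_square (\sum_(i <- s | P i) x i).
Proof.
by move=> Px; elim/big_ind: _; [apply: radical_square0 | apply: radical_squareD |].
Qed.

End Ring.

Lemma map_radical_square (R S : comNzRingType) (h : {rmorphism R -> S}) x :
  radical_square x -> radical_square (map_ma (M := M) h x).
Proof.
elim/radical_square_ind => [|a b Ia Ib|a b Na Nb].
- by rewrite map_ma0; apply: radical_square0.
- by rewrite map_maD; apply: radical_squareD.
by rewrite map_maM; apply: radical_square_mul; apply: map_ma_radical.
Qed.

Local Notation to h := (map_ma (intr : {rmorphism int -> h})).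

(* The radical is the solution space of integral linear equations, and over a domain of
   characteristic 0 such a space is spanned by integral solutions. *)
Lemma radical_integral_basis : exists v : M -> monoid_algebra M int,
  (forall i, sandwich_radical (v i)) /\
  forall (R : idomainType) (x : monoid_algebra M R), injective (intr : int -> R) ->
    sandwich_radical x -> exists y, x = \sum_i y i *: to R (v i).
Proof.
pose good (s : M * M * M) := let: (f, a, b) := s in
  [&& (f * f == f)%g, (f * a == a)%g & (b * f == b)%g].
pose c (s : M * M * M) (n : M) : int :=
  (good s && (s.1.2 * n * s.2 == s.1.1)%g)%:R.
have cE (R : comNzRingType) (x : monoid_algebra M R) f a b :
    good (f, a, b) -> \sum_n (c (f, a, b) n)%:~R * x n = sandwich f x a b.
  move=> gs; rewrite /sandwich [RHS]big_mkcond; apply: eq_bigr => n _.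
  by rewrite /c gs /=; case: eqP => _; rewrite ?mul1r ?mul0r.
have [v [vK vP]] := int_kernel c.
exists (fun j => [ffun n => v n j : int^o]); split.
  move=> j f a b /eqP ff /eqP fa /eqP bf.
  have gs : good (f, a, b) by rewrite /good ff fa bf.
  rewrite -cE // -[RHS](vK j (f, a, b)).
  by apply: eq_bigr => n _; rewrite ffunE intz.
move=> R x injR Nx; have [|y yE] := vP R (fun n => x n) injR.
  move=> [[f a] b]; have [gs|ngs] := boolP (good (f, a, b)).
    by rewrite cE //; have /and3P[/eqP ? /eqP ? /eqP ?] := gs; apply: Nx.
  by apply: big1 => n _; rewrite /c (negbTE ngs) mul0r.
exists y; apply/ffunP => n; rewrite yE sum_ffunE.
by apply: eq_bigr => j _; rewrite ma_scaleE !ffunE mulrC.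
Qed.

Variables (O : idomainType) (F k : fieldType).
Variables (iota : {rmorphism O -> F}) (rho : {rmorphism O -> k}).
Variables (p : nat) (pi : O).
Hypothesis sys : complete_system iota rho p pi.
Hypothesis p_prime : prime p.
Hypothesis nonmod : ~ modular M p.

Lemma radical_pure (R : idomainType) (a : R) (x : monoid_algebra M R) : a != 0 ->
  sandwich_radical (a *: x) -> sandwich_radical x.
Proof.
move=> a0 Nax f r l ff fr lf; apply: (mulfI a0).
by rewrite -sandwichZ Nax ?mulr0.
Qed.

(** The squared radical is spanned by the products of the integral generators [v i], the columns of
    [B]. Over Z they are p-pure, so B B' B = N B with [p] not dividing [N]. If pi z = B w, then pi N
    z = B B' B w = pi B B' z, hence z = N^-1 B B' z. *)
Lemma radical_square_pure (z : monoid_algebra M O) :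
  radical_square (pi *: z) -> radical_square z.
Proof.
have [v [vN vP]] := radical_integral_basis.
have span (R : idomainType) (x : monoid_algebra M R) : injective (intr : int -> R) ->
    radical_square x -> exists w : M * M -> R,
      x = \sum_ij w ij *: to R (v ij.1 * v ij.2).
  move=> injR; elim/radical_square_ind => [|a b [w ->] [w' ->]|a b Na Nb].
  - by exists (fun=> 0); rewrite big1 // => i _; rewrite scale0r.
  - by exists (fun i => w i + w' i); rewrite -big_split; apply: eq_bigr => i _; rewrite scalerDl.
  have [y ->] := vP R a injR Na; have [y' ->] := vP R b injR Nb.
  exists (fun ij => y ij.1 * y' ij.2).
  rewrite mulr_suml; under eq_bigr => i _ do rewrite mulr_sumr.
  rewrite pair_big; apply: eq_bigr => ij _ /=.
  by rewrite map_maM -scalerAl -scalerAr scalerA.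
pose B (m : M) (ij : M * M) : int := (v ij.1 * v ij.2) m.
have BE (R : comNzRingType) (w : M * M -> R) m :
    (\sum_ij w ij *: to R (v ij.1 * v ij.2)) m = \sum_ij (B m ij)%:~R * w ij.
  rewrite sum_ffunE; apply: eq_bigr => ij _.
  by rewrite ma_scaleE ffunE mulrC.
have intinj : injective (intr : int -> int) by move=> a b; rewrite !intz.
have v2 (R : comNzRingType) ij : radical_square (to R (v ij.1 * v ij.2)).
  by rewrite map_maM; apply: radical_square_mul; apply: map_ma_radical.
have [|B' [N [pN BB]]] := pure_quasi_inverse (c := B) p_prime.
  move=> x w xw; pose X : monoid_algebra M int := [ffun m => x m : int^o].
  have XE : X *+ p = \sum_ij w ij *: to int (v ij.1 * v ij.2).
    apply/ffunP => m; rewrite BE ffunMnE ffunE xw.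
    by apply: eq_bigr => ij _; rewrite intz.
  have pX : radical_square (X *+ p).
    by rewrite XE; apply: radical_square_sum => ij _; apply/radical_squareZ/v2.
  have NX : sandwich_radical X.
    apply: (@radical_pure _ p%:Z); first by rewrite -lt0n prime_gt0.
    by rewrite -[p%:Z]natz scaler_nat; apply: radical_square_sub.
  have [u uE] := span _ X intinj (sandwich_square_pure p_prime nonmod NX pX).
  exists u => m; have := congr1 (fun z : monoid_algebra M int => z m) uE.
  by rewrite BE ffunE => ->; apply: eq_bigr => ij _; rewrite intz.
move=> /(span _ _ (intr_inj_system sys))[w wE].
have uN := unit_natr sys pN.
pose bz ij := \sum_m (B' ij m)%:~R * z m.
suff -> : z = N%:R^-1 *: \sum_ij bz ij *: to O (v ij.1 * v ij.2).
  apply: radical_squareZ; apply: radical_square_sum => ij _.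
  exact/radical_squareZ/v2.
apply/ffunP => m; apply: (mulfI (uniformizer_neq0 sys)).
rewrite ma_scaleE BE mulrCA; apply: (canRL (mulKr uN)).
rewrite -ma_scaleE wE BE mulr_sumr /bz.
transitivity (\sum_ij (\sum_ij' \sum_m' (B m ij')%:~R * (B' ij' m')%:~R * (B m' ij)%:~R) * w ij).
  apply: eq_bigr => ij _; rewrite mulrA; congr (_ * _).
  rewrite -[N%:R](rmorph_nat (intr : {rmorphism int -> O})) -rmorphM mulr_natl -BB.
  rewrite rmorph_sum; apply: eq_bigr => ij' _; rewrite rmorph_sum.
  by apply: eq_bigr => m' _; rewrite !rmorphM.
under eq_bigr => ij _ do rewrite mulr_suml.
rewrite exchange_big mulr_sumr; apply: eq_bigr => ij' _ /=.
rewrite mulr_sumr.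
under eq_bigr => ij _ do rewrite mulr_suml.
rewrite exchange_big /= mulr_sumr.
transitivity (\sum_m' (B m ij')%:~R * (B' ij' m')%:~R * (pi *: z) m').
  apply: eq_bigr => m' _; rewrite wE BE mulr_sumr; apply: eq_bigr => ij _.
  by rewrite mulrA.
by apply: eq_bigr => m' _; rewrite ma_scaleE; ring.
Qed.

End RadicalSquare.

(** * Lifting idempotents by completeness *)

Section LiftIdempotents.
Variables (O : idomainType) (F k : fieldType).
Variables (iota : {rmorphism O -> F}) (rho : {rmorphism O -> k}).
Variables (p : nat) (pi : O).
Hypothesis sys : complete_system iota rho p pi.
Variable M : finMonoidType.
Local Notation A := (monoid_algebra M O).
Local Notation red := (@map_ma M O k rho).
Implicit Types x y z u : A.

Definition pi_divides n x := exists b : A, x = pi ^+ n *: b.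

Lemma pi_dividesD n x y : pi_divides n x -> pi_divides n y -> pi_divides n (x + y).
Proof. by move=> [b ->] [c ->]; exists (b + c); rewrite scalerDr. Qed.

Lemma pi_dividesN n x : pi_divides n x -> pi_divides n (- x).
Proof. by move=> [b ->]; exists (- b); rewrite scalerN. Qed.

Lemma pi_dividesMl n x y : pi_divides n y -> pi_divides n (x * y).
Proof. by move=> [b ->]; exists (x * b); rewrite scalerAr. Qed.

Lemma pi_dividesMr n x y : pi_divides n y -> pi_divides n (y * x).
Proof. by move=> [b ->]; exists (b * x); rewrite scalerAl. Qed.

Lemma pi_dividesM n m x y : pi_divides n x -> pi_divides m y -> pi_divides (n + m) (x * y).
Proof. by move=> [b ->] [c ->]; exists (b * c); rewrite -scalerAl -scalerAr scalerA exprD. Qed.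

Lemma pi_divides_le n m x : (m <= n)%N -> pi_divides n x -> pi_divides m x.
Proof.
by move=> mn [b ->]; exists (pi ^+ (n - m) *: b); rewrite scalerA -exprD subnKC.
Qed.

Lemma pi_dividesP n x : pi_divides n x <-> forall m, exists b, x m = b * pi ^+ n.
Proof.
split=> [[b ->] m|xm]; first by exists (b m); rewrite ma_scaleE mulrC.
pose c m := sval (cid (xm m)).
exists [ffun m => c m : O^o]; apply/ffunP => m.
by rewrite ma_scaleE ffunE /c; case: cid => b /= ->; rewrite mulrC.
Qed.

Lemma pi_divides_eq0 x : (forall n, pi_divides n x) -> x = 0.
Proof.
move=> xn; apply/ffunP => m; rewrite ffunE; apply: (separated sys) => n.
by have /pi_dividesP := xn n; apply.
Qed.

Lemma pi_divides_limit (u : nat -> A) : (forall n, pi_divides n (u n.+1 - u n)) ->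
  exists l, forall n, pi_divides n (l - u n).
Proof.
move=> un.
have um m : exists l, forall n, exists b, l - u n m = b * pi ^+ n.
  apply: (complete_seq sys) => n.
  by have /pi_dividesP/(_ m) := un n; rewrite ma_subE.
pose l m := sval (cid (um m)); exists [ffun m => l m : O^o] => n.
apply/pi_dividesP => m; rewrite ma_subE ffunE /l.
by case: cid => c /= /(_ n).
Qed.

Lemma red_eq0 x : red x = 0 <-> pi_divides 1 x.
Proof.
split=> [rx|[b ->]]; last by rewrite map_maZ expr1 (residue_pi sys) scale0r.
apply/pi_dividesP => m; rewrite expr1; apply/(residue_ker sys).
by have := congr1 (fun z : monoid_algebra M k => z m) rx; rewrite !ffunE.
Qed.

(* Newton's step for y^2 - y = 0, which squares the error. *)
Definition newton y := y - (y *+ 2 - 1) * (y * y - y).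

Lemma newton_square y (d := y * y - y) :
  newton y * newton y - newton y = d * d * (d *+ 4 - 3%:R).
Proof.
(* Everything happens in the commutative subalgebra generated by [y]: the identity is proved for an
   indeterminate and evaluated at [y]. *)
pose P : {poly O} := 'X; pose D := P * P - P; pose N := P - (P *+ 2 - 1) * D.
have E : N * N - N = D * D * (D *+ 4 - 3%:R) by rewrite /N /D; ring.
have hX : horner_alg y P = y by rewrite horner_algX.
have hD : horner_alg y D = d by rewrite rmorphB rmorphM /= hX.
have hN : horner_alg y N = newton y.
  by rewrite rmorphB rmorphM rmorphB rmorphMn rmorph1 /= hD hX.
clearbody N D.
have := congr1 (horner_alg y) E.
by rewrite rmorphB rmorphM /= hN !rmorphM rmorphB rmorphMn rmorph_nat /= hD.
Qed.

(** Newton's iteration stays in the corner of [u], and its n-th error is divisible by [pi ^+ n.+1].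
    Lifting within a corner makes it possible to lift orthogonal idempotents in turn, each in the
    corner complementary to the previous ones. *)
Lemma idempotent_lift u (e : monoid_algebra M k) : u * u = u -> e * e = e ->
  red u * e = e -> e * red u = e ->
  exists z, [/\ z * z = z, u * z = z, z * u = z & red z = e].
Proof.
move=> uu ee ue eu.
have [y0 y0e] := map_ma_surj sys e.
pose y n := iter n newton (u * y0 * u).
have yu n : u * y n = y n /\ y n * u = y n.
  elim: n => [|n [IH1 IH2]] /=; first by rewrite !mulrA uu -!mulrA uu.
  have d1 : u * (y n * y n - y n) = y n * y n - y n by rewrite mulrBr mulrA IH1.
  have d2 : (y n * y n - y n) * u = y n * y n - y n by rewrite mulrBl -mulrA IH2.
  rewrite /newton; split.
    rewrite mulrBr IH1; congr (_ - _); move: (y n * y n - y n) d1 => d d1.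
    by rewrite mulrBl mul1r mulrBr d1 mulrA mulrnAr IH1.
  by rewrite mulrBl IH2 -mulrA d2.
have ysq n : pi_divides n.+1 (y n * y n - y n).
  elim: n => [|n IHn].
    by apply/red_eq0; rewrite map_maB !map_maM y0e ue eu ee subrr.
  rewrite /= newton_square; apply: pi_dividesMr.
  by apply: pi_divides_le (pi_dividesM IHn IHn); lia.
have ystep n : pi_divides n.+1 (y n.+1 - y n).
  rewrite /= /newton addrC addKr -mulNr; exact: pi_dividesMl.
have yred n : red (y n) = e.
  elim: n => [|n IHn]; first by rewrite /= !map_maM y0e ue eu.
  have /red_eq0 : pi_divides 1 (y n.+1 - y n) by apply: pi_divides_le (ystep n).
  by rewrite map_maB IHn => /subr0_eq.
have [l lP] : exists l, forall n, pi_divides n (l - y n).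
  by apply: pi_divides_limit => n; apply: pi_divides_le (ystep n).
have lim_eq z : (forall n, pi_divides n (z - y n)) -> z = l.
  move=> zP; apply/subr0_eq/pi_divides_eq0 => n.
  have -> : z - l = (z - y n) + - (l - y n) by rewrite opprB addrA subrK.
  by apply: pi_dividesD => //; apply: pi_dividesN.
exists l; split.
- apply: lim_eq => n.
  have -> : l * l - y n = l * (l - y n) + (l - y n) * y n + (y n * y n - y n).
    by rewrite mulrBr mulrBl !addrA !subrK.
  apply: pi_dividesD; last by apply: pi_divides_le (ysq n).
  by apply: pi_dividesD; [apply: pi_dividesMl | apply: pi_dividesMr].
- apply: lim_eq => n; rewrite -{1}(yu n).1 -mulrBr.
  exact: pi_dividesMl.
- apply: lim_eq => n; rewrite -{1}(yu n).2 -mulrBl.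
  exact: pi_dividesMr.
have /red_eq0 := lP 1%N; rewrite map_maB yred.
exact: subr0_eq.
Qed.

Lemma orthogonal_lift (n : nat) (e : nat -> monoid_algebra M k) :
  (forall i, (i < n)%N -> e i * e i = e i) ->
  (forall i j, (i < n)%N -> (j < n)%N -> i != j -> e i * e j = 0) ->
  exists z : nat -> A, [/\ forall i, (i < n)%N -> z i * z i = z i,
    forall i j, (i < n)%N -> (j < n)%N -> i != j -> z i * z j = 0 &
    forall i, (i < n)%N -> red (z i) = e i].
Proof.
elim: n => [|n IHn] ee ef; first by exists (fun=> 0).
have [||z [zz zo ze]] := IHn.
- by move=> i /ltnW; apply: ee.
- by move=> i j /ltnW ? /ltnW ?; apply: ef.
pose u := \sum_(i < n) z i.
have zu i : (i < n)%N -> z i * u = z i /\ u * z i = z i.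
  move=> ni; rewrite mulr_sumr mulr_suml (bigD1 (Ordinal ni)) //= zz // big1 ?addr0.
    split=> //; rewrite (bigD1 (Ordinal ni)) //= zz // big1 ?addr0 // => j ji.
    by apply: zo.
  by move=> j ji; apply: zo => //; rewrite eq_sym.
have uu : u * u = u.
  by rewrite {1}/u mulr_suml; apply: eq_bigr => i _; rewrite (zu i _).1.
have ru : red u = \sum_(i < n) e i.
  by rewrite map_ma_sum; apply: eq_bigr => i _; apply: ze.
have ue : red u * e n = 0.
  rewrite ru mulr_suml big1 // => i _; apply: ef => //; last by rewrite ltn_eqF.
  by rewrite ltnS ltnW.
have eu : e n * red u = 0.
  rewrite ru mulr_sumr big1 // => i _; apply: ef => //; last by rewrite eq_sym ltn_eqF.
  by rewrite ltnS ltnW.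
have [||||z' [zz' uz' zu' ze']] := @idempotent_lift (1 - u) (e n).
- by rewrite mulrBr mulr1 mulrBl mul1r uu subrr subr0.
- by apply: ee.
- by rewrite map_maB map_ma1 mulrBl mul1r ue subr0.
- by rewrite map_maB map_ma1 mulrBr mulr1 eu subr0.
have uz0 : u * z' = 0 by rewrite -uz' mulrBl mul1r mulrBr mulrA uu subrr.
have zu0 : z' * u = 0 by rewrite -zu' mulrBr mulr1 mulrBl -mulrA uu subrr.
have lt_n i : (i < n.+1)%N -> i != n -> (i < n)%N by lia.
exists (fun i => if i == n then z' else z i); split.
- move=> i ni; have [//|ne] := eqVneq i n; exact: zz (lt_n i ni ne).
- move=> i j ni nj ij; have [iE|ine] := eqVneq i n; have [jE|jne] := eqVneq j n.
  + by rewrite iE jE eqxx in ij.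
  + by rewrite -(zu j (lt_n j nj jne)).2 mulrA zu0 mul0r.
  + by rewrite -(zu i (lt_n i ni ine)).1 -mulrA uz0 mulr0.
  exact: zo (lt_n i ni ine) (lt_n j nj jne) ij.
by move=> i ni; have [->//|ne] := eqVneq i n; exact: ze (lt_n i ni ne).
Qed.

Lemma complete_orthogonal_lift (n : nat) (e : 'I_n -> monoid_algebra M k) :
  (forall i, e i * e i = e i) -> (forall i j, i != j -> e i * e j = 0) ->
  \sum_i e i = 1 ->
  exists z : 'I_n -> A, [/\ forall i, z i * z i = z i,
    forall i j, i != j -> z i * z j = 0, forall i, red (z i) = e i & \sum_i z i = 1].
Proof.
case: n e => [|n] e ee ef e1.
  move: e1; rewrite big_ord0 => /esym/eqP.
  by rewrite oner_eq0.
have [||z [zz zo ze]] := @orthogonal_lift n.+1 (fun i => e (inord i)).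
- by move=> i _; apply: ee.
- move=> i j ni nj ij; apply: ef; rewrite -val_eqE /= !inordK //.
have zE (i : 'I_n.+1) : red (z i) = e i by rewrite ze // inord_val.
exists (fun i => z i); split=> //; first by move=> i; apply: zz.
- by move=> i j ij; apply: zo.
pose u := \sum_(i < n.+1) z i.
have uu : u * u = u.
  rewrite {1}/u mulr_suml; apply: eq_bigr => i _.
  by rewrite mulr_sumr (bigD1 i) //= zz // big1 ?addr0 // => j ji; apply: zo; rewrite // eq_sym.
have vv : (1 - u) * (1 - u) = 1 - u.
  by rewrite mulrBr mulr1 mulrBl mul1r uu subrr subr0.
have ru : red (1 - u) = 0.
  rewrite map_maB map_ma1 map_ma_sum; under eq_bigr => i _ do rewrite zE.
  by rewrite e1 subrr.
(* The idempotent [1 - u] is divisible by [pi], hence by every power of [pi]. *)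
apply/esym/subr0_eq/pi_divides_eq0 => m.
elim: m => [|m IHm]; first by exists (1 - u); rewrite expr0 scale1r.
rewrite -vv -addn1; apply: pi_dividesM => //.
exact/red_eq0.
Qed.

Lemma one_plus_pi_unit x : exists y, (1 - pi *: x) * y = 1 /\ y * (1 - pi *: x) = 1.
Proof.
pose t := pi *: x.
pose y n := \sum_(i < n) t ^+ i.
have tn n : pi_divides n (t ^+ n).
  elim: n => [|n IHn]; first by exists 1; rewrite !expr0 scale1r.
  by rewrite exprSr -addn1; apply: pi_dividesM => //; exists x; rewrite expr1.
have [n|l lP] := @pi_divides_limit y.
  by rewrite /y big_ord_recr /= addrAC subrr add0r.
have cy n : GRing.comm (y n) (1 - t).
  apply/commr_sym/commr_sum => i _; apply/commrX/commr_sym/commrB => //.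
  exact: commr1.
have y1 n : (1 - t) * y n = 1 - t ^+ n.
  by rewrite -[1 - t]opprB mulNr -subrX1 opprB.
have sub2 (X T : A) : X - 1 = X - (1 - T) - T by rewrite opprB addrA [RHS]addrAC addrK.
exists l; split; apply/subr0_eq/pi_divides_eq0 => n.
  rewrite (sub2 _ (t ^+ n)) -y1 -mulrBr.
  by apply: pi_dividesD; [apply: pi_dividesMl | apply: pi_dividesN].
rewrite (sub2 _ (t ^+ n)) -y1 -cy -mulrBl.
by apply: pi_dividesD; [apply: pi_dividesMr | apply: pi_dividesN].
Qed.

End LiftIdempotents.

(** * Splitting fields and basic idempotents *)

Record left_submodule (A : pzRingType) := LeftSubmodule {
  left_sub :> zsubgroup A;
  left_subM : forall a x, left_sub x -> left_sub (a * x)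
}.

Definition left_quot (A : pzRingType) (L : left_submodule A) := zquot L.

Section LeftQuotient.
Variables (A : pzRingType) (L : left_submodule A).
Local Notation Q := (left_quot L).

HB.instance Definition _ := GRing.Zmodule.on Q.
HB.instance Definition _ := Quotient.on Q.

Lemma left_quotP (x y : A) : \pi_Q x = \pi_Q y <-> L (x - y).
Proof. exact: zquotP. Qed.

Lemma left_quotK (x : A) : L (repr (\pi_Q x) - x).
Proof. by apply/left_quotP; rewrite reprK. Qed.

Lemma left_pi_zmod_morphism : zmod_morphism (\pi_Q).
Proof. by move=> x y /=; rewrite !piE. Qed.

HB.instance Definition _ :=
  GRing.isZmodMorphism.Build A Q \pi_Q left_pi_zmod_morphism.

Definition left_scale (a : A) : Q -> Q := lift_op1 Q ( *%R a).

Lemma left_pi_scale a x : \pi_Q (a * x) = left_scale a (\pi_Q x).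
Proof.
rewrite /left_scale -lock; apply/esym/left_quotP; rewrite -mulrBr.
exact/left_subM/left_quotK.
Qed.

Lemma left_scaleA a b v : left_scale a (left_scale b v) = left_scale (a * b) v.
Proof. by elim/quotW: v => x; rewrite -!left_pi_scale mulrA. Qed.

Lemma left_scale1 : left_id 1 left_scale.
Proof. by elim/quotW=> x; rewrite -left_pi_scale mul1r. Qed.

Lemma left_scaleDr : right_distributive left_scale +%R.
Proof.
move=> a; elim/quotW=> x; elim/quotW=> y.
by rewrite -raddfD -!left_pi_scale -raddfD mulrDr.
Qed.

Lemma left_scaleDl v : {morph left_scale^~ v : a b / a + b}.
Proof.
by move=> a b; elim/quotW: v => x; rewrite -!left_pi_scale -raddfD mulrDl.
Qed.

HB.instance Definition _ := GRing.Zmodule_isLmodule.Build A Q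
  left_scaleA left_scale1 left_scaleDr left_scaleDl.

Lemma left_scaleE a x : a *: (\pi_Q x) = \pi_Q (a * x).
Proof. by rewrite left_pi_scale. Qed.

Variable y : A.
Hypothesis Ly : forall x, L x -> L (x * y).

Definition right_mul (v : Q) : Q := \pi_Q (repr v * y).

Lemma right_mulE x : right_mul (\pi_Q x) = \pi_Q (x * y).
Proof. apply/left_quotP; rewrite -mulrBl; apply: Ly; exact: left_quotK. Qed.

Lemma right_mul_is_linear : linear right_mul.
Proof.
move=> a; elim/quotW=> x; elim/quotW=> z.
rewrite left_scaleE -raddfD !right_mulE left_scaleE -raddfD.
by rewrite mulrDl mulrA.
Qed.

Lemma right_mul_linear : exists h : {linear Q -> Q}, forall v, h v = right_mul v.
Proof.
pose m := GRing.isLinear.Build A Q Q *:%R right_mul right_mul_is_linear.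
pose h : {linear Q -> Q} := HB.pack right_mul m.
by exists h.
Qed.

End LeftQuotient.

Section Splitting.
Variables (M : finMonoidType) (K : fieldType).
Local Notation A := (monoid_algebra M K).
Hypothesis GK : forall f : midem M, #|{: maxgroup f}|%:R != 0 :> K.

(** If every [e * a * x] were nilpotent, so would be every [a * x], and [x] would be radical.
    Otherwise some [e * a * x] is a unit of the local corner at [e]. *)
Lemma nonradical_left_inverse (e x : A) : primitive_idempotent e -> x * e = x ->
  ~ sandwich_radical x -> exists2 a, e * a = a & a * x = e.
Proof.
move=> pe xe Nx; have [ee _ _] := pe; apply: contrapT => no; apply: Nx.
apply: nil_left_ideal_sandwich_radical => // a.
have [||[n zn]|[y [ey ye _ yz]]] :=
  @primitive_dichotomy _ e (e * a * x) (@monoid_algebra_pi_regular M K) pe.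
- by rewrite !mulrA ee.
- by rewrite -!mulrA xe.
- exists n.+1; suff -> : (a * x) ^+ n.+1 = a * x * (e * a * x) ^+ n.
    by rewrite zn mulr0.
  elim: n {zn} => [|n IHn]; first by rewrite mulr1 expr1.
  have we : a * x * (e * a * x) ^+ n * e = a * x * (e * a * x) ^+ n.
    case: (n) => [|i]; first by rewrite expr0 mulr1 -!mulrA xe.
    by rewrite exprSr -!mulrA xe.
  by rewrite exprSr IHn exprSr -[in LHS]we !mulrA.
case: no; exists (y * e * a); first by rewrite !mulrA ey.
by rewrite -[RHS]yz !mulrA.
Qed.

(** The quotient of A by the left ideal [P] is a copy of the simple module Ae/Ne. Right
    multiplication by [y] acts on it as a scalar [c], which is read off at the class of 1. *)
Lemma splitting_corner (e : A) : splitting_field A -> primitive_idempotent e ->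
  forall y, e * y = y -> y * e = y -> exists c : K, sandwich_radical (y - c *: e).
Proof.
move=> splitA pe y ey ye; have [ee e0 _] := pe.
pose P (x : A) := sandwich_radical (x * e).
have P0 : P 0 by rewrite /P mul0r; apply: sandwich_radical0.
have PB x z : P x -> P z -> P (x - z).
  move=> Px Pz; rewrite /P mulrBl -scaleN1r; apply: sandwich_radicalD => //.
  exact: sandwich_radicalZ.
have PM a x : P x -> P (a * x) by move=> Px; rewrite /P -mulrA; apply: sandwich_radicalMl.
pose L := @LeftSubmodule A (ZSubgroup P0 PB) PM.
pose Q := left_quot L.
have Ly x : L x -> L (x * y).
  move=> Lx; rewrite /= /P -mulrA ye -ey mulrA; exact: sandwich_radicalMr.
have e_nonrad : ~ sandwich_radical e.
  move=> Ne; have [n nP] := sandwich_radical_nilpotent M K.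
  case/eqP: e0.
  have <- : \prod_(x <- nseq n.+1 e) x = e.
    by elim: (n) => [|i IHi]; rewrite /= big_cons ?big_nil ?mulr1 // IHi.
  by apply: nP => [x|]; rewrite ?size_nseq // => /nseqP[->].
have simpleQ : simple_module Q.
  split.
    exists (\pi_Q e); apply/eqP; rewrite -(raddf0 \pi_Q) => /left_quotP.
    by rewrite subr0 /= /P ee.
  move=> N N0 ND NM.
  have [[v Nv v0]|no] := pselect (exists2 v, N v & v != 0); last first.
    left=> v Nv; apply/eqP; apply: contrapT => v0; apply: no.
    by exists v => //; apply/negP.
  right; move: v Nv v0; elim/quotW=> x Nx x0.
  have Px : ~ P x.
    move=> Px; case/eqP: x0; rewrite -(raddf0 \pi_Q); apply/left_quotP.
    by rewrite subr0.
  have [|a ea ax] := nonradical_left_inverse pe _ Px.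
    by rewrite -mulrA ee.
  elim/quotW=> z.
  have -> : \pi_Q z = (z * a) *: \pi_Q x.
    rewrite left_scaleE; apply/left_quotP; rewrite /= /P.
    suff -> : (z - z * a * x) * e = 0 by apply: sandwich_radical0.
    by rewrite mulrBl -!mulrA ax subrr.
  exact: NM.
have [h hE] := right_mul_linear Ly.
have [c cE] := splitA Q simpleQ h.
exists c; have := cE (\pi_Q 1).
rewrite hE right_mulE // left_scaleE mul1r mulr1 => /left_quotP.
by rewrite /= /P mulrBl ye -scalerAl mul1r.
Qed.

End Splitting.

Lemma idempotent_in_radical (M : finMonoidType) (R : comNzRingType)
  (e : monoid_algebra M R) : e * e = e -> sandwich_radical e -> e = 0.
Proof.
move=> ee Ne; have [n nP] := sandwich_radical_nilpotent M R.
have <- : \prod_(x <- nseq n.+1 e) x = e.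
  by elim: (n) => [|i IHi]; rewrite /= big_cons ?big_nil ?mulr1 // IHi.
by apply: nP => [x|]; rewrite ?size_nseq // => /nseqP[->].
Qed.

Lemma iso_idem_map (M : finMonoidType) (R S : comNzRingType) (h : {rmorphism R -> S})
    (e f : monoid_algebra M R) :
  iso_idem e f -> iso_idem (map_ma h e) (map_ma h f).
Proof.
move=> [a [b [ea af fb be [ab ba]]]]; exists (map_ma h a), (map_ma h b).
by rewrite -!map_maM ea af fb be ab ba.
Qed.

(** If [x] were not radical, a left factor would carry it to [e]; this makes [e] and [f] isomorphic,
    hence conjugate. *)
Lemma primitive_corner_radical (M : finMonoidType) (K : fieldType)
    (e f x : monoid_algebra M K) :
  (forall f : midem M, #|{: maxgroup f}|%:R != 0 :> K) ->
  primitive_idempotent e -> primitive_idempotent f -> ~ conjugate e f ->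
  f * x = x -> x * e = x -> sandwich_radical x.
Proof.
move=> GK pe pf ncef fx xe; apply: contrapT => Nx; apply: ncef.
have [ee e0 _] := pe; have [ff _ _] := pf.
have [a ea ax] := nonradical_left_inverse GK pe xe Nx.
apply: conjugate_of_iso => //; first exact: monoid_algebra_pi_regular.
apply: (@primitive_iso_of_nonzero _ e f (a * f) x pf) => //.
- by rewrite mulrA ea.
- by rewrite -mulrA ff.
by rewrite -mulrA fx.
Qed.

(** * Corners of OM and FM at lifted idempotents *)

Section BasicIdempotent.
Variables (O : idomainType) (F k : fieldType).
Variables (iota : {rmorphism O -> F}) (rho : {rmorphism O -> k}).
Variables (p : nat) (pi : O).
Hypothesis sys : complete_system iota rho p pi.
Hypothesis p_prime : prime p.
Variable M : finMonoidType.
Hypothesis nonmod : ~ modular M p.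
Hypothesis splitk : splitting_field (monoid_algebra M k).
Local Notation A := (monoid_algebra M O).
Local Notation red := (@map_ma M O k rho).
Local Notation ext := (@map_ma M O F iota).

Let pi0 := uniformizer_neq0 sys.
Let ext_inj : injective ext := map_ma_inj (fraction_inj sys).

Lemma residue_card_neq0 (f : midem M) : #|{: maxgroup f}|%:R != 0 :> k.
Proof.
have := unit_residue_neq0 rho (card_maxgroup_unit sys nonmod f).
by rewrite rmorph_nat.
Qed.

Lemma common_denominator (I : finType) (c : I -> F) :
  exists d (b : I -> O), d != 0 /\ forall i, iota d * c i = iota (b i).
Proof.
have cP i := fractionP sys (c i).
pose a i := sval (cid (cP i)).
pose b i := sval (cid (svalP (cid (cP i)))).
have bP i : b i != 0 /\ c i = iota (a i) / iota (b i).
  exact: svalP (cid (svalP (cid (cP i)))).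
exists (\prod_i b i), (fun i => a i * \prod_(j | j != i) b j); split.
  by apply/prodf_neq0 => i _; have [] := bP i.
move=> i; have [bi ->] := bP i.
have bi' : iota (b i) != 0.
  by apply: contra bi => /eqP bi0; apply/eqP/(fraction_inj sys); rewrite bi0 rmorph0.
rewrite (bigD1 i) //= !rmorphM [_ * (iota (a i) / _)]mulrC mulrA.
by rewrite mulfVK.
Qed.

Lemma clear_denominator (x : monoid_algebra M F) :
  exists d y, d != 0 /\ iota d *: x = ext y.
Proof.
have [d [b [d0 db]]] := common_denominator (fun m => x m).
exists d, [ffun m => b m : O^o]; split=> //.
by apply/ffunP => m; rewrite ma_scaleE !ffunE db.
Qed.

Lemma iota_neq0 d : d != 0 -> iota d != 0.
Proof. by apply: contra => /eqP d0; apply/eqP/(fraction_inj sys); rewrite d0 rmorph0. Qed.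

Lemma ext_radical x : sandwich_radical (ext x) -> sandwich_radical x.
Proof.
move=> Nx f r l ff fr lf; apply: (fraction_inj sys).
by rewrite -sandwich_map Nx ?rmorph0.
Qed.

Lemma scale_uniformizer_inj (x y : A) : pi *: x = pi *: y -> x = y.
Proof.
move=> /ffunP xy; apply/ffunP => m; apply: (mulfI pi0).
by have := xy m; rewrite !ma_scaleE.
Qed.

(** Iterating the decomposition makes every sandwich sum of [y] divisible by all powers of [pi]; no
    series of radical parts has to be summed. *)
Lemma radical_descent (Y : A -> Prop) :
  (forall y, Y y -> exists n y', [/\ sandwich_radical n, Y y' & y = n + pi *: y']) ->
  forall y, Y y -> sandwich_radical y.
Proof.
move=> YP y Yy f r l ff fr lf; apply: (separated sys) => n.
elim: n y Yy => [|n IHn] y Yy; first by exists (sandwich f y r l); rewrite mulr1.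
have [z [y' [Nz Yy' ->]]] := YP y Yy; have [b bE] := IHn y' Yy'.
by exists b; rewrite sandwichD sandwichZ Nz // add0r bE exprS mulrCA.
Qed.

(* A corner element with reduction in the radical is, up to the radical, divisible by pi
   within the corner. *)
Lemma corner_lift (e f y : A) : e * e = e -> f * f = f -> f * y = y -> y * e = y ->
  sandwich_radical (red y) ->
  exists n y', [/\ sandwich_radical n, f * y' = y', y' * e = y' & y = n + pi *: y'].
Proof.
move=> ee ff fy ye Ny.
have [z zE Nz] := lift_radical sys p_prime nonmod Ny.
pose n := f * z * e.
have Nn : sandwich_radical n by apply: sandwich_radicalM.
have /(red_eq0 sys)[w wE] : red (y - n) = 0.
  by rewrite map_maB !map_maM zE -!map_maM fy ye subrr.
rewrite expr1 in wE.
exists n, w; split=> //.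
- by apply: scale_uniformizer_inj; rewrite scalerAr -wE mulrBr fy /n !mulrA ff.
- by apply: scale_uniformizer_inj; rewrite scalerAl -wE mulrBl ye /n -!mulrA ee.
by rewrite -wE addrC subrK.
Qed.

(** The scalar is found at once: some sandwich functional [D] is nonzero at the idempotent [red e].
    It kills the radical and is a unit at [e], so [c] has to be [D x / D e]. A corner element on
    which [D] vanishes has radical reduction, and [radical_descent] applies. *)
Lemma lifted_corner_split (e : A) : e * e = e -> primitive_idempotent (red e) ->
  forall x, e * x = x -> x * e = x -> exists c, sandwich_radical (x - c *: e).
Proof.
move=> ee pe.
have [re re0 _] := pe.
have [f [r [l [ff fr lf u0]]]] : exists f r l, [/\ (f * f = f)%g, (f * r = r)%g,
    (l * f = l)%g & sandwich f (red e) r l != 0].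
  apply: contrapT => no; case/eqP: re0; apply: idempotent_in_radical => //.
  move=> f r l ff fr lf; apply/eqP; apply: contrapT => u0; apply: no.
  by exists f, r, l; split=> //; apply/negP.
pose D (z : A) := sandwich f z r l.
have uD : D e \is a GRing.unit by apply: (residue_unit sys); rewrite -sandwich_map.
move=> x ex xe; exists (D x / D e).
pose Y y := [/\ e * y = y, y * e = y & D y = 0].
suff YN y : Y y -> sandwich_radical y.
  apply: YN; split.
  - by rewrite mulrBr ex -scalerAr ee.
  - by rewrite mulrBl xe -scalerAl ee.
  by rewrite /D -scaleN1r scalerA sandwichD sandwichZ -/(D x) -/(D e) mulN1r mulNr divrK // subrr.
apply: (@radical_descent Y) => {}y [ey ye Dy].
have [||c Nc] := @splitting_corner _ _ residue_card_neq0 (red e) splitk pe (red y).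
- by rewrite -map_maM ey.
- by rewrite -map_maM ye.
have c0 : c = 0.
  have := Nc f r l ff fr lf.
  rewrite -scaleN1r scalerA sandwichD sandwichZ sandwich_map -/(D y) Dy rmorph0 add0r.
  by move/eqP; rewrite mulf_eq0 (negbTE u0) orbF mulN1r oppr_eq0 => /eqP.
rewrite c0 scale0r subr0 in Nc.
have [n [y' [Nn ey' ye' yE]]] := corner_lift ee ee ey ye Nc.
exists n, y'; split=> //; split=> //.
apply: (mulfI pi0); rewrite mulr0 -[RHS]Dy yE /D sandwichD sandwichZ Nn //.
by rewrite add0r.
Qed.

Lemma lifted_corner_radical (e f : A) : e * e = e -> f * f = f ->
  primitive_idempotent (red e) -> primitive_idempotent (red f) ->
  ~ conjugate (red e) (red f) ->
  forall x, f * x = x -> x * e = x -> sandwich_radical x.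
Proof.
move=> ee ff pe pf ncef x fx xe.
apply: (@radical_descent (fun y => f * y = y /\ y * e = y)) => // y [fy ye].
have Ny : sandwich_radical (red y).
  apply: (primitive_corner_radical residue_card_neq0 pe pf ncef).
    by rewrite -map_maM fy.
  by rewrite -map_maM ye.
have [n [y' [Nn ey' ye' yE]]] := corner_lift ee ff fy ye Ny.
by exists n, y'.
Qed.

Lemma ext_corner (e f : A) (x : monoid_algebra M F) : ext f * x = x -> x * ext e = x ->
  exists d y, [/\ d != 0, f * y = y, y * e = y & iota d *: x = ext y].
Proof.
move=> fx xe; have [d [y [d0 dy]]] := clear_denominator x.
exists d, y; split=> //; apply: ext_inj.
  by rewrite map_maM -dy -scalerAr fx.
by rewrite map_maM -dy -scalerAl xe.
Qed.

Lemma ext_idem (e : A) : e * e = e -> ext e * ext e = ext e.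
Proof. by move=> ee; rewrite -map_maM ee. Qed.

(** Clearing denominators shows that an idempotent summand [a] of [ext e] is [c' *: ext e] modulo
    the radical. Idempotency makes [c'] 0 or 1, so [a] or its complement is an idempotent in the
    radical, hence zero. *)
Lemma lifted_primitive (e : A) : e * e = e -> primitive_idempotent (red e) ->
  primitive_idempotent (ext e).
Proof.
move=> ee pe; have [_ re0 _] := pe.
have e0 : ext e != 0.
  apply: contra re0 => /eqP ez.
  have -> : e = 0 by apply: ext_inj; rewrite ez map_ma0.
  by rewrite map_ma0.
split=> //; first exact: ext_idem.
move=> a b aa bb ab ba eE.
have ea : ext e * a = a by rewrite eE mulrDl aa ba addr0.
have ae : a * ext e = a by rewrite eE mulrDr aa ab addr0.
have [d [x [d0 ex xe dx]]] := ext_corner ea ae.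
have [c Nc] := lifted_corner_split ee pe ex xe.
pose c' := iota c / iota d.
have d0' := iota_neq0 d0.
have Na : sandwich_radical (a - c' *: ext e).
  have -> : a - c' *: ext e = (iota d)^-1 *: ext (x - c *: e).
    by rewrite map_maB -dx map_maZ scalerBr scalerK // scalerA mulrC.
  exact/sandwich_radicalZ/map_ma_radical.
have : sandwich_radical ((c' * c' - c') *: ext e).
  have -> : (c' * c' - c') *: ext e =
      (a - c' *: ext e) - (a * (a - c' *: ext e) + (a - c' *: ext e) * (c' *: ext e)).
    have E1 : a * (a - c' *: ext e) = a - c' *: a.
      by rewrite mulrBr aa -scalerAr ae.
    have E2 : (a - c' *: ext e) * (c' *: ext e) = c' *: a - (c' * c') *: ext e.
      by rewrite mulrBl -!scalerAr ae -scalerAl ext_idem // scalerA.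
    by rewrite E1 E2 addrA subrK opprB scalerBl [RHS]addrC addrA subrK.
  rewrite -[X in _ + X]scaleN1r.
  apply: sandwich_radicalD => //; apply: sandwich_radicalZ; apply: sandwich_radicalD.
    exact: sandwich_radicalMl.
  exact: sandwich_radicalMr.
move=> Ncc.
have /eqP : c' * c' - c' = 0.
  apply/eqP; apply: contraNT e0 => cc0; apply/eqP.
  apply: idempotent_in_radical; first exact: ext_idem.
  by rewrite -[ext e](scalerK cc0); apply: sandwich_radicalZ.
rewrite -{3}[c']mulr1 -mulrBr mulf_eq0 subr_eq0 => /orP[/eqP c0|/eqP c1].
  left; apply: idempotent_in_radical => //.
  by move: Na; rewrite c0 scale0r subr0.
right; apply: idempotent_in_radical => //.
have -> : b = -1 *: (a - c' *: ext e).
  by rewrite c1 scale1r scaleN1r opprB eE addrC addKr.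
exact: sandwich_radicalZ.
Qed.

(** One of two mutually inverse maps between [ext e] and [ext f] would be radical by
    [lifted_corner_radical], and so would [ext e = a * b]. *)
Lemma lifted_nonconjugate (e f : A) : e * e = e -> f * f = f ->
  primitive_idempotent (red e) -> primitive_idempotent (red f) ->
  ~ conjugate (red e) (red f) -> ~ conjugate (ext e) (ext f).
Proof.
move=> ee ff pe pf ncef /(conjugate_iso (ext_idem ee))[a [b [ea af fb be [ab ba]]]].
have [d [y [d0 fy ye dy]]] := ext_corner fb be.
have Ny := lifted_corner_radical ee ff pe pf ncef fy ye.
have Nb : sandwich_radical b.
  rewrite -[b](scalerK (iota_neq0 d0)) dy.
  exact/sandwich_radicalZ/map_ma_radical.
have [_ e0 _] := lifted_primitive ee pe.
case/eqP: e0; apply: idempotent_in_radical; first exact: ext_idem.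
by rewrite -ab; apply: sandwich_radicalMl.
Qed.

Lemma pi_idempotent_eq0 (g : A) : g * g = g -> red g = 0 -> g = 0.
Proof.
move=> gg rg; apply: (pi_divides_eq0 sys) => n.
elim: n => [|n IHn]; first by exists g; rewrite expr0 scale1r.
by rewrite -gg -addn1; apply: pi_dividesM => //; apply/(red_eq0 sys).
Qed.

(** For lifts of [a0] and [b0] in the corners, [a * b = e * (1 - pi *: w)] is corrected to [e] by a
    unit. Then [f - b' * a] is an idempotent with zero reduction. *)
Lemma iso_lift (e f : A) : e * e = e -> f * f = f ->
  iso_idem (red e) (red f) -> iso_idem e f.
Proof.
move=> ee ff [a0 [b0 [ea af fb be [ab ba]]]].
have [a1 a1E] := map_ma_surj sys a0; have [b1 b1E] := map_ma_surj sys b0.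
pose a := e * a1 * f; pose b := f * b1 * e.
have ra : red a = a0 by rewrite !map_maM a1E ea af.
have rb : red b = b0 by rewrite !map_maM b1E fb be.
have e_a : e * a = a by rewrite /a !mulrA ee.
have a_f : a * f = a by rewrite /a -!mulrA ff.
have f_b : f * b = b by rewrite /b !mulrA ff.
have b_e : b * e = b by rewrite /b -!mulrA ee.
clearbody a b.
have /(red_eq0 sys)[w wE] : red (e - a * b) = 0.
  by rewrite map_maB map_maM ra rb ab subrr.
rewrite expr1 in wE.
have [v [uv vu]] := one_plus_pi_unit sys w.
have rv : red v = 1.
  have := congr1 red uv; rewrite map_maM map_maB map_maZ (residue_pi sys) scale0r subr0.
  by rewrite map_ma1 mul1r.
have abE : a * b = e * (1 - pi *: w).
  by rewrite -wE mulrBr mulr1 mulrBr ee mulrA e_a opprB addrC subrK.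
pose b' := b * v * e.
have ab' : a * b' = e by rewrite /b' !mulrA abE -[e * _ * v]mulrA uv mulr1 ee.
have fb' : f * b' = b' by rewrite /b' !mulrA f_b.
have b'e : b' * e = b' by rewrite /b' -!mulrA ee.
exists a, b'; split=> //; split=> //.
pose g := b' * a.
have fg : f * g = g by rewrite mulrA fb'.
have gf : g * f = g by rewrite -mulrA a_f.
have gg : g * g = g by rewrite /g mulrA -[b' * a * b']mulrA ab' b'e.
apply/esym/subr0_eq/pi_idempotent_eq0.
  by rewrite mulrBr !mulrBl ff fg gf gg subrr subr0.
by rewrite map_maB !map_maM ra rb rv mulr1 be ba subrr.
Qed.

End BasicIdempotent.

(** * Evaluation of path algebras *)

Section PathEvaluation.
Variables (K : comNzRingType) (A : algType K) (Q : quiver).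
Variables (ev : vertex Q -> A) (al : arrow Q -> A).
Implicit Types (x y : path_algebra K Q) (p q : qpath Q) (v w : vertex Q).

(** Arrows are listed in order of travel but composed from right to left, so the first arrow is the
    rightmost factor; the idempotent of the last vertex comes leftmost. *)
Fixpoint walk_value v (s : seq (arrow Q)) : A :=
  if s is a :: s' then walk_value (tgt a) s' * al a else ev v.

Definition path_value p : A := walk_value (psrc p) (parrows p).

Definition path_eval x : A := \sum_(p <- msupp x) x@_p *: path_value p.

Lemma path_evalw (D : {fset qpath Q}) x : (msupp x `<=` D)%fset ->
  path_eval x = \sum_(p <- D) x@_p *: path_value p.
Proof.
by move=> xD; apply: big_fset_incl => // p _ /mcoeff_outdom ->; rewrite scale0r.
Qed.

Lemma path_eval_pterm c p : path_eval (pterm c p) = c *: path_value p.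
Proof.
by rewrite (path_evalw (msupp_pterm c p)) big_seq_fset1 mcoeff_pterm eqxx.
Qed.

Lemma path_evalD x y : path_eval (x + y) = path_eval x + path_eval y.
Proof.
pose D := (msupp x `|` msupp y)%fset.
rewrite (@path_evalw D (x + y)) ?msuppD_le // (@path_evalw D x) ?fsubsetUl //.
rewrite (@path_evalw D y) ?fsubsetUr // -big_split /=.
by apply: eq_bigr => p _; rewrite mcoeffD scalerDl.
Qed.

Lemma path_eval0 : path_eval 0 = 0.
Proof. by apply: (addIr (path_eval 0)); rewrite -path_evalD !add0r. Qed.

Lemma path_evalN x : path_eval (- x) = - path_eval x.
Proof. by apply: (addIr (path_eval x)); rewrite -path_evalD !addNr path_eval0. Qed.

Lemma path_evalB x y : path_eval (x - y) = path_eval x - path_eval y.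
Proof. by rewrite path_evalD path_evalN. Qed.

Lemma path_eval_sum (I : Type) (s : seq I) (P : pred I) (x : I -> path_algebra K Q) :
  path_eval (\sum_(i <- s | P i) x i) = \sum_(i <- s | P i) path_eval (x i).
Proof. exact: (big_morph path_eval path_evalD path_eval0). Qed.

Lemma path_evalZ c x : path_eval (c *: x) = c *: path_eval x.
Proof.
rewrite (@path_evalw (msupp x) (c *: x)) ?msuppZ_le // scaler_sumr.
by apply: eq_bigr => p _; rewrite mcoeffZ scalerA.
Qed.

Hypothesis ev_idem : forall v, ev v * ev v = ev v.
Hypothesis ev_orth : forall v w, v != w -> ev v * ev w = 0.
Hypothesis al_src : forall a, al a * ev (src a) = al a.
Hypothesis al_tgt : forall a, ev (tgt a) * al a = al a.

Lemma walk_value_src v s : walk v s -> walk_value v s * ev v = walk_value v s.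
Proof.
case: s => [|a s] /=; first by rewrite ev_idem.
by case/andP => /eqP <- _; rewrite -mulrA al_src.
Qed.

Lemma walk_value_tgt v s : walk v s -> ev (walk_end v s) * walk_value v s = walk_value v s.
Proof.
elim: s v => [|a s IHs] v /=; first by rewrite ev_idem.
by case/andP => /eqP va ws; rewrite mulrA (IHs _ ws).
Qed.

Lemma walk_value_cat v s t : walk v (s ++ t) ->
  walk_value v (s ++ t) = walk_value (walk_end v s) t * walk_value v s.
Proof.
elim: s v => [|a s IHs] v /=; first by move/walk_value_src.
by case/andP => _ w; rewrite IHs // mulrA.
Qed.

Lemma path_value_empty v : path_value (empty_path v) = ev v.
Proof. by []. Qed.

Lemma path_value_arrow a : path_value (arrow_path a) = al a.
Proof. by rewrite /path_value /= al_tgt. Qed.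

Lemma path_evalM x y : path_eval (x * y) = path_eval x * path_eval y.
Proof.
elim/pa_ind: x => [|x x' IHx IHx'|c p].
- by rewrite mul0r path_eval0 mul0r.
- by rewrite mulrDl !path_evalD mulrDl IHx IHx'.
elim/pa_ind: y => [|y y' IHy IHy'|d q].
- by rewrite mulr0 path_eval0 mulr0.
- by rewrite mulrDr !path_evalD mulrDr IHy IHy'.
rewrite [in LHS]/GRing.mul /= pa_mulUU !path_eval_pterm -scalerAl -scalerAr scalerA.
case: pcompP => [r qp rs rt ra|qp] /=.
  rewrite path_eval_pterm; congr (_ *: _).
  rewrite /path_value ra rs walk_value_cat -/(ptgt q) ?qp //.
  by rewrite -ra -rs; apply: (valP r).
rewrite path_eval0 /path_value -(walk_value_src (valP p)) -(walk_value_tgt (valP q)).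
by rewrite -mulrA [ev _ * (_ * _)]mulrA ev_orth ?mul0r ?mulr0 ?scaler0 //; apply/eqP => E; case: qp.
Qed.

Lemma path_eval1 : path_eval 1 = \sum_v ev v.
Proof.
transitivity (path_eval (\sum_v pterm 1 (empty_path v))); first by [].
by rewrite path_eval_sum; apply: eq_bigr => v _; rewrite path_eval_pterm scale1r.
Qed.

Section Presentation.
Variables (I : ideal (path_algebra K Q)) (e : idem A).
Hypothesis eE : val e = \sum_v ev v.
Hypothesis ker : forall x, I x <-> path_eval x = 0.
Hypothesis surj : forall z, val e * z * val e = z -> exists x, path_eval x = z.

Lemma path_eval_corner x : val e * path_eval x * val e = path_eval x.
Proof. by rewrite eE -path_eval1 -!path_evalM mul1r mulr1. Qed.

Definition quot_eval (u : ring_quot I) : corner e :=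
  exist (corner_pred e) (path_eval (repr u)) (introT eqP (path_eval_corner (repr u))).

Lemma quot_evalE x : val (quot_eval (\pi x)) = path_eval x.
Proof. by apply/subr0_eq; rewrite -path_evalB; apply/ker/ring_quotK. Qed.

Lemma quot_eval_zmod : zmod_morphism quot_eval.
Proof.
elim/quotW=> x; elim/quotW=> y; apply: val_inj.
by rewrite -raddfB [LHS]quot_evalE path_evalB -!quot_evalE.
Qed.

Lemma quot_eval_monoid : monoid_morphism quot_eval.
Proof.
split; first by apply: val_inj; rewrite [LHS]quot_evalE path_eval1 -eE.
elim/quotW=> x; elim/quotW=> y; apply: val_inj.
have -> : \pi_(ring_quot I) x * \pi_(ring_quot I) y = \pi_(ring_quot I) (x * y).
  exact: esym (Defs.pi_mul I x y).
by rewrite [LHS]quot_evalE path_evalM -!quot_evalE.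
Qed.

HB.instance Definition _ :=
  GRing.isZmodMorphism.Build (ring_quot I) (corner e) quot_eval quot_eval_zmod.
HB.instance Definition _ :=
  GRing.isMonoidMorphism.Build (ring_quot I) (corner e) quot_eval quot_eval_monoid.

Lemma quot_eval_scalable : scalable quot_eval.
Proof.
move=> c; elim/quotW=> x; apply: val_inj.
have -> : c *: (\pi_(ring_quot I) x) = \pi_(ring_quot I) (c *: x).
  by rewrite [RHS]pi_scale.
by rewrite [LHS]quot_evalE path_evalZ -quot_evalE.
Qed.

Lemma quot_eval_bij : bijective quot_eval.
Proof.
have surj' (y : corner e) : exists x, path_eval x = val y.
  by apply: surj; apply/eqP/(valP y).
pose g (y : corner e) := \pi_(ring_quot I) (sval (cid (surj' y))).
exists g; last first.
  by move=> y; apply: val_inj; rewrite /g quot_evalE; case: cid.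
elim/quotW=> x; apply/ring_quotP/ker; apply/eqP.
rewrite path_evalB (svalP (cid (surj' (quot_eval (\pi x))))) quot_evalE.
by rewrite subrr.
Qed.

Lemma quot_eval_rmorphism : exists f : {rmorphism ring_quot I -> corner e},
  scalable f /\ bijective f.
Proof.
by exists quot_eval; split; [apply: quot_eval_scalable | apply: quot_eval_bij].
Qed.

End Presentation.
End PathEvaluation.

Section BaseChangeEval.
Variables (R S : comNzRingType) (h : {rmorphism R -> S}) (M : finMonoidType) (Q : quiver).

Lemma map_paZ c (x : path_algebra R Q) : map_pa h (c *: x) = h c *: map_pa h x.
Proof. by apply/malgP => q; rewrite mcoeffZ !mcoeff_map_pa mcoeffZ rmorphM. Qed.

Lemma map_paB (x y : path_algebra R Q) : map_pa h (x - y) = map_pa h x - map_pa h y.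
Proof. by apply/malgP => q; rewrite mcoeffB !mcoeff_map_pa mcoeffB rmorphB. Qed.

Variables (ev : vertex Q -> monoid_algebra M R) (al : arrow Q -> monoid_algebra M R).

Lemma map_path_eval (x : path_algebra R Q) :
  path_eval (fun v => map_ma h (ev v)) (fun a => map_ma h (al a)) (map_pa h x) =
  map_ma h (path_eval ev al x).
Proof.
elim/pa_ind: x => [|x y IHx IHy|c p].
- by rewrite map_pa0 !path_eval0 map_ma0.
- by rewrite map_paD !path_evalD map_maD IHx IHy.
rewrite map_pterm !path_eval_pterm map_maZ; congr (_ *: _).
rewrite /path_value; elim: (parrows p) (psrc p) => //= a s IHs v.
by rewrite IHs map_maM.
Qed.

End BaseChangeEval.

(** * Arrow ideals and admissible kernels *)

Section ArrowIdeal.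
Variables (K : fieldType) (Q : quiver).
Local Notation KQ := (path_algebra K Q).

Lemma arrow_ideal_arrow a : arrow_ideal (pterm 1 (arrow_path a) : KQ).
Proof. by move=> I _; apply; exists a. Qed.

Lemma pterm_cons (c : K) (p : qpath Q) a s : parrows p = a :: s ->
  exists2 p' : qpath Q, parrows p' = s &
    pterm c p = pterm c p' * pterm 1 (arrow_path a) :> KQ.
Proof.
case: p => [[v t] w] E; rewrite /parrows /= in E; subst t.
have /andP[/eqP va ws] := w; rewrite /= in va ws.
exists (exist _ (tgt a, s) ws) => //.
rewrite [in RHS]/GRing.mul /= pa_mulUU mulr1.
case: pcompP => [r _ rs _ ra|]; last by [].
congr (pterm _ _); apply: qpath_inj; first by rewrite rs /psrc /= va.
by rewrite ra.
Qed.

Definition vertex_part (x : KQ) : KQ := \sum_v pterm x@_(empty_path v) (empty_path v).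
Definition arrow_part (x : KQ) : KQ := \sum_a pterm x@_(arrow_path a) (arrow_path a).

Lemma vertex_partD x y : vertex_part (x + y) = vertex_part x + vertex_part y.
Proof. by rewrite -big_split; apply: eq_bigr => v _; rewrite mcoeffD ptermD. Qed.

Lemma arrow_partD x y : arrow_part (x + y) = arrow_part x + arrow_part y.
Proof. by rewrite -big_split; apply: eq_bigr => v _; rewrite mcoeffD ptermD. Qed.

Lemma vertex_part_pterm c p :
  vertex_part (pterm c p) = if parrows p is [::] then pterm c p else 0.
Proof.
case E : (parrows p) => [|a s].
  have pE : p = empty_path (psrc p) by apply: qpath_inj.
  rewrite {1}pE /vertex_part (bigD1 (psrc p)) //= mcoeff_pterm -pE eqxx big1 ?addr0 // => v vp.
  rewrite mcoeff_pterm; case: eqP => [pv|_]; last by rewrite pterm0.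
  by case/eqP: vp; rewrite pv.
rewrite /vertex_part big1 // => v _; rewrite mcoeff_pterm.
by case: eqP => [pv|_]; [rewrite pv in E | rewrite pterm0].
Qed.

Lemma arrow_part_pterm c p :
  arrow_part (pterm c p) = if size (parrows p) == 1%N then pterm c p else 0.
Proof.
case: ifP => [|p1].
  case E : (parrows p) => [|a [|b s]] // _.
  have pE : p = arrow_path a.
    apply: qpath_inj; rewrite // /psrc /=.
    case: p E => [[v t] w] E; rewrite /parrows /= in E; subst t.
    by have /andP[/eqP va _] := w.
  rewrite {1}pE /arrow_part (bigD1 a) //= mcoeff_pterm -pE eqxx big1 ?addr0 // => b ba.
  rewrite mcoeff_pterm; case: eqP => [pb|_]; last by rewrite pterm0.
  case/eqP: ba; have := congr1 (@parrows Q) pb; rewrite E.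
  by move=> [].
rewrite /arrow_part big1 // => a _; rewrite mcoeff_pterm.
by case: eqP => [pa|_]; [rewrite pa in p1 | rewrite pterm0].
Qed.

Lemma path_algebra_head (x : KQ) :
  ideal_pow (@arrow_ideal K Q) 2 (x - vertex_part x - arrow_part x).
Proof.
elim/pa_ind: x => [|x y IHx IHy|c p].
- rewrite /vertex_part /arrow_part !big1 ?subr0; first exact: ideal_pow0.
    by move=> a _; rewrite mcoeff0 pterm0.
  by move=> a _; rewrite mcoeff0 pterm0.
- have -> : x + y - vertex_part (x + y) - arrow_part (x + y) =
     (x - vertex_part x - arrow_part x) - - (y - vertex_part y - arrow_part y).
    rewrite vertex_partD arrow_partD opprK !opprD.
    by rewrite [RHS]addrACA [X in _ = X + _]addrACA.
  by apply: ideal_powB => //; apply: ideal_powN.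
rewrite vertex_part_pterm arrow_part_pterm.
case E : (parrows p) => [|a [|b s]] /=; rewrite ?subrr ?subr0 ?subrr; try exact: (ideal_pow0 _ 2).
have [p' p'E ->] := pterm_cons c E; have [p'' _ p''E] := pterm_cons c p'E.
exists [:: (pterm c p', pterm 1 (arrow_path a))]; rewrite ?big_seq1 // => u.
rewrite inE => /eqP-> /=; split; last exact: arrow_ideal_arrow.
exists [:: (pterm c p'', pterm 1 (arrow_path b))]; rewrite ?big_seq1 // => w.
by rewrite inE => /eqP-> /=; split=> //; apply: arrow_ideal_arrow.
Qed.

End ArrowIdeal.

Section Admissible.
Variables (K : fieldType) (M : finMonoidType) (Q : quiver).
Local Notation A := (monoid_algebra M K).
Local Notation KQ := (path_algebra K Q).
Variables (ev : vertex Q -> A) (al : arrow Q -> A).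
Hypothesis ev_idem : forall v, ev v * ev v = ev v.
Hypothesis ev_neq0 : forall v, ev v != 0.
Hypothesis ev_orth : forall v w, v != w -> ev v * ev w = 0.
Hypothesis al_src : forall a, al a * ev (src a) = al a.
Hypothesis al_tgt : forall a, ev (tgt a) * al a = al a.
Hypothesis al_radical : forall a, sandwich_radical (al a).
Hypothesis al_free : forall c : arrow Q -> K,
  radical_square (\sum_a c a *: al a) -> forall a, c a = 0.
Local Notation theta := (path_eval ev al).

Let thetaM := path_evalM ev_idem ev_orth al_src.

Lemma arrow_ideal_radical (x : KQ) : arrow_ideal x -> sandwich_radical (theta x).
Proof.
move=> Bx; apply: (Bx (fun x => sandwich_radical (theta x))).
  split; first split.
  - by rewrite path_eval0; apply: sandwich_radical0.
  - by move=> y z Ny Nz; rewrite path_evalD; apply: sandwich_radicalD.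
  - by move=> a y Ny; rewrite thetaM; apply: sandwich_radicalMl.
  by move=> a y Ny; rewrite thetaM; apply: sandwich_radicalMr.
by move=> _ [a ->]; rewrite path_eval_pterm scale1r path_value_arrow.
Qed.

Lemma arrow_ideal_pow_radical n (x : KQ) :
  ideal_pow (@arrow_ideal K Q) n x -> ideal_pow (@sandwich_radical M K) n (theta x).
Proof.
elim: n x => //= n IHn _ [s sP ->].
exists [seq (theta u.1, theta u.2) | u <- s].
  move=> _ /mapP[u /sP[u1 u2] ->] /=; split; first exact: IHn.
  exact: arrow_ideal_radical.
by rewrite path_eval_sum big_map; apply: eq_bigr => u _; rewrite thetaM.
Qed.

Lemma ideal_pow2_radical_square (x : A) :
  ideal_pow (@sandwich_radical M K) 2 x -> radical_square x.
Proof.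
move=> [s sP ->]; exists s => // u /sP[[t tP ->] u2]; split=> //.
elim: t tP => [|w t IHt] tP; first by rewrite big_nil; apply: sandwich_radical0.
rewrite big_cons; apply: sandwich_radicalD; last first.
  by apply: IHt => z zt; apply: tP; rewrite inE zt orbT.
by apply: sandwich_radicalMl; case: (tP w (mem_head _ _)).
Qed.

(** Modulo the squared arrow ideal, [x] is a combination of vertices and arrows. Its vertex part
    evaluates into the radical, where cutting by [ev v] would put a nonzero idempotent if a
    coefficient survived. The arrow part then evaluates into the squared radical, and [al_free]
    applies. *)
Lemma path_eval_kernel (x : KQ) : theta x = 0 -> ideal_pow (@arrow_ideal K Q) 2 x.
Proof.
move=> x0; have B2 := path_algebra_head x.
have N2 : radical_square (theta (x - vertex_part x - arrow_part x)).
  exact/ideal_pow2_radical_square/arrow_ideal_pow_radical.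
rewrite !path_evalB x0 sub0r in N2.
have vE : theta (vertex_part x) = \sum_v x@_(empty_path v) *: ev v.
  by rewrite path_eval_sum; apply: eq_bigr => v _; rewrite path_eval_pterm.
have aE : theta (arrow_part x) = \sum_a x@_(arrow_path a) *: al a.
  by rewrite path_eval_sum; apply: eq_bigr => a _; rewrite path_eval_pterm path_value_arrow.
have Na : sandwich_radical (theta (arrow_part x)).
  rewrite aE; elim/big_ind: _ => [|y z Ny Nz|a _]; first exact: sandwich_radical0.
    exact: sandwich_radicalD.
  exact: sandwich_radicalZ.
have Nv : sandwich_radical (theta (vertex_part x)).
  have -> : theta (vertex_part x) =
      -1 *: (- theta (vertex_part x) - theta (arrow_part x)) + -1 *: theta (arrow_part x).
    by rewrite -scalerDr addrNK scaleN1r opprK.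
  by apply: sandwich_radicalD; apply: sandwich_radicalZ => //; apply: radical_square_sub.
have cv v : x@_(empty_path v) = 0.
  apply/eqP; apply: contraT => c0; case/negP: (ev_neq0 v); apply/eqP.
  apply: idempotent_in_radical => //; rewrite -[ev v](scalerK c0).
  apply: sandwich_radicalZ.
  have -> : x@_(empty_path v) *: ev v = theta (vertex_part x) * ev v.
    rewrite vE mulr_suml (bigD1 v) //= -scalerAl ev_idem big1 ?addr0 // => w wv.
    by rewrite -scalerAl ev_orth // scaler0.
  exact: sandwich_radicalMr.
have v0 : vertex_part x = 0 by rewrite /vertex_part big1 // => v _; rewrite cv pterm0.
rewrite v0 path_eval0 oppr0 sub0r in N2.
have a0 : arrow_part x = 0.
  rewrite /arrow_part big1 // => a _; rewrite (al_free (c := fun a => x@_(arrow_path a))) ?pterm0 //.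
  rewrite -aE -[theta _]opprK -scaleN1r; exact: radical_squareZ.
by move: B2; rewrite v0 a0 !subr0.
Qed.

Lemma path_eval_admissible (I : ideal KQ) :
  (forall x, I x <-> theta x = 0) -> admissible I.
Proof.
move=> IP; have [e eP] := sandwich_radical_pow M K.
exists e.+2 => //; split=> x.
  move=> /arrow_ideal_pow_radical xe; apply/IP; apply: eP xe.
  by rewrite -addn2 leq_addr.
by move/IP/path_eval_kernel.
Qed.

End Admissible.

Section KernelIdeal.
Variables (R : comNzRingType) (A : algType R) (Q : quiver).
Variables (ev : vertex Q -> A) (al : arrow Q -> A).
Hypothesis ev_idem : forall v, ev v * ev v = ev v.
Hypothesis ev_orth : forall v w, v != w -> ev v * ev w = 0.
Hypothesis al_src : forall a, al a * ev (src a) = al a.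

Definition eval_ker (x : path_algebra R Q) : Prop := path_eval ev al x = 0.

Lemma eval_ker0 : eval_ker 0. Proof. exact: path_eval0. Qed.

Lemma eval_kerB x y : eval_ker x -> eval_ker y -> eval_ker (x - y).
Proof. by rewrite /eval_ker path_evalB => -> ->; rewrite subrr. Qed.

Lemma eval_kerMl a x : eval_ker x -> eval_ker (a * x).
Proof. by rewrite /eval_ker path_evalM // => ->; rewrite mulr0. Qed.

Lemma eval_kerMr a x : eval_ker x -> eval_ker (x * a).
Proof. by rewrite /eval_ker path_evalM // => ->; rewrite mul0r. Qed.

Definition eval_ideal : ideal (path_algebra R Q) :=
  @Ideal (path_algebra R Q) (ZSubgroup eval_ker0 eval_kerB) eval_kerMl eval_kerMr.

End KernelIdeal.

Section BalancedMaps.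
Variables (R S : comNzRingType) (h : {rmorphism R -> S}) (Q : quiver).
Variables (I : ideal (path_algebra R Q)) (V : zmodType) (beta : S -> path_algebra R Q -> V).
Hypothesis betaDl : forall c d x, I x -> beta (c + d) x = beta c x + beta d x.
Hypothesis betaDr : forall c x y, I x -> I y -> beta c (x + y) = beta c x + beta c y.

Lemma beta0r c : beta c 0 = 0.
Proof.
by apply: (addIr (beta c 0)); rewrite -betaDr ?addr0 ?add0r //; apply: zsub0.
Qed.

Lemma beta0l x : I x -> beta 0 x = 0.
Proof. by move=> Ix; apply: (addIr (beta 0 x)); rewrite -betaDl // addr0 add0r. Qed.

(** [beta] is additive on [I] only, so membership of the partial sums is carried along. *)
Lemma beta_sum c (T : eqType) (s : seq T) (x : T -> path_algebra R Q) :
  (forall i, i \in s -> I (x i)) ->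
  I (\sum_(i <- s) x i) /\ beta c (\sum_(i <- s) x i) = \sum_(i <- s) beta c (x i).
Proof.
elim: s => [|i s IHs] Is; first by rewrite !big_nil beta0r; split=> //; apply: zsub0.
have [|Is' E] := IHs; first by move=> j js; apply: Is; rewrite inE js orbT.
have Ii := Is i (mem_head _ _).
by rewrite !big_cons betaDr // E; split=> //; apply: idealD.
Qed.

End BalancedMaps.

(** * Base change of the evaluation kernel *)

Section BaseChangeKernel.
Variables (O : idomainType) (F k : fieldType).
Variables (iota : {rmorphism O -> F}) (rho : {rmorphism O -> k}).
Variables (p : nat) (pi : O).
Hypothesis sys : complete_system iota rho p pi.
Variables (M : finMonoidType) (Q : quiver).
Variables (ev : vertex Q -> monoid_algebra M O) (al : arrow Q -> monoid_algebra M O).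
Hypothesis ev_idem : forall v, ev v * ev v = ev v.
Hypothesis ev_orth : forall v w, v != w -> ev v * ev w = 0.
Hypothesis al_src : forall a, al a * ev (src a) = al a.
Local Notation OQ := (path_algebra O Q).
Local Notation theta := (path_eval ev al).
Local Notation I := (eval_ideal ev_idem ev_orth al_src).
Local Notation theta_of h :=
  (path_eval (fun v => map_ma h (ev v)) (fun a => map_ma h (al a))).

Lemma map_pa_sum (R S : comNzRingType) (h : {rmorphism R -> S}) (T : Type) (s : seq T)
    (x : T -> path_algebra R Q) :
  map_pa h (\sum_(i <- s) x i) = \sum_(i <- s) map_pa h (x i).
Proof.
by elim: s => [|i s IHs]; rewrite ?big_nil ?map_pa0 // !big_cons map_paD IHs.
Qed.

Lemma base_change_eval_ker (S : comNzRingType) (h : {rmorphism O -> S}) y :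
  base_change h I y -> theta_of h y = 0.
Proof.
move=> [s sI ->]; rewrite path_eval_sum big_seq big1 // => u /sI Iu.
by rewrite path_evalZ map_path_eval Iu map_ma0 scaler0.
Qed.

Lemma seq_denominator (T : eqType) (s : seq T) (c : T -> F) :
  exists d (a : T -> O), d != 0 /\ forall u, u \in s -> iota d * c u = iota (a u).
Proof.
suff [d [d0 dP]] : exists d, d != 0 /\ forall u, u \in s -> exists a, iota d * c u = iota a.
  exists d, (fun u => if pselect (exists a, iota d * c u = iota a) is left e
                      then sval (cid e) else 0); split=> // u /dP e.
  by case: pselect => // e'; case: cid.
elim: s => [|u s [d [d0 dP]]]; first by exists 1; rewrite oner_neq0.
have [a [b [b0 uE]]] := fractionP sys (c u).
have b0' := iota_neq0 sys b0.
exists (b * d); rewrite mulf_neq0 //; split=> // v; rewrite inE => /orP[/eqP->|/dP[a' aE]].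
  by exists (d * a); rewrite uE !rmorphM [iota b * _]mulrC -mulrA [iota b * _]mulrC mulfVK.
by exists (b * a'); rewrite !rmorphM -mulrA aE.
Qed.

Lemma pa_denominator (y : path_algebra F Q) :
  exists d (x : OQ), d != 0 /\ iota d *: y = map_pa iota x.
Proof.
have [d [a [d0 aE]]] := seq_denominator (msupp y) (fun q => y@_q).
exists d, (\sum_(q <- msupp y) pterm (a q) q); split=> //.
rewrite {1}[y]ptermE scaler_sumr map_pa_sum !big_seq; apply: eq_bigr => q qy.
by rewrite scale_pterm map_pterm aE.
Qed.

Lemma map_pa_iota_inj (x : OQ) : map_pa iota x = 0 -> x = 0.
Proof.
move=> x0; apply/malgP => q; apply: (fraction_inj sys).
by rewrite -mcoeff_map_pa x0 !mcoeff0 rmorph0.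
Qed.

Lemma base_change_fraction y : base_change iota I y <-> theta_of iota y = 0.
Proof.
split; first exact: base_change_eval_ker.
move=> y0; have [d [x [d0 dx]]] := pa_denominator y.
have dn0 := iota_neq0 sys d0.
exists [:: ((iota d)^-1, x)]; last by rewrite /natural_map big_seq1 /= -dx scalerA mulVf // scale1r.
move=> u; rewrite inE => /eqP-> /=; rewrite /eval_ker.
apply: (map_ma_inj (fraction_inj sys)).
by rewrite -map_path_eval -dx path_evalZ y0 scaler0 map_ma0.
Qed.

(** A common denominator gathers the tensor into [(iota d)^-1] tensored with one element of [I],
    which vanishes because OQ embeds in FQ. *)
Lemma natural_map_injective_fraction : natural_map_injective iota I.
Proof.
move=> s sI s0 V beta bDl bDr bM.
have [d [a [d0 aE]]] := seq_denominator s (fun u => u.1).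
have dn0 := iota_neq0 sys d0.
have Iau u : u \in s -> I (a u *: u.2) by move=> us; apply/idealZ/sI.
have [_ E] := beta_sum bDr (iota d)^-1 Iau.
transitivity (\sum_(u <- s) beta (iota d)^-1 (a u *: u.2)).
  rewrite !big_seq; apply: eq_bigr => u us; rewrite -bM; last exact: sI.
  by rewrite -aE // mulKf.
rewrite -E; suff -> : \sum_(u <- s) a u *: u.2 = 0 by apply: (beta0r bDr).
apply: map_pa_iota_inj; rewrite map_pa_sum.
transitivity (iota d *: natural_map iota s); last by rewrite s0 scaler0.
rewrite /natural_map scaler_sumr !big_seq; apply: eq_bigr => u us.
rewrite map_paZ -(aE u us); exact: esym (scalerA _ _ _).
Qed.

Lemma map_pa_surj (y : path_algebra k Q) : exists x : OQ, map_pa rho x = y.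
Proof.
elim/pa_ind: y => [|_ _ [x <-] [x' <-]|c q].
- by exists 0; rewrite map_pa0.
- by exists (x + x'); rewrite map_paD.
by have [a <-] := residue_surj sys c; exists (pterm a q); rewrite map_pterm.
Qed.

Lemma map_pa_ker (x : OQ) : map_pa rho x = 0 -> exists y, x = pi *: y.
Proof.
move=> x0.
have xq q : exists b, x@_q = pi * b.
  by apply: (residue_eq0 sys); rewrite -mcoeff_map_pa x0 mcoeff0.
pose b q := sval (cid (xq q)).
exists (\sum_(q <- msupp x) pterm (b q) q).
rewrite {1}[x]ptermE scaler_sumr; apply: eq_bigr => q _.
by rewrite scale_pterm /b; case: cid => c /= ->.
Qed.

Lemma eval_ideal_pure (y : OQ) : I (pi *: y) -> I y.
Proof.
rewrite /= /eval_ker path_evalZ => y0; apply: (scale_uniformizer_inj sys).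
rewrite scaler0; exact: y0.
Qed.

(** Lifted coefficients gather the tensor into 1 tensored with an element of [I] with zero
    reduction. That element is [pi *: y] with [y] in [I] by purity, and [pi] vanishes when moved
    across the tensor sign. *)
Lemma natural_map_injective_residue : natural_map_injective rho I.
Proof.
move=> s sI s0 V beta bDl bDr bM.
pose a (u : k * OQ) := sval (cid (residue_surj sys u.1)).
have aE u : rho (a u) = u.1 by rewrite /a; case: cid.
have Iau u : u \in s -> I (a u *: u.2) by move=> us; apply/idealZ/sI.
have [IX E] := beta_sum bDr 1 Iau.
transitivity (\sum_(u <- s) beta 1 (a u *: u.2)).
  rewrite !big_seq; apply: eq_bigr => u us; rewrite -bM; last exact: sI.
  by rewrite aE mul1r.
rewrite -E; have [|y yE] := @map_pa_ker (\sum_(u <- s) a u *: u.2).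
  rewrite map_pa_sum -[RHS]s0 /natural_map; apply: eq_bigr => u _.
  by rewrite map_paZ aE.
rewrite yE in IX *; have Iy := eval_ideal_pure IX.
by rewrite -bM // (residue_pi sys) mulr0 (beta0l bDl).
Qed.

Variable te : monoid_algebra M O.
Hypothesis te_idem : te * te = te.
Hypothesis theta_corner : forall x, te * theta x * te = theta x.
Hypothesis theta_surj : forall z, te * z * te = z -> exists x, theta x = z.

(** A lift [x] of [y] evaluates to some [pi *: z], and surjectivity gives [z = theta w]; so
    [x - pi *: w] is a lift of [y] in [I]. *)
Lemma base_change_residue y : base_change rho I y <-> theta_of rho y = 0.
Proof.
split; first exact: base_change_eval_ker.
move=> y0; have [x xE] := map_pa_surj y.
have /(red_eq0 sys)[z] : map_ma rho (theta x) = 0 by rewrite -map_path_eval xE.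
rewrite expr1 => zE.
have [w wE] : exists w, theta w = z.
  apply: theta_surj; apply: (scale_uniformizer_inj sys).
  by rewrite scalerAl scalerAr -zE theta_corner.
exists [:: (1, x - pi *: w)].
  move=> u; rewrite inE => /eqP-> /=.
  by rewrite /eval_ker path_evalB path_evalZ wE zE subrr.
rewrite /natural_map big_seq1 /= scale1r map_paB map_paZ xE (residue_pi sys).
by rewrite scale0r subr0.
Qed.

End BaseChangeKernel.

(** * Freeness and surjectivity lifted from the residue field *)

Section LiftGenerators.
Variables (O : idomainType) (F k : fieldType).
Variables (iota : {rmorphism O -> F}) (rho : {rmorphism O -> k}).
Variables (p : nat) (pi : O).
Hypothesis sys : complete_system iota rho p pi.
Hypothesis p_prime : prime p.
Variable M : finMonoidType.
Hypothesis nonmod : ~ modular M p.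
Local Notation A := (monoid_algebra M O).
Local Notation red := (@map_ma M O k rho).
Local Notation ext := (@map_ma M O F iota).

Lemma radical_denominator (x : monoid_algebra M F) : sandwich_radical x ->
  exists d y, [/\ d != 0, sandwich_radical y & iota d *: x = ext y].
Proof.
move=> Nx; have [d [y [d0 dy]]] := clear_denominator sys x.
exists d, y; split=> //; apply: (ext_radical sys); rewrite -dy.
exact: sandwich_radicalZ.
Qed.

Lemma radical_square_denominator (x : monoid_algebra M F) : radical_square x ->
  exists d y, [/\ d != 0, radical_square y & iota d *: x = ext y].
Proof.
elim/radical_square_ind => [|a b [d [y [d0 y2 dy]]] [d' [y' [d0' y2' dy']]]|a b].
- by exists 1, 0; rewrite oner_neq0 scaler0 map_ma0; split=> //; apply: radical_square0.
- exists (d * d'), (d' *: y + d *: y'); rewrite mulf_neq0 //; split=> //.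
    by apply: radical_squareD; apply: radical_squareZ.
  rewrite map_maD !map_maZ -dy -dy' !scalerA scalerDr rmorphM.
  by rewrite [iota d' * _]mulrC.
move=> /radical_denominator[d [y [d0 Ny dy]]] /radical_denominator[d' [y' [d0' Ny' dy']]].
exists (d * d'), (y * y'); rewrite mulf_neq0 //; split=> //.
  exact: radical_square_mul.
by rewrite map_maM -dy -dy' -scalerAl -scalerAr scalerA rmorphM.
Qed.

Section Free.
Variables (I : finType) (al : I -> A).
Hypothesis red_free : forall c : I -> k,
  radical_square (\sum_i c i *: red (al i)) -> forall i, c i = 0.

Lemma lift_free_step (b : I -> O) : radical_square (\sum_i b i *: al i) ->
  exists b', (forall i, b i = pi * b' i) /\ radical_square (\sum_i b' i *: al i).
Proof.
move=> b2; have rb i : exists c, b i = pi * c.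
  apply: (residue_eq0 sys); apply: (red_free (c := fun i => rho (b i))).
  rewrite (_ : \sum_i _ = red (\sum_i b i *: al i)); first exact: map_radical_square.
  by rewrite map_ma_sum; apply: eq_bigr => j _; rewrite map_maZ.
pose b' i := sval (cid (rb i)); have b'E i : b i = pi * b' i := svalP (cid (rb i)).
exists b'; split=> //; apply: (radical_square_pure sys p_prime nonmod).
rewrite scaler_sumr; under eq_bigr => i _ do rewrite scalerA -b'E.
exact: b2.
Qed.

(** Reduction makes the coefficients divisible by [pi], and purity of the squared radical lets the
    relation be divided by [pi]; this can be repeated forever. *)
Lemma lift_free (b : I -> O) : radical_square (\sum_i b i *: al i) -> forall i, b i = 0.
Proof.
move=> b2 i; apply: (separated sys) => n.
elim: n b b2 => [|n IHn] b b2; first by exists (b i); rewrite mulr1.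
have [b' [b'E /IHn[c cE]]] := lift_free_step b2.
by exists c; rewrite b'E cE exprS mulrCA.
Qed.

Lemma fraction_free (c : I -> F) :
  radical_square (\sum_i c i *: ext (al i)) -> forall i, c i = 0.
Proof.
move=> c2 i; have [d [b [d0 db]]] := common_denominator sys c.
have [d' [y [d0' y2 dy]]] := radical_square_denominator c2.
have bE : \sum_i (d' * b i) *: al i = d *: y.
  apply: (map_ma_inj (fraction_inj sys)).
  rewrite map_maZ -dy scalerA mulrC -scalerA map_ma_sum scaler_sumr scaler_sumr.
  by apply: eq_bigr => j _; rewrite map_maZ rmorphM -db !scalerA mulrA.
have /(lift_free (b := fun i => d' * b i))/(_ i)/eqP : radical_square (\sum_i (d' * b i) *: al i).
  by rewrite bE; apply: radical_squareZ.
rewrite mulf_eq0 (negbTE d0') => /eqP bi0.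
have := db i; rewrite bi0 rmorph0 => /eqP; rewrite mulf_eq0.
by rewrite (negbTE (iota_neq0 sys d0)) => /eqP.
Qed.

End Free.

Section Surjectivity.
Variables (Q : quiver) (ev : vertex Q -> A) (al : arrow Q -> A) (te : A).
Hypothesis te_idem : te * te = te.
Local Notation theta := (path_eval ev al).
Local Notation theta_red :=
  (path_eval (fun v => red (ev v)) (fun a => red (al a))).
Hypothesis theta_corner : forall x, te * theta x * te = theta x.
Hypothesis red_surj : forall z, red te * z * red te = z -> exists x, theta_red x = z.

(* Modulo pi, the elements te m te are values of theta; they are values of theta because
   the matrix 1 - pi W expressing the difference is invertible. *)
Lemma path_eval_surj (z : A) : te * z * te = z -> exists x, theta x = z.
Proof.
pose g m := te * madelta O m * te.
have gX m : exists X w, g m - theta X = pi *: w.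
  have [|y yE] := @red_surj (red (g m)).
    by rewrite -!map_maM /g !mulrA te_idem -!mulrA te_idem.
  have [X XE] := map_pa_surj sys y.
  have /(red_eq0 sys)[w wE] : red (g m - theta X) = 0.
    by rewrite map_maB -map_path_eval XE yE subrr.
  by exists X, w; rewrite wE expr1.
pose X m := sval (cid (gX m)); pose w m := sval (cid (svalP (cid (gX m)))).
have wE m : g m - theta (X m) = pi *: w m := svalP (cid (svalP (cid (gX m)))).
have expand (x : A) : te * x * te = \sum_m x m *: g m.
  rewrite {1}[x]ma_expand mulr_sumr mulr_suml; apply: eq_bigr => m _.
  by rewrite -scalerAr -scalerAl.
have wg m : w m = \sum_m' w m m' *: g m'.
  rewrite -expand; apply: (scale_uniformizer_inj sys); rewrite scalerAl scalerAr -wE.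
  by rewrite mulrBr mulrBl theta_corner /g !mulrA te_idem -!mulrA te_idem.
pose W : 'M[O]_#|M| := \matrix_(i, j) w (enum_val i) (enum_val j).
pose U := 1%:M - pi *: W.
have Uu : U \in unitmx.
  rewrite unitmxE; apply: (residue_unit sys).
  rewrite -det_map_mx /U map_mxB map_mxZ (residue_pi sys) scale0r subr0.
  by rewrite map_mx1 det1 oner_neq0.
pose Y i := \sum_l invmx U i l *: X (enum_val l).
have gY m : theta (Y (enum_rank m)) = g m.
  have gU l : theta (X (enum_val l)) = \sum_j U l j *: g (enum_val j).
    have -> : theta (X (enum_val l)) = g (enum_val l) - pi *: w (enum_val l).
      by rewrite -wE opprB addrC subrK.
    rewrite wg scaler_sumr (reindex (@enum_val _ (mem M))) /=; last first.
      by apply: onW_bij; apply: enum_val_bij.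
    under [RHS]eq_bigr => j _ do rewrite !mxE scalerBl.
    rewrite sumrB; congr (_ - _).
      rewrite (bigD1 l) //= eqxx scale1r big1 ?addr0 // => j jl.
      by rewrite eq_sym (negbTE jl) scale0r.
    by apply: eq_bigr => j _; rewrite scalerA.
  rewrite path_eval_sum; under eq_bigr => l _ do rewrite path_evalZ gU scaler_sumr.
  rewrite exchange_big /=.
  transitivity (\sum_j (invmx U *m U) (enum_rank m) j *: g (enum_val j)).
    apply: eq_bigr => j _; rewrite mxE scaler_suml.
    by apply: eq_bigr => l _; rewrite scalerA.
  rewrite mulVmx // (bigD1 (enum_rank m)) //= mxE eqxx scale1r enum_rankK.
  rewrite big1 ?addr0 // => j jm; rewrite mxE eq_sym (negbTE jm) scale0r //.
move=> zE; exists (\sum_m z m *: Y (enum_rank m)).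
rewrite path_eval_sum -[RHS]zE expand; apply: eq_bigr => m _.
by rewrite path_evalZ gY.
Qed.

End Surjectivity.
End LiftGenerators.

(** * The quiver of kM *)

Section RadicalPowers.
Variables (M : finMonoidType) (K : comNzRingType).
Local Notation A := (monoid_algebra M K).
Local Notation Npow := (ideal_pow (@sandwich_radical M K)).

Lemma radical_pow_add n (x y : A) : Npow n x -> Npow n y -> Npow n (x + y).
Proof. by move=> xn yn; rewrite -[y]opprK; apply/ideal_powB/ideal_powN. Qed.

Lemma radical_pow_mulr n (x y : A) : Npow n x -> sandwich_radical y -> Npow n.+1 (x * y).
Proof.
by move=> xn Ny; exists [:: (x, y)]; rewrite ?big_seq1 // => u; rewrite inE => /eqP->.
Qed.

Lemma radical_pow_mull n (x y : A) : sandwich_radical x -> Npow n y -> Npow n.+1 (x * y).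
Proof.
elim: n x y => [|n IHn] x y Nx yn.
  by rewrite -[_ * _]mul1r; apply: (@radical_pow_mulr 0) => //; apply: sandwich_radicalMr.
case: yn => s sP ->; rewrite mulr_sumr big_seq.
elim/big_ind: _ => [|a b|u /sP[u1 u2]]; first exact: ideal_pow0.
  exact: radical_pow_add.
by rewrite mulrA; apply: radical_pow_mulr => //; apply: IHn.
Qed.

End RadicalPowers.

Section ResidueSide.
Variables (M : finMonoidType) (K : fieldType).
Local Notation A := (monoid_algebra M K).
Hypothesis GK : forall f : midem M, #|{: maxgroup f}|%:R != 0 :> K.
Hypothesis splitK : splitting_field A.
Variables (s t : nat) (ts : (t <= s)%N) (eps : 'I_s -> A).
Hypothesis eps_sum : \sum_i eps i = 1.
Hypothesis eps_prim : forall i, primitive_idempotent (eps i).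
Hypothesis eps_orth : forall i j, i != j -> eps i * eps j = 0.
Hypothesis eps_nonconj : forall i j : 'I_s, (i < t)%N -> (j < t)%N -> i != j ->
  ~ conjugate (eps i) (eps j).
Hypothesis eps_all : forall x, primitive_idempotent x ->
  exists2 i : 'I_s, (i < t)%N & conjugate (eps i) x.

Definition basic_vertex (v : 'I_t) : A := eps (widen_ord ts v).
Local Notation ev := basic_vertex.
Local Notation e := (\sum_(v < t) ev v).

Lemma basic_vertex_prim v : primitive_idempotent (ev v). Proof. exact: eps_prim. Qed.

Lemma basic_vertex_idem v : ev v * ev v = ev v. Proof. by have [] := basic_vertex_prim v. Qed.

Lemma basic_vertex_orth v w : v != w -> ev v * ev w = 0.
Proof. by move=> vw; apply: eps_orth; rewrite -val_eqE. Qed.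

Lemma basic_vertex_nonconj v w : v != w -> ~ conjugate (ev v) (ev w).
Proof. by move=> vw; apply: eps_nonconj; rewrite //= -val_eqE. Qed.

Lemma basic_vertex_suml v : ev v * e = ev v.
Proof.
rewrite mulr_sumr (bigD1 v) //= basic_vertex_idem big1 ?addr0 // => w wv.
by rewrite basic_vertex_orth // eq_sym.
Qed.

Lemma basic_vertex_sumr v : e * ev v = ev v.
Proof.
rewrite mulr_suml (bigD1 v) //= basic_vertex_idem big1 ?addr0 // => w wv.
by rewrite basic_vertex_orth.
Qed.

Lemma basic_sum_idem : e * e = e.
Proof. by rewrite {1}mulr_suml; apply: eq_bigr => v _; rewrite basic_vertex_suml. Qed.

Definition peirce_spec (vw : 'I_t * 'I_t) (x : A) : Prop :=
  [/\ ev vw.2 * x = x, x * ev vw.1 = x & sandwich_radical x].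

Lemma peirce_exists vw : exists U : {vspace A}, forall x, x \in U <-> peirce_spec vw x.
Proof.
apply: vspace_of_pred; first by split; rewrite ?mulr0 ?mul0r //; apply: sandwich_radical0.
move=> c x y [wx xv Nx] [wy yv Ny]; split.
- by rewrite mulrDr -scalerAr wx wy.
- by rewrite mulrDl -scalerAl xv yv.
by apply: sandwich_radicalD => //; apply: sandwich_radicalZ.
Qed.

Definition peirce vw : {vspace A} := sval (cid (peirce_exists vw)).

Lemma peirceP vw x : x \in peirce vw <-> peirce_spec vw x.
Proof. exact: svalP (cid (peirce_exists vw)) x. Qed.

Lemma square_exists : exists U : {vspace A}, forall x, x \in U <-> radical_square x.
Proof.
apply: vspace_of_pred; first exact: radical_square0.
by move=> c x y x2 y2; apply: radical_squareD => //; apply: radical_squareZ.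
Qed.

Definition square_space : {vspace A} := sval (cid square_exists).

Lemma square_spaceP x : x \in square_space <-> radical_square x.
Proof. exact: svalP (cid square_exists) x. Qed.

(** A complement in e_w N e_v of its intersection with N^2: its dimension is the number of arrows
    from v to w in the Gabriel quiver. *)
Definition arrow_space vw := (peirce vw :\: square_space)%VS.

Definition basic_quiver : quiver :=
  @Quiver 'I_t {vw : 'I_t * 'I_t & 'I_(\dim (arrow_space vw))}
    (fun a => (tag a).1) (fun a => (tag a).2).
Local Notation Q := basic_quiver.

Definition arrow_elt (a : arrow Q) : A := (vbasis (arrow_space (tag a)))`_(tagged a).
Local Notation al := arrow_elt.

Lemma arrow_elt_spec (a : arrow Q) : peirce_spec (tag a) (al a).
Proof.
apply/peirceP; apply: (subvP (diffvSl _ square_space)); apply: vbasis_mem.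
by apply: mem_nth; rewrite size_tuple.
Qed.

Lemma arrow_elt_src (a : arrow Q) : al a * ev (src a) = al a.
Proof. by have [] := arrow_elt_spec a. Qed.

Lemma arrow_elt_tgt (a : arrow Q) : ev (tgt a) * al a = al a.
Proof. by have [] := arrow_elt_spec a. Qed.

Lemma arrow_elt_radical (a : arrow Q) : sandwich_radical (al a).
Proof. by have [] := arrow_elt_spec a. Qed.

Definition arrow_of vw (i : 'I_(\dim (arrow_space vw))) : arrow Q :=
  Tagged (fun vw => 'I_(\dim (arrow_space vw))) i.

Lemma arrow_sum (c : arrow Q -> K) : \sum_a c a *: al a =
  \sum_vw \sum_i c (@arrow_of vw i) *: (vbasis (arrow_space vw))`_i.
Proof.
rewrite (sig_big_dep _ (fun _ _ => true)
  (fun vw i => c (@arrow_of vw i) *: (vbasis (arrow_space vw))`_i)) /=.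
by apply: eq_bigr => -[vw i] _.
Qed.

Lemma arrow_elt_free (c : arrow Q -> K) : radical_square (\sum_a c a *: al a) -> forall a, c a = 0.
Proof.
move=> c2 [vw i]; pose y := \sum_i c (@arrow_of vw i) *: (vbasis (arrow_space vw))`_i.
(* Cutting by vertex idempotents isolates one Peirce component and keeps it in the squared radical,
   which meets [arrow_space vw] only in 0. *)
have yE : y = ev vw.2 * (\sum_a c a *: al a) * ev vw.1.
  rewrite arrow_sum mulr_sumr mulr_suml (bigD1 vw) //= [X in _ + X]big1 ?addr0.
    rewrite mulr_sumr mulr_suml; apply: eq_bigr => j _.
    have [tj sj _] := arrow_elt_spec (@arrow_of vw j).
    by rewrite -scalerAr -scalerAl tj sj.
  move=> vw' ne; rewrite mulr_sumr mulr_suml big1 // => j _.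
  have [tj sj _] := arrow_elt_spec (@arrow_of vw' j).
  rewrite -scalerAr -scalerAl -[_`_j]tj -[X in _ * (_ * X)]sj !mulrA /=.
  have [E2|ne2] := eqVneq vw'.2 vw.2; last by rewrite basic_vertex_orth ?mul0r ?scaler0 // eq_sym.
  have [E1|ne1] := eqVneq vw'.1 vw.1; last by rewrite -mulrA (basic_vertex_orth ne1) mulr0 scaler0.
  by case/eqP: ne; rewrite [vw']surjective_pairing [vw]surjective_pairing E1 E2.
have yU : y \in arrow_space vw.
  apply: memv_suml => j _; apply/memvZ/vbasis_mem/mem_nth.
  by rewrite size_tuple.
have yW : y \in square_space.
  by apply/square_spaceP; rewrite yE; apply/radical_squareMr/radical_squareMl.
have y0 : y = 0.
  apply/eqP; rewrite -memv0 -(capv_diff (peirce vw) square_space).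
  by rewrite memv_cap yU yW.
have /freeP := basis_free (vbasisP (arrow_space vw)).
exact: (fun H => H (fun i => c (@arrow_of vw i)) y0 i).
Qed.

Lemma peirce_generated vw x : peirce_spec vw x ->
  exists c : 'I_(\dim (arrow_space vw)) -> K,
    radical_square (x - \sum_i c i *: al (@arrow_of vw i)).
Proof.
move/peirceP; rewrite -(addv_diff_cap (peirce vw) square_space).
move=> /memv_addP[u uU [w]]; rewrite memv_cap => /andP[_ /square_spaceP w2] ->.
exists (fun i => coord (vbasis (arrow_space vw)) i u).
set S := (X in _ - X); have -> : S = u by rewrite [RHS](coord_vbasis uU).
by rewrite addrAC subrr add0r.
Qed.

Local Notation theta := (@path_eval K A Q ev al).
Let theta_mul := @path_evalM K A Q ev al basic_vertex_idem basic_vertex_orth arrow_elt_src.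

Lemma corner_expand y : e * y * e = \sum_vw ev vw.2 * y * ev vw.1.
Proof.
rewrite mulr_suml mulr_suml; under eq_bigr => w _ do rewrite mulr_sumr.
by rewrite exchange_big pair_big.
Qed.

Lemma radical_corner_generated y : sandwich_radical y -> e * y * e = y ->
  exists c : arrow Q -> K, radical_square (y - \sum_a c a *: al a).
Proof.
move=> Ny ey.
have cP vw : exists c : 'I_(\dim (arrow_space vw)) -> K,
    radical_square (ev vw.2 * y * ev vw.1 - \sum_i c i *: al (@arrow_of vw i)).
  apply: peirce_generated; split; first by rewrite !mulrA basic_vertex_idem.
    by rewrite -!mulrA basic_vertex_idem.
  exact: sandwich_radicalM.
pose c vw := sval (cid (cP vw)).
exists (fun a => c (tag a) (tagged a)); rewrite arrow_sum -{1}ey corner_expand -sumrB.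
by apply: radical_square_sum => vw _; apply: (svalP (cid (cP vw))).
Qed.

(** The approximating value must itself be radical, so that for a product the error term
    [theta a * (y - theta b)] gains a power of the radical. *)
Definition approximable n y := exists x,
  sandwich_radical (theta x) /\ ideal_pow (@sandwich_radical M K) n (y - theta x).

Lemma approximableD n x y : approximable n x -> approximable n y -> approximable n (x + y).
Proof.
move=> [a [Na xa]] [b [Nb yb]]; exists (a + b); rewrite path_evalD; split.
  exact: sandwich_radicalD.
by rewrite opprD addrACA; apply: radical_pow_add.
Qed.

Lemma approximable_sum n (I : Type) (r : seq I) (x : I -> A) :
  (forall i, approximable n (x i)) -> approximable n (\sum_(i <- r) x i).
Proof.
move=> xn; elim/big_ind: _ => //; last exact: approximableD.
exists 0; rewrite path_eval0 subrr; split; first exact: sandwich_radical0.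
exact: ideal_pow0.
Qed.

Lemma approximable_mul n x y : sandwich_radical x -> sandwich_radical y ->
  approximable n x -> approximable n y -> approximable n.+1 (x * y).
Proof.
move=> Nx Ny [a [Na xa]] [b [Nb yb]]; exists (a * b); rewrite theta_mul.
split; first exact: sandwich_radicalMl.
have -> : x * y - theta a * theta b = (x - theta a) * y + theta a * (y - theta b).
  by rewrite mulrBl mulrBr addrA subrK.
by apply: radical_pow_add; [apply: radical_pow_mulr | apply: radical_pow_mull].
Qed.

(* Every primitive summand of 1 is isomorphic to one of e, hence kM e kM = kM. *)
Lemma one_through_e : exists a b : 'I_s -> A, \sum_i a i * e * b i = 1.
Proof.
have ab i : exists ab : A * A, ab.1 * e * ab.2 = eps i.
  have [j jt ji] := eps_all (eps_prim i).
  have [[jj _ _] [ii _ _]] := (eps_prim j, eps_prim i).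
  have [a [b [ja ai ib bj [Eab Eba]]]] := conjugate_iso jj ji.
  exists (b, a) => /=; pose v : 'I_t := Ordinal jt.
  have jv : eps j = ev v by congr eps; apply: val_inj.
  by rewrite -bj jv -[_ * ev v * e]mulrA basic_vertex_suml -jv bj Eba.
exists (fun i => (sval (cid (ab i))).1), (fun i => (sval (cid (ab i))).2).
by rewrite -eps_sum; apply: eq_bigr => i _; apply: (svalP (cid (ab i))).
Qed.

(** Arrows suffice modulo N^2. As 1 factors through [e], an element of e N^2 e is a sum of products
    of two elements of eNe; approximations of the factors modulo N^n yield one of the product modulo
    N^(n+1). *)
Lemma radical_approximable n y : sandwich_radical y -> e * y * e = y -> approximable n y.
Proof.
elim: n y => [|n IHn] y Ny ey.
  by exists 0; rewrite path_eval0; split=> //; apply: sandwich_radical0.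
have [c c2] := radical_corner_generated Ny ey.
have cE : theta (\sum_a c a *: pterm 1 (arrow_path a)) = \sum_a c a *: al a.
  rewrite path_eval_sum; apply: eq_bigr => a _.
  by rewrite path_evalZ path_eval_pterm scale1r path_value_arrow // => b; apply: arrow_elt_tgt.
have ec : e * (\sum_a c a *: al a) * e = \sum_a c a *: al a.
  rewrite [e * _]mulr_sumr [LHS]mulr_suml; apply: eq_bigr => a _.
  by rewrite -scalerAr -scalerAl -(arrow_elt_tgt a) mulrA basic_vertex_sumr -(arrow_elt_src a) -!mulrA basic_vertex_suml.
have [a [b ab1]] := one_through_e.
have sq q : radical_square q -> approximable n.+1 (e * q * e).
  elim/radical_square_ind => [|x z Ix Iz|x z Nx Nz].
  - rewrite mulr0 mul0r; exists 0; rewrite path_eval0 subrr.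
    by split; [apply: sandwich_radical0 | apply: ideal_pow0].
  - by rewrite mulrDr mulrDl; apply: approximableD.
  have -> : e * (x * z) * e = \sum_i (e * x * a i * e) * (e * b i * z * e).
    transitivity (e * x * (\sum_i a i * e * b i) * (z * e)).
      by rewrite ab1 mulr1 !mulrA.
    rewrite [e * x * _]mulr_sumr [LHS]mulr_suml; apply: eq_bigr => i _.
    rewrite !mulrA; congr (_ * _ * _ * _).
    by rewrite -[RHS]mulrA basic_sum_idem.
  apply: approximable_sum => i; apply: approximable_mul.
  - by rewrite -!mulrA mulrA; apply: sandwich_radicalMr; apply: sandwich_radicalMl.
  - by apply: sandwich_radicalM.
  - apply: IHn; last by rewrite !mulrA basic_sum_idem -!mulrA basic_sum_idem.
    by rewrite -!mulrA mulrA; apply: sandwich_radicalMr; apply: sandwich_radicalMl.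
  apply: IHn; last by rewrite !mulrA basic_sum_idem -!mulrA basic_sum_idem.
  by apply: sandwich_radicalM.
have -> : y = \sum_a c a *: al a + e * (y - \sum_a c a *: al a) * e.
  by rewrite mulrBr mulrBl ey ec addrC subrK.
apply: approximableD; last exact: sq.
exists (\sum_a c a *: pterm 1 (arrow_path a)); rewrite cE subrr; split.
  elim/big_ind: _ => [|x z|i _]; [exact: sandwich_radical0 | exact: sandwich_radicalD |].
  by apply: sandwich_radicalZ; apply: arrow_elt_radical.
exact: ideal_pow0.
Qed.

(** Scalars from the splitting field remove the part of [y] at the vertices; corners between
    distinct vertices are radical. The remainder is approximated modulo a vanishing power of the
    radical, hence attained. *)
Lemma basic_path_eval_surj y : e * y * e = y -> exists x, theta x = y.
Proof.
move=> ey.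
have cP v : exists c : K, sandwich_radical (ev v * y * ev v - c *: ev v).
  apply: (splitting_corner GK splitK (basic_vertex_prim v)).
    by rewrite !mulrA basic_vertex_idem.
  by rewrite -!mulrA basic_vertex_idem.
pose c v := sval (cid (cP v)).
have cN v : sandwich_radical (ev v * y * ev v - c v *: ev v) := svalP (cid (cP v)).
pose d := \sum_v c v *: ev v.
have Nyd : sandwich_radical (y - d).
  have -> : y - d = \sum_vw (ev vw.2 * y * ev vw.1 - (if vw.1 == vw.2 then c vw.1 *: ev vw.1 else 0)).
    rewrite sumrB -corner_expand ey; congr (_ - _).
    rewrite -(pair_big xpredT xpredT (fun v w => if v == w then c v *: ev v else 0)) /=.
    apply: eq_bigr => v _; rewrite (bigD1 v) //= eqxx big1 ?addr0 // => w wv.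
    by rewrite eq_sym (negbTE wv).
  elim/big_ind: _ => [|x z|[v w] _]; [exact: sandwich_radical0 | exact: sandwich_radicalD |].
  rewrite /=; have [->|vw] := eqVneq v w; first exact: cN.
  rewrite subr0; apply: (primitive_corner_radical GK (basic_vertex_prim v) (basic_vertex_prim w) (basic_vertex_nonconj vw)).
    by rewrite !mulrA basic_vertex_idem.
  by rewrite -!mulrA basic_vertex_idem.
have ed : e * d * e = d.
  rewrite [e * _]mulr_sumr [LHS]mulr_suml; apply: eq_bigr => v _.
  by rewrite -scalerAr -scalerAl basic_vertex_sumr basic_vertex_suml.
have [n nP] := sandwich_radical_pow M K.
have [|x [_ xn]] := @radical_approximable n (y - d) Nyd.
  by rewrite mulrBr mulrBl ey ed.
have xE : y - d = theta x by apply/subr0_eq/(nP n).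
exists (x + \sum_v c v *: pterm 1 (@empty_path Q v)).
rewrite path_evalD -xE path_eval_sum.
rewrite (_ : \sum_v theta _ = d) ?subrK //; apply: eq_bigr => v _.
by rewrite path_evalZ path_eval_pterm scale1r path_value_empty.
Qed.

End ResidueSide.

Section LiftedBasicIdempotent.
Variables (O : idomainType) (F k : fieldType).
Variables (iota : {rmorphism O -> F}) (rho : {rmorphism O -> k}).
Variables (p : nat) (pi : O).
Hypothesis sys : complete_system iota rho p pi.
Hypothesis p_prime : prime p.
Variable M : finMonoidType.
Hypothesis nonmod : ~ modular M p.
Hypothesis splitk : splitting_field (monoid_algebra M k).
Local Notation A := (monoid_algebra M O).
Local Notation red := (@map_ma M O k rho).
Local Notation ext := (@map_ma M O F iota).

Variables (s t : nat) (z : 'I_s -> A).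
Hypothesis z_idem : forall i, z i * z i = z i.
Hypothesis z_sum : \sum_i z i = 1.
Hypothesis red_prim : forall i, primitive_idempotent (red (z i)).
Hypothesis red_all : forall x, primitive_idempotent x ->
  exists2 i : 'I_s, (i < t)%N & conjugate (red (z i)) x.

(** In the local corner at [x], the identity is the sum of the [x * ext (z i) * x], so one of them
    is a unit and [x] is isomorphic to [ext (z i)]. Over [k] this [z i] is conjugate to some [z j]
    with [j < t], and the isomorphism lifts. *)
Lemma lifted_conjugate_all (x : monoid_algebra M F) : primitive_idempotent x ->
  exists2 i : 'I_s, (i < t)%N & conjugate (ext (z i)) x.
Proof.
move=> px; have [xx x0 _] := px.
have piF : pi_regular (monoid_algebra M F) by exact: monoid_algebra_pi_regular.
have [|||i [c [xc cx xzc czx]]] := @corner_unit_sum _ x _ (index_enum 'I_s)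
    (fun i => x * ext (z i) * x) piF px.
- by move=> i; rewrite !mulrA xx.
- by move=> i; rewrite -!mulrA xx.
- exists x; split; rewrite ?xx // -mulr_suml -mulr_sumr -map_ma_sum z_sum map_ma1 mulr1 xx //.
have zz := ext_idem iota (z_idem i).
have xi : iso_idem x (ext (z i)).
  apply: (@primitive_iso_of_nonzero _ _ _ (x * ext (z i)) (ext (z i) * x * c)) => //.
  - exact: (lifted_primitive sys p_prime nonmod splitk).
  - by rewrite mulrA xx.
  - by rewrite -mulrA zz.
  - by rewrite !mulrA zz.
  - by rewrite -!mulrA cx.
  by rewrite -[RHS]xzc !mulrA -[x * _ * ext _]mulrA zz.
have [j jt cij] := red_all (red_prim i); exists j => //.
apply: conjugate_of_iso => //; first exact: (lifted_primitive sys p_prime nonmod splitk).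
apply: iso_idem_trans (iso_idem_sym xi); apply: iso_idem_map.
apply: (iso_lift sys) => //; apply: conjugate_iso cij.
by have [] := red_prim j.
Qed.

End LiftedBasicIdempotent.

(** * The presentation over O and its two base changes *)

Section LiftedPresentation.
Variables (O : idomainType) (F k : fieldType).
Variables (iota : {rmorphism O -> F}) (rho : {rmorphism O -> k}).
Variables (p : nat) (pi : O).
Hypothesis sys : complete_system iota rho p pi.
Hypothesis p_prime : prime p.
Variable M : finMonoidType.
Hypothesis nonmod : ~ modular M p.
Local Notation A := (monoid_algebra M O).
Local Notation red := (@map_ma M O k rho).
Local Notation ext := (@map_ma M O F iota).
Variables (Q : quiver) (ev : vertex Q -> A) (al : arrow Q -> A) (te : idem A).
Hypothesis ev_idem : forall v, ev v * ev v = ev v.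
Hypothesis ev_orth : forall v w, v != w -> ev v * ev w = 0.
Hypothesis al_src : forall a, al a * ev (src a) = al a.
Hypothesis al_tgt : forall a, ev (tgt a) * al a = al a.
Hypothesis al_radical : forall a, sandwich_radical (al a).
Hypothesis red_neq0 : forall v, red (ev v) != 0.
Hypothesis red_free : forall c : arrow Q -> k,
  radical_square (\sum_a c a *: red (al a)) -> forall a, c a = 0.
Hypothesis teE : val te = \sum_v ev v.
Local Notation I := (eval_ideal ev_idem ev_orth al_src).
Local Notation theta := (path_eval ev al).
Local Notation theta_of h :=
  (path_eval (fun v => map_ma h (ev v)) (fun a => map_ma h (al a))).
Hypothesis red_surj : forall x, red (val te) * x * red (val te) = x ->
  exists y, theta_of rho y = x.

Let te_idem : val te * val te = val te := idem_mul te.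
Let theta_corner := path_eval_corner ev_idem ev_orth al_src teE.

Let theta_surj x : val te * x * val te = x -> exists y, theta y = x.
Proof. exact: (path_eval_surj sys te_idem theta_corner red_surj). Qed.

Section Map.
Variables (S : fieldType) (h : {rmorphism O -> S}).

Let map_idem_ev v : map_ma h (ev v) * map_ma h (ev v) = map_ma h (ev v).
Proof. by rewrite -map_maM ev_idem. Qed.

Let map_orth v w : v != w -> map_ma h (ev v) * map_ma h (ev w) = 0.
Proof. by move=> vw; rewrite -map_maM ev_orth // map_ma0. Qed.

Let map_src a : map_ma h (al a) * map_ma h (ev (src a)) = map_ma h (al a).
Proof. by rewrite -map_maM al_src. Qed.

Lemma map_presents_corner (J : ideal (path_algebra S Q)) :
  (forall x, J x <-> theta_of h x = 0) ->
  (forall x, map_ma h (val te) * x * map_ma h (val te) = x -> exists y, theta_of h y = x) ->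
  presents_corner J (map_idem h te).
Proof.
move=> JP surj; apply: (quot_eval_rmorphism map_idem_ev map_orth map_src) JP _ => //.
by rewrite /= teE map_ma_sum.
Qed.

End Map.

Lemma map_admissible (K : fieldType) (h : {rmorphism O -> K}) (J : ideal (path_algebra K Q)) :
  (forall v, map_ma h (ev v) != 0) ->
  (forall c : arrow Q -> K,
     radical_square (\sum_a c a *: map_ma h (al a)) -> forall a, c a = 0) ->
  (forall x, J x <-> theta_of h x = 0) -> admissible J.
Proof.
move=> ev0 free; apply: path_eval_admissible => //.
- by move=> v; rewrite -map_maM ev_idem.
- by move=> v w vw; rewrite -map_maM ev_orth // map_ma0.
- by move=> a; rewrite -map_maM al_src.
- by move=> a; rewrite -map_maM al_tgt.
by move=> a; apply: map_ma_radical.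
Qed.

Lemma fraction_path_eval_surj x : ext (val te) * x * ext (val te) = x ->
  exists y, theta_of iota y = x.
Proof.
move=> xE; have EE : ext (val te) * ext (val te) = ext (val te) by rewrite -map_maM te_idem.
have [||d [y [d0 ty yt dy]]] := @ext_corner _ _ _ _ _ _ _ sys M (val te) (val te) x.
- by rewrite -xE !mulrA EE.
- by rewrite -xE -!mulrA EE.
have [w wE] : exists w, theta w = y by apply: theta_surj; rewrite ty yt.
exists ((iota d)^-1 *: map_pa iota w).
by rewrite path_evalZ map_path_eval wE -dy scalerA mulVf ?scale1r // (iota_neq0 sys).
Qed.

Lemma lifted_presentation : exists J : ideal (path_algebra O Q),
  [/\ natural_map_injective iota J, admissible (base_change iota J) &
      presents_corner (base_change iota J) (map_idem iota te)] /\
  [/\ natural_map_injective rho J, admissible (base_change rho J) &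
      presents_corner (base_change rho J) (map_idem rho te)].
Proof.
have ev0 v : ev v != 0.
  by apply: contra (red_neq0 v) => /eqP->; rewrite map_ma0.
have kerF := base_change_fraction sys ev_idem ev_orth al_src.
have kerk := base_change_residue sys ev_idem ev_orth al_src theta_corner theta_surj.
exists I; split; split.
- exact: (natural_map_injective_fraction sys).
- apply: map_admissible kerF.
    move=> v; apply: contra (ev0 v) => /eqP v0; apply/eqP.
    by apply: (map_ma_inj (fraction_inj sys)); rewrite v0 map_ma0.
  exact: (fraction_free sys p_prime nonmod red_free).
- exact: map_presents_corner kerF fraction_path_eval_surj.
- exact: (natural_map_injective_residue sys).
- exact: map_admissible kerk.
exact: map_presents_corner kerk red_surj.
Qed.

End LiftedPresentation.

Lemma sum_orthogonal_idem (A : pzRingType) (I : finType) (P : pred I) (x : I -> A) :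
  (forall i, x i * x i = x i) -> (forall i j, i != j -> x i * x j = 0) ->
  (\sum_(i | P i) x i) * (\sum_(i | P i) x i) = \sum_(i | P i) x i.
Proof.
move=> xx xo; rewrite {1}mulr_suml; apply: eq_bigr => i Pi.
rewrite mulr_sumr (bigD1 i) //= xx big1 ?addr0 // => j /andP[_ ji].
by rewrite xo // eq_sym.
Qed.

Theorem theorem4p7 (M : finMonoidType) (p : nat) (p_prime : prime p)
  (p_nonmodular : ~ modular M p)
  (O : idomainType) (F k : fieldType)
  (iota : {rmorphism O -> F}) (rho : {rmorphism O -> k})
  (system : modular_system p iota rho)
  (splitF : splitting_field (monoid_algebra M F))
  (splitk : splitting_field (monoid_algebra M k))
  (e : idem (monoid_algebra M k)) (e_basic : basic_idempotent (val e)) :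
  exists te : idem (monoid_algebra M O),
    [/\ map_idem rho te = e,
        basic_idempotent (val (map_idem iota te)) &
        exists (Q : quiver) (I : ideal (path_algebra O Q)),
          [/\ natural_map_injective iota I,
              admissible (base_change iota I) &
              presents_corner (base_change iota I) (map_idem iota te)] /\
          [/\ natural_map_injective rho I,
              admissible (base_change rho I) &
              presents_corner (base_change rho I) e]].
Proof.
have [pi sys] := modular_system_complete system.
have [s [t [eps [ts eps1 prim orth [nonconj all eE]]]]] := e_basic.
have eps_idem i : eps i * eps i = eps i by have [] := prim i.
have [z [z_idem z_orth zE z1]] := complete_orthogonal_lift sys eps_idem orth eps1.
have zred : (fun i => map_ma rho (z i)) = eps by apply: functional_extensionality_dep.
have GK := residue_card_neq0 sys p_nonmodular.
pose te0 := \sum_(i < s | (i < t)%N) z i.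
have te_idem : te0 * te0 == te0 by apply/eqP/sum_orthogonal_idem.
pose te : idem (monoid_algebra M O) := exist (fun x => x * x == x) te0 te_idem.
have te_e : map_idem rho te = e.
  by apply: val_inj; rewrite /= map_ma_sum eE; apply: eq_bigr => i _; rewrite zE.
exists te; split=> //.
  have zprim i : primitive_idempotent (map_ma rho (z i)) by rewrite zE.
  exists s, t, (fun i => map_ma iota (z i)); split=> //.
  - by rewrite -map_ma_sum z1 map_ma1.
  - by move=> i; apply: (lifted_primitive sys p_prime p_nonmodular splitk).
  - by move=> i j ij; rewrite -map_maM z_orth // map_ma0.
  split; last by rewrite /= map_ma_sum.
    move=> i j it jt ij; apply: (lifted_nonconjugate sys p_prime p_nonmodular splitk) => //.
    by rewrite !zE; apply: nonconj.
  move=> x /(lifted_conjugate_all sys p_prime p_nonmodular splitk (t := t) z_idem z1 zprim).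
  by apply=> y /all[i it iy]; exists i; rewrite ?zE.
pose Q := basic_quiver ts eps.
have lift_al (a : arrow Q) : exists n : monoid_algebra M O,
    map_ma rho n = arrow_elt a /\ sandwich_radical n.
  have [n nE Nn] := lift_radical sys p_prime p_nonmodular (arrow_elt_radical a).
  by exists n.
pose n a := sval (cid (lift_al a)).
have nE a : map_ma rho (n a) = arrow_elt a by have [] := svalP (cid (lift_al a)).
have nN a : sandwich_radical (n a) by have [] := svalP (cid (lift_al a)).
pose ev (v : vertex Q) := z (widen_ord ts v).
(* A radical lift of an arrow need not respect the vertices; cutting it by the lifted idempotents
   achieves this and leaves its reduction unchanged. *)
pose al a := ev (tgt a) * n a * ev (src a).
have evE : (fun v => map_ma rho (ev v)) = basic_vertex ts eps.
  by apply: functional_extensionality_dep => v; apply: zE.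
have alE : (fun a => map_ma rho (al a)) = @arrow_elt _ _ _ _ ts eps.
  apply: functional_extensionality_dep => a.
  by rewrite !map_maM !zE nE (arrow_elt_tgt a) (arrow_elt_src a).
have teE : val te = \sum_v ev v.
  by rewrite /= /te0 (big_ord_narrow ts).
have redE : map_ma rho (val te) = \sum_v basic_vertex ts eps v.
  by rewrite teE map_ma_sum -evE.
exists Q; rewrite -te_e.
apply: (@lifted_presentation _ _ _ _ _ _ _ sys p_prime M p_nonmodular Q ev al te).
- by move=> v; apply: z_idem.
- by move=> v w vw; apply: z_orth.
- by move=> a; rewrite /al -mulrA z_idem.
- by move=> a; rewrite /al !mulrA z_idem.
- by move=> a; apply: sandwich_radicalM.
- by move=> v; rewrite zE; have [] := prim (widen_ord ts v).
- move=> c; rewrite (_ : \sum_a _ = \sum_a c a *: arrow_elt a); first exact: arrow_elt_free.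
  by apply: eq_bigr => a _; rewrite -alE.
- by [].
move=> x; rewrite redE evE alE; exact: basic_path_eval_surj.
Qed.
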